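(* Let $m>0$, let $f:\mathbb{R}\to\mathbb{R}_+$ be a smooth, compactly supported, positive (i.e. nonnegative) even function with $f(0)=1$, and let $V:\mathbb{R}\to\mathbb{R}$ be a smooth bounded function with all derivatives bounded. Let $\xi$ be a Gaussian white noise on $\mathbb{R}$ and let $\phi$ be the solution of $$\partial_t\phi(t)+m^2\phi(t)+f(t)V'(\phi(t))=\xi(t),\qquad t\in\mathbb{R},$$ that coincides for sufficiently negative times with the stationary Ornstein--Uhlenbeck process $\varphi=\mathcal{G}\ast\xi$. Then for any bounded measurable function $F:\mathbb{R}\to\mathbb{R}$, $$\mathbb{E}\left[F(\phi(0))\,e^{-2\int_{-\infty}^0 f'(t)V(\phi(t))\,\mathrm{d}t}\right]=\mathcal{Z}\int_{\mathbb{R}}F(x)\,e^{-m^2x^2-2V(x)}\,\mathrm{d}x,$$ where $$\mathcal{Z}=\frac{\mathbb{E}\left[e^{-2\int_{-\infty}^0 f'(t)V(\phi(t))\,\mathrm{d}t}\right]}{\int_{\mathbb{R}}e^{-m^2x^2-2V(x)}\,\mathrm{d}x}.$$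
   Context: $\mathcal{G}(t)=e^{-m^2t}\,\mathbb{I}_{t>0}$, and $\varphi=\mathcal{G}\ast\xi$ is the stationary Ornstein--Uhlenbeck process, i.e. the centered Gaussian process on $\mathbb{R}$ with covariance $\frac{1}{2m^2}e^{-m^2|t-s|}$. The solution $\phi:\mathbb{R}\to\mathbb{R}$ is the unique (continuous) process satisfying the integral equation $\phi(t)+\mathcal{G}\ast(fV'(\phi))(t)=\varphi(t)$ for all $t\in\mathbb{R}$; since $f$ has compact support, it coincides with $\varphi$ for sufficiently negative times. *)

(* Defs.v *)
From HB Require Import structures.
From mathcomp Require Import all_boot all_order all_algebra.
From mathcomp Require Import all_classical all_reals all_analysis.

Set Implicit Arguments.
Unset Strict Implicit.
Unset Printing Implicit Defensive.

Import Order.TTheory GRing.Theory Num.Theory.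
Import numFieldNormedType.Exports.
Local Open Scope classical_set_scope.
Local Open Scope ring_scope.

Definition smooth (R : realType) (g : R -> R) : Prop :=
  forall (n : nat) (x : R), derivable (g^`(n))%classic x 1.

Definition compactly_supported (R : realType) (g : R -> R) : Prop :=
  compact (closure [set x : R | g x != 0]).

Definition bounded_fct (R : realType) (g : R -> R) : Prop :=
  exists M : R, forall x : R, `|g x| <= M.

(* [normal_prob mu 0] is the uniform law on [0, 1], so the degenerate Gaussian
   has to be treated separately. *)
Definition gaussian_law (R : realType) (mu sigma : R) (A : set R) : \bar R :=
  if sigma == 0 then \d_mu A else normal_prob mu sigma A.

Definition gaussian_rv d (T : measurableType d) (R : realType)
    (P : probability T R) (X : T -> R) : Prop :=
  measurable_fun setT X /\
  exists mu sigma : R, 0 <= sigma /\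
    forall A : set R, measurable A -> P (X @^-1` A) = gaussian_law mu sigma A.

(* [xi h] is the pairing of the noise with [h]; it is only constrained for
   square-integrable [h].  The family is not indexed by equivalence classes:
   almost-sure linearity in [h] and invariance under a.e. equality follow from
   the covariance. *)
Record white_noise d (T : measurableType d) (R : realType)
    (P : probability T R) (xi : (R -> R) -> {RV P >-> R}) : Prop := WhiteNoise {
  white_noise_gaussian :
    forall (n : nat) (h : 'I_n -> R -> R) (c : 'I_n -> R),
      (forall k, h k \in Lfun (@lebesgue_measure R) 2%:E) ->
      gaussian_rv P (fun w => \sum_(k < n) c k * xi (h k) w);
  white_noise_centered :
    forall h : R -> R, h \in Lfun (@lebesgue_measure R) 2%:E ->
      ('E_P[xi h] = 0)%E;
  white_noise_covariance :
    forall g h : R -> R,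
      g \in Lfun (@lebesgue_measure R) 2%:E ->
      h \in Lfun (@lebesgue_measure R) 2%:E ->
      ('E_P[fun w => (xi g w * xi h w)%R])%E =
        (\int[@lebesgue_measure R]_s (g s * h s))%:E
}.

Definition OU_kernel (R : realType) (m t : R) : R :=
  if 0 < t then expR (- m ^+ 2 * t) else 0.

Definition convolution (R : realType) (g h : R -> R) (t : R) : R :=
  \int[@lebesgue_measure R]_s (g (t - s) * h s).

Definition continuous_process d (T : measurableType d) (R : realType)
    (P : probability T R) (X : R -> {RV P >-> R}) : Prop :=
  {ae P, forall w, continuous (fun t : R => X t w)}.

(* The continuous modification of the convolution of the kernel with [xi]. *)
Definition stationary_OU d (T : measurableType d) (R : realType)
    (P : probability T R) (m : R) (xi : (R -> R) -> {RV P >-> R})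
    (ou : R -> {RV P >-> R}) : Prop :=
  continuous_process ou /\
  forall t : R, {ae P, forall w, ou t w = xi (fun s => OU_kernel m (t - s)) w}.

(* Mild form of [phi' + m^2 phi + f V'(phi) = xi].  It forces [phi t = ou t] for
   all [t] to the left of the support of [f], since [OU_kernel] vanishes on
   nonpositive times. *)
Definition mild_solution d (T : measurableType d) (R : realType)
    (P : probability T R) (m : R) (f V : R -> R)
    (ou phi : R -> {RV P >-> R}) : Prop :=
  continuous_process phi /\
  {ae P, forall w, forall t : R,
    phi t w + convolution (OU_kernel m) (fun s => f s * (V^`())%classic (phi s w)) t
    = ou t w}.

(* Main.v *)
(* Time is discretised with step h.  Sampled on the grid, the Ornstein-Uhlenbeck
   process is an autoregressive chain with independent Gaussian innovations, and
   the Euler scheme X' = a X - s^2 f V'(X) + Y for phi is reversible for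
   exp(- m^2 x^2 - 2 f V(x)) up to errors of order h^(3/2); reweighting by
   exp(- 2 (f(t + h) - f(t)) V) turns this density into the one of the next grid
   time.  Since f vanishes initially, the density starts from the stationary
   Gaussian law, so the product of the weights transports it to exp(- m^2 x^2 -
   2 V(x)) at time 0, where f = 1, up to an error of order h^(1/2).  As h tends
   to 0, a Gronwall argument gives the pathwise convergence of X to phi and of
   the product of the weights to exp(- 2 int f' V(phi)).  Independence of the
   innovations is only used through their joint characteristic function. *)

Require Import Defs.
From HB Require Import structures.
From mathcomp Require Import all_boot all_order all_algebra.
From mathcomp Require Import all_classical all_reals all_analysis.
From mathcomp Require Import measurable_realfun.
From mathcomp Require Import ring lra.

Set Implicit Arguments.
Unset Strict Implicit.
Unset Printing Implicit Defensive.

Import Order.TTheory GRing.Theory Num.Theory.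
Import numFieldNormedType.Exports.
Local Open Scope classical_set_scope.
Local Open Scope ring_scope.

(** * Integrals and image measures *)

(** Discretisation replaces stochastic calculus: the noise is known only through the Gaussian laws
    of its pairings, without filtration or conditional expectation, so the Markov property has to be
    recovered from characteristic functions. About [1 / h] one-step errors are added, so each must
    be [o(h)]. They are, because the linear part is sampled exactly, which makes its Gaussian
    transition exactly reversible, and because the gradient drift then leaves a trapezoidal-rule
    remainder, cubic in increments of order [h^(1/2)]. The one-step estimate is stated for
    measurable test functions with values in [[0, 1]], a class that the weighted transition operator
    preserves up to normalisation, so that it can be iterated. The limit in [h] only passes through
    continuous test functions; measurable [F] are reached at the very end, by uniqueness of
    measures. The constant is inherited from the initial law, of density [c0 * exp(- m^2 x^2)]: the
    limit identity first appears with the explicit factor [c0], and the choice [F = 1] then shows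
    that [Z = c0]. *)

Lemma Rintegral_dominated_cvg d (T : measurableType d) (R : realType)
    (mu : {measure set T -> \bar R}) (f_ : nat -> T -> R) (f g : T -> R) :
  (forall n, measurable_fun setT (f_ n)) -> measurable_fun setT f ->
  {ae mu, forall x, f_ n x @[n --> \oo] --> f x} ->
  mu.-integrable setT (EFin \o g) ->
  {ae mu, forall x n, `|f_ n x| <= g x} ->
  \int[mu]_x f_ n x @[n --> \oo] --> \int[mu]_x f x.
Proof.
move=> mf_ mf ff ig fg.
have [if_ _ c] : [/\ mu.-integrable setT (EFin \o f),
    [sequence \int[mu]_x `|(EFin \o f_ n) x - (EFin \o f) x|]_n @ \oo --> 0 &
    [sequence \int[mu]_x (EFin \o f_ n) x]_n @ \oo --> \int[mu]_x (EFin \o f) x]%E.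
  apply: (@dominated_convergence _ _ _ _ _ _ _ _ (EFin \o g)) => //.
  - by move=> n; exact/measurable_EFinP.
  - exact/measurable_EFinP.
  - by apply: filterS ff => x fx _; apply: cvg_EFin => //; exact: nearW.
  - by apply: filterS fg => x fx n _ /=; rewrite lee_fin.
apply: fine_cvg; rewrite /Rintegral fineK//; exact: integrable_fin_num.
Qed.

Section density.
Local Open Scope ereal_scope.
Context d (T : measurableType d) (R : realType).
Import HBNNSimple.

(** The hypothesis is the case of indicators; simple functions and monotone convergence on both
    sides give the rest. *)
Lemma ge0_integral_density (mu nu : {measure set T -> \bar R}) (g : T -> R)
    (f : T -> \bar R) :
  measurable_fun setT g -> (forall x, (0 <= g x)%R) ->
  (forall A, measurable A -> nu A = \int[mu]_(x in A) (g x)%:E) ->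
  measurable_fun setT f -> (forall x, 0 <= f x) ->
  \int[nu]_x f x = \int[mu]_x (f x * (g x)%:E).
Proof.
move=> mg g0 nuE mf f0.
pose h := nnsfun_approx measurableT mf.
have mh n : measurable_fun setT (EFin \o h n) by exact/measurable_EFinP.
have hf x : (EFin \o h n) x @[n --> \oo] --> f x.
  exact: (@cvg_nnsfun_approx _ _ _ _ measurableT f mf).
have -> : \int[nu]_x f x = lim (\int[nu]_x (EFin \o h n) x @[n --> \oo]).
  rewrite -monotone_convergence//.
  - by apply: eq_integral => x _; apply/esym/cvg_lim => //.
  - by move=> n x _; rewrite lee_fin.
  - by move=> x _ a b ab; rewrite lee_fin; exact/lefP/nd_nnsfun_approx.
have -> : \int[mu]_x (f x * (g x)%:E) =
    lim (\int[mu]_x ((EFin \o h n) x * (g x)%:E) @[n --> \oo]).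
  rewrite -monotone_convergence//.
  - by apply: eq_integral => x _; apply/esym/cvg_lim => //; exact: cvgeZr.
  - by move=> n; apply: emeasurable_funM => //; exact/measurable_EFinP.
  - by move=> n x _; rewrite mule_ge0 ?lee_fin.
  - move=> x _ a b ab; rewrite lee_wpmul2r ?lee_fin//.
    exact/lefP/nd_nnsfun_approx.
congr (lim _); apply: congr2 => //; apply/funext => n.
have mi y : measurable_fun setT (fun x => (y * \1_(h n @^-1` [set y]) x)%:E).
  by apply/measurable_EFinP; exact: measurable_funM.
transitivity (\int[nu]_x
   (\sum_(y \in range (h n)) (y * \1_(h n @^-1` [set y]) x)%:E)).
  by apply: eq_integral => t _; rewrite /= fimfunE -fsumEFin.
rewrite ge0_integral_fsum//; last by move=> m y Ey; exact: nnfun_muleindic_ge0.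
transitivity (\int[mu]_x (\sum_(y \in range (h n))
    (y * \1_(h n @^-1` [set y]) x)%:E * (g x)%:E)); last first.
  apply: eq_integral => x xE.
  rewrite -ge0_mule_fsuml => [|y]; last exact: nnfun_muleindic_ge0.
  by rewrite fsumEFin // -(fimfunE _ x).
rewrite ge0_integral_fsum//; last 2 first.
  - move=> y; apply: emeasurable_funM => //; exact/measurable_EFinP.
  - by move=> m y Ey; rewrite mule_ge0 ?lee_fin// -lee_fin nnfun_muleindic_ge0.
apply: eq_fsbigr => r /[!inE] -[t _ tr].
have r0 : (0 <= r)%R by rewrite -tr.
under [RHS]eq_integral do rewrite EFinM -muleA.
rewrite integralZl_indic_nnsfun// [RHS]ge0_integralZl//; last 2 first.
- apply: emeasurable_funM; exact/measurable_EFinP.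
- by move=> x _; rewrite mule_ge0 ?lee_fin.
congr (_ * _); rewrite integral_indic// setIT nuE//.
rewrite integral_mkcond; apply: eq_integral => x _.
by rewrite epatch_indic muleC.
Qed.

End density.

Section weighted_image.
Local Open Scope ereal_scope.
Context d (T : measurableType d) d' (T' : measurableType d') (R : realType).
Variables (mu : {measure set T -> \bar R}) (g : {mfun T >-> R}).

(** The absolute value makes this a measure for every [g], so that the canonical instance carries no
    sign hypothesis. *)
Definition density_measure (A : set T) : \bar R :=
  \int[mu]_(x in A) `|g x|%:E.

Let mg A : measurable_fun A (fun x => `|g x|%:E).
Proof. by apply: measurable_funTS; apply/measurable_EFinP/measurableT_comp. Qed.

Let density0 : density_measure set0 = 0.
Proof. by rewrite /density_measure integral_set0. Qed.

Let density_ge0 A : 0 <= density_measure A.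
Proof. by apply: integral_ge0 => x _; rewrite lee_fin. Qed.

Let density_sigma_additive : semi_sigma_additive density_measure.
Proof.
move=> A mA tA mUA; rewrite /density_measure ge0_integral_bigcup//.
by apply: is_cvg_ereal_nneg_natsum_cond => n _ _; exact: density_ge0.
Qed.

HB.instance Definition _ := isMeasure.Build _ _ _
  density_measure density0 density_ge0 density_sigma_additive.

End weighted_image.

(** [nu] is the image under [Y] of the measure of density [g]. Only its integrals are exposed; this
    is how a weighted law becomes a measure to which uniqueness theorems apply. *)
Lemma ge0_weighted_image d (T : measurableType d) d' (T' : measurableType d')
    (R : realType) (mu : {measure set T -> \bar R}) (g : T -> R) (Y : T -> T') :
  measurable_fun setT g -> (forall x, 0 <= g x) -> measurable_fun setT Y ->
  exists nu : {measure set T' -> \bar R},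
    forall f : T' -> \bar R, measurable_fun setT f -> (forall y, 0 <= f y)%E ->
      (\int[nu]_y f y = \int[mu]_x (f (Y x) * (g x)%:E))%E.
Proof.
move=> mg g0 mY.
pose G : {mfun T >-> R} := mfun_Sub (mem_set mg).
pose m := density_measure mu G.
unshelve refine (ex_intro _ [the measure _ _ of pushforward m Y] _) => //.
move=> f mf f0.
rewrite (ge0_integral_pushforward mY) ?preimage_setT//.
rewrite (@ge0_integral_density _ _ _ mu _ g)//=.
- by move=> A mA; apply: eq_integral => x _; rewrite ger0_norm.
- exact: measurableT_comp.
Qed.

(** Closed half-lines are stable under intersection, generate the Borel sets, and those starting at
    [- n] exhaust the line. *)
Lemma half_line_measure_unique (R : realType)
    (mu nu : {measure set (measurableTypeR R) -> \bar R}) :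
  (forall b : R, mu `[b, +oo[%classic = nu `[b, +oo[%classic) ->
  (forall b : R, mu `[b, +oo[%classic < +oo)%E ->
  forall A, measurable A -> mu A = nu A.
Proof.
move=> munu muoo A mA.
apply: (@measure_unique _ R (measurableTypeR R) (@RGenCInfty.G R)
  (fun n : nat => `[- n%:R, +oo[%classic)) => //.
- exact: RGenCInfty.measurableE.
- move=> _ _ [x ->] [y ->]; exists (Num.max x y).
  apply/seteqP; split => z /=; rewrite !in_itv/= !andbT ge_max.
    by move=> [-> ->].
  by move=> /andP[].
- by move=> i; exists (- i%:R).
- apply/seteqP; split => // x _; exists (Num.Def.archi_bound `|x|) => //=.
  rewrite in_itv/= andbT lerNl (le_trans (ler_norm _))// normrN ltW//.
  exact: archi_boundP.
- by move=> _ [x ->]; exact: munu.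
Qed.

Lemma integral_density d (T : measurableType d) (R : realType)
    (mu nu : {measure set T -> \bar R}) (g : T -> R) (f : T -> \bar R) :
  measurable_fun setT g -> (forall x, 0 <= g x) ->
  (forall A, measurable A -> nu A = \int[mu]_(x in A) (g x)%:E)%E ->
  measurable_fun setT f ->
  (\int[nu]_x f x = \int[mu]_x (f x * (g x)%:E))%E.
Proof.
move=> mg g0 nuE mf; rewrite integralE [RHS]integralE; congr (_ - _)%E.
- rewrite (ge0_integral_density mg g0 nuE)//; last exact: measurable_funepos.
  apply: eq_integral => x _; rewrite !funeposE !(muleC _ (g x)%:E).
  rewrite maxe_pMr ?lee_fin//. rewrite mule0//.
- rewrite (ge0_integral_density mg g0 nuE)//; last exact: measurable_funeneg.
  apply: eq_integral => x _; rewrite !funenegE !(muleC _ (g x)%:E).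
  by rewrite maxe_pMr ?lee_fin// mule0 muleN.
Qed.

(** * Gaussian integrals *)

Section normal_pdf_calculus.
Context (R : realType) (m s : R).
Hypothesis s0 : s != 0.
Local Notation p := (normal_pdf m s).

Lemma normal_pdf_expR x :
  p x = normal_peak s * expR (- (x - m) ^+ 2 / (s ^+ 2 *+ 2)).
Proof. by rewrite normal_pdfE. Qed.

Lemma is_derive_normal_pdf (x : R) :
  is_derive x 1 p (- ((x - m) / s ^+ 2 * p x)).
Proof.
rewrite (_ : p = fun x : R => normal_peak s * expR (- (x - m) ^+ 2 / (s ^+ 2 *+ 2))); last first.
  by apply/funext => y; exact: normal_pdf_expR.
apply: is_derive_eq.
rewrite /GRing.scale/= !(mulr0, mul0r, addr0, mulr1).
by field.
Qed.

(** Doubling the standard deviation frees a factor [expR (- (3 / 8) * (x - m) ^+ 2 / s ^+ 2)], which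
    absorbs the quadratic polynomial through [1 + t <= expR t]. *)
Lemma normal_pdf_sqr_bound x :
  (1 + (x - m) ^+ 2) * p x <=
  (1 + 3 * s ^+ 2) * (normal_peak s / normal_peak (2 * s)) *
    normal_pdf m (2 * s) x.
Proof.
have s20 : 2 * s != 0 by rewrite mulf_neq0.
rewrite normal_pdf_expR normal_pdfE// mulrCA -[leRHS]mulrA -(mulrA (normal_peak s)).
rewrite (mulrA _ (normal_peak (2 * s))) mulVf ?gt_eqF ?normal_peak_gt0// mul1r.
rewrite [leRHS]mulrCA ler_wpM2l ?normal_peak_ge0//.
rewrite /normal_fun.
set y := x - m.
have -> : - y ^+ 2 / (s ^+ 2 *+ 2) =
   - y ^+ 2 / ((2 * s) ^+ 2 *+ 2) - y ^+ 2 / s ^+ 2 * (3 / 8) by field.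
rewrite expRD (mulrC (expR _)) mulrA ler_wpM2r ?expR_ge0//.
rewrite expRN ler_pdivrMr ?expR_gt0//.
have h : 1 + y ^+ 2 / s ^+ 2 * (3 / 8) <= expR (y ^+ 2 / s ^+ 2 * (3 / 8)).
  exact: expR_ge1Dx.
have hs : 0 < s ^+ 2 by rewrite exprn_even_gt0.
apply: le_trans (ler_wpM2l _ h); last by rewrite addr_ge0// mulr_ge0// ltW.
rewrite (_ : (1 + 3 * s ^+ 2) * (1 + y ^+ 2 / s ^+ 2 * (3 / 8)) =
   1 + y ^+ 2 * (9 / 8)  + 3 * s ^+ 2 + y ^+ 2 / s ^+ 2 * (3 / 8) ); last by field.
have hq : 0 <= y ^+ 2 / s ^+ 2 by rewrite divr_ge0 ?sqr_ge0.
have := sqr_ge0 y; lra.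
Qed.

Lemma integrable_normal_pdf_quadratic (g : R -> R) (C : R) :
  measurable_fun setT g -> (forall x, `|g x| <= C * (1 + (x - m) ^+ 2)) ->
  lebesgue_measure.-integrable setT (fun x => (g x * p x)%:E).
Proof.
move=> mg gC.
pose K := C * ((1 + 3 * s ^+ 2) * (normal_peak s / normal_peak (2 * s))).
have C0 : 0 <= C.
  by rewrite -(pmulr_lge0 _ (_ : 0 < 1 + (m - m) ^+ 2))
    ?(le_trans _ (gC m))// subrr expr0n addr0.
apply: (@le_integrable _ _ R lebesgue_measure setT measurableT _
   (fun x => (K * normal_pdf m (2 * s) x)%:E)).
- apply/measurable_EFinP/measurable_funM => //; exact: measurable_normal_pdf.
- move=> x _ /=; rewrite lee_fin normrM (ger0_norm (normal_pdf_ge0 _ _ _)).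
  apply: le_trans (ler_norm _); apply: (@le_trans _ _ (C * ((1 + (x - m) ^+ 2) * p x))).
    by rewrite mulrA ler_wpM2r ?normal_pdf_ge0.
  by rewrite /K -mulrA ler_wpM2l// normal_pdf_sqr_bound.
- under eq_fun do rewrite EFinM.
  by apply: integrableZl => //; exact: integrable_normal_pdf.
Qed.

End normal_pdf_calculus.

Section integral_derivative.
Context (R : realType).
Local Notation mu := (@lebesgue_measure R).

(** Decay of the primitive along the integers is enough, since the line is exhausted by the
    intervals from [- n.+1] to [n.+1]. *)
Lemma integral_derive_eq0 (G g : R -> R) (K : R) :
  (forall x : R, is_derive x 1 G (g x)) -> continuous g ->
  mu.-integrable setT (EFin \o g) ->
  (forall n : nat, `|G n.+1%:R| <= K * harmonic n) ->
  (forall n : nat, `|G (- n.+1%:R)| <= K * harmonic n) ->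
  \int[mu]_x g x = 0.
Proof.
move=> dG cg ig Gp Gn.
have n0 (n : nat) : - n.+1%:R < n.+1%:R :> R.
  by rewrite (@lt_trans _ _ 0)// ?oppr_lt0 ltr0n.
have cG : continuous G.
  move=> x; apply/differentiable_continuous/derivable1_diffP.
  by have [] := dG x.
pose I n := `[- n.+1%:R, n.+1%:R]%classic : set R.
have FTC n : (\int[mu]_(x in I n) (g x)%:E = (G n.+1%:R)%:E - (G (- n.+1%:R))%:E)%E.
  apply: continuous_FTC2 => //.
  - by apply: continuous_subspaceT.
  - split.
    + by move=> x _; have [] := dG x.
    + by apply: cvg_at_right_filter; exact: cG.
    + by apply: cvg_at_left_filter; exact: cG.
  - by move=> x _; rewrite derive1E; have [_] := dG x.
have mI n : measurable (I n) by exact: measurable_itv.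
have cvg1 : \int[mu]_x ((g \_ (I n)) x) @[n --> \oo] --> \int[mu]_x g x.
  apply: (@Rintegral_dominated_cvg _ _ R mu (fun n => g \_ (I n)) g (fun x => `|g x|)).
  - move=> n; apply/(measurable_restrictT _ (mI n)).
    exact: measurable_funTS (continuous_measurable_fun cg).
  - exact: continuous_measurable_fun.
  - apply: aeW => x; apply: cvg_near_cst.
    exists (Num.Def.archi_bound `|x|) => // n /= xn.
    rewrite patchE mem_set// /I/= in_itv/= -ler_norml ltW//.
    rewrite (lt_le_trans (archi_boundP _))// ler_nat.
    exact: leq_trans xn _.
  - exact: integrable_norm.
  - by apply: aeW => x n; rewrite patchE; case: ifPn => // _; rewrite normr0.
have cvg2 : (G n.+1%:R - G (- n.+1%:R)) @[n --> \oo] --> (0 : R).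
  have ch : (K + K) * harmonic n @[n --> \oo] --> (0 : R).
    by rewrite -(mulr0 (K + K)); apply: cvgM; [exact: cvg_cst|exact: cvg_harmonic].
  apply: norm_cvg0; apply: (squeeze_cvgr _ (cvg_cst 0) ch).
  apply: nearW => n; rewrite normr_ge0/= mulrDl (le_trans (ler_normB _ _))//.
  by rewrite lerD.
rewrite (_ : (fun n => _) = (fun n => G n.+1%:R - G (- n.+1%:R))) in cvg1.
  exact: (cvg_unique _ cvg1 cvg2).
by apply/funext => n; rewrite -Rintegral_mkcond /Rintegral FTC.
Qed.

End integral_derivative.

Section gaussian_integrals.
Context (R : realType) (m s : R).
Hypothesis s0 : s != 0.
Local Notation p := (normal_pdf m s).
Local Notation mu := (@lebesgue_measure R).

Lemma is_derive_continuous (u u' : R -> R) :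
  (forall x : R, is_derive x 1 u (u' x)) -> continuous u.
Proof.
move=> du x; apply/differentiable_continuous/derivable1_diffP.
by have [] := du x.
Qed.

(** Stein's identity: [u * p] has derivative [u' * p - (x - m) / s ^+ 2 * u * p], and the growth
    bound on [u] makes it decay at least like [1 / |x|], so that this derivative has integral 0. *)
Lemma normal_pdf_stein (u u' : R -> R) (C : R) :
  (forall x : R, is_derive x 1 u (u' x)) -> continuous u' ->
  (forall x, `|u x| <= C * (1 + `|x - m|)) ->
  (forall x, `|u' x| <= C * (1 + (x - m) ^+ 2)) ->
  \int[mu]_x (u x * (x - m) * p x) = s ^+ 2 * \int[mu]_x (u' x * p x).
Proof.
move=> du cu' uC u'C.
have cu := is_derive_continuous du.
have C0 : 0 <= C.
  by rewrite -(pmulr_lge0 _ (_ : 0 < 1 + `|m - m|)) ?(le_trans _ (uC m))//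
    subrr normr0 addr0.
have s20 : s ^+ 2 != 0 by rewrite expf_neq0.
have mxm : measurable_fun setT (fun x : R => x - m) by exact: measurable_funB.
have mu' : measurable_fun setT u' by exact: continuous_measurable_fun.
have mu_ : measurable_fun setT u by exact: continuous_measurable_fun.
have absq (y : R) : `|y| * 2 <= 1 + y ^+ 2.
  by have := sqr_ge0 (`|y| - 1); rewrite -(real_normK (num_real y)); lra.
have i1 : mu.-integrable setT (fun x => (u x * (x - m) * p x)%:E).
  apply: (@integrable_normal_pdf_quadratic _ _ _ s0
    (fun x => u x * (x - m)) (2 * C)).
    exact: measurable_funM.
  move=> x; rewrite normrM (le_trans (ler_wpM2r _ (uC x)))//.
  rewrite -(real_normK (num_real (x - m))).
  move: `|x - m| (normr_ge0 (x - m)) => y y0.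
  rewrite -subr_ge0 (_ : _ - _ = C * (1 + (y - 1) ^+ 2 + y)); last by ring.
  by rewrite mulr_ge0// !addr_ge0 ?sqr_ge0.
have i2 : mu.-integrable setT (fun x => (u' x * p x)%:E).
  exact: (@integrable_normal_pdf_quadratic _ _ _ s0 u' C).
pose g := fun x => u' x * p x - s ^- 2 * (u x * (x - m) * p x).
have ig : mu.-integrable setT (EFin \o g).
  rewrite /g /comp; under eq_fun do rewrite EFinB (EFinM (s ^- 2)).
  apply: integrableB => //; exact: integrableZl.
pose B := (1 + 3 * s ^+ 2) * (normal_peak s / normal_peak (2 * s))
   * normal_peak (2 * s).
have pB x : (1 + (x - m) ^+ 2) * p x <= B.
  apply: (le_trans (normal_pdf_sqr_bound _ s0 _)); rewrite ler_wpM2l//.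
    rewrite mulr_ge0 ?divr_ge0 ?normal_peak_ge0//.
    by have := sqr_ge0 s; lra.
  by apply: normal_pdf_ub; rewrite mulf_neq0.
have GB (x : R) : `|x| != 0 -> `|u x * p x| <= 2 * C * (1 + `|m|) * B * `|x|^-1.
  move=> x0; rewrite ler_pdivlMr ?lt0r ?x0//=.
  rewrite normrM (ger0_norm (normal_pdf_ge0 _ _ _)).
  have pB' : 2 * C * (1 + `|m|) * ((1 + (x - m) ^+ 2) * p x) <=
      2 * C * (1 + `|m|) * B.
    by rewrite ler_wpM2l// !mulr_ge0// addr_ge0.
  apply: le_trans pB'; rewrite [leRHS]mulrA mulrAC ler_wpM2r ?normal_pdf_ge0//.
  rewrite (le_trans (ler_wpM2r _ (uC x)))//.
  have xm : `|x| <= `|x - m| + `|m|.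
    by rewrite -[X in `|X| <= _](subrK m) ler_normD.
  rewrite (le_trans (ler_wpM2l _ xm)) ?mulr_ge0 ?addr_ge0//.
  rewrite -(real_normK (num_real (x - m))).
  move: `|x - m| (normr_ge0 (x - m)) `|m| (normr_ge0 m) => y y0 k k0.
  rewrite -subr_ge0 (_ : _ - _ =
     C * (1 + (y - 1) ^+ 2 + y + ((y - 1) ^+ 2 + y + y ^+ 2) * k)); last by ring.
  have q : 0 <= (y - 1) ^+ 2 + y + y ^+ 2 by rewrite !addr_ge0 ?sqr_ge0.
  by rewrite mulr_ge0//; have := mulr_ge0 q k0; have := sqr_ge0 (y - 1); lra.
have h : \int[mu]_x g x = 0.
  apply: (@integral_derive_eq0 _ (fun x => u x * p x) g
     (2 * C * (1 + `|m|) * B)) => //.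
  - move=> x; have dp := is_derive_normal_pdf m s0 x; have dux := du x.
    apply: is_derive_eq; rewrite /g /GRing.scale/=; field.
    by [].
  - move=> x; apply: cvgB.
      by apply: cvgM; [exact: cu'|exact: continuous_normal_pdf].
    apply: cvgM; first exact: cvg_cst.
    apply: cvgM; last exact: continuous_normal_pdf.
    apply: cvgM; first exact: cu.
    by apply: cvgB; [exact: cvg_id|exact: cvg_cst].
  - by move=> n; have := GB n.+1%:R; rewrite normr_nat pnatr_eq0; exact.
  - by move=> n; have := GB (- n.+1%:R); rewrite normrN normr_nat pnatr_eq0; exact.
move: h; rewrite /g RintegralB//; last first.
  rewrite /comp; under eq_fun do rewrite (EFinM (s ^- 2)); exact: integrableZl.
rewrite RintegralZl// => /eqP; rewrite subr_eq0 => /eqP ->.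
by rewrite mulrA divff// mul1r.
Qed.

End gaussian_integrals.

Lemma gaussian_ode (R : realType) (F : R -> R) (k : R) :
  (forall t : R, is_derive t 1 F (- (k * t * F t))) ->
  forall t, F t = F 0 * expR (- (k * t ^+ 2) / 2).
Proof.
move=> dF t.
have h (x : R) : is_derive x 1 (fun x : R => F x * expR (k * x ^+ 2 / 2)) 0.
  have dFx := dF x; apply: is_derive_eq.
  by rewrite /GRing.scale/=; field.
have := @is_derive_0_is_cst _ _ t 0 h.
rewrite expr0n mulr0 mul0r expR0 mulr1 => <-.
by rewrite -mulrA -expRD mulNr subrr expR0 mulr1.
Qed.

Section gaussian_trigonometric_integrals.
Context (R : realType) (m s : R).
Hypothesis s0 : s != 0.
Local Notation p := (normal_pdf m s).
Local Notation mu := (@lebesgue_measure R).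

(** Differentiating under the integral and applying Stein's identity to [c'] gives the equation
    [F' = - s ^+ 2 * t * F]. The pair [(c, c')] is abstract so that cosines of any phase are covered
    at once. *)
Lemma normal_pdf_trigonometric (c c' : R -> R) :
  (forall x : R, is_derive x 1 c (c' x)) ->
  (forall x : R, is_derive x 1 c' (- c x)) ->
  (forall x, `|c x| <= 1) -> (forall x, `|c' x| <= 1) ->
  forall t, \int[mu]_x (c (t * (x - m)) * p x) =
            c 0 * expR (- (s ^+ 2 * t ^+ 2) / 2).
Proof.
move=> dc dc' c1 c'1.
have cc := is_derive_continuous dc.
have cc' := is_derive_continuous dc'.
have caff (t : R) : continuous (fun x : R => t * (x - m)).
  move=> x; apply: cvgM; first exact: cvg_cst.
  by apply: cvgB; [exact: cvg_id|exact: cvg_cst].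
have ccaff (t : R) : continuous (fun x => c (t * (x - m))).
  by move=> x; apply: continuous_comp; [exact: caff|exact: cc].
have ccaff' (t : R) : continuous (fun x => c' (t * (x - m))).
  by move=> x; apply: continuous_comp; [exact: caff|exact: cc'].
have daff (t x : R) : is_derive x 1 (fun x : R => t * (x - m)) t.
  by apply: is_derive_eq; rewrite /GRing.scale/=; ring.
have daff' (t x : R) : is_derive t 1 (fun t : R => t * (x - m)) (x - m).
  by apply: is_derive_eq; rewrite /GRing.scale/=; ring.
pose F t := \int[mu]_x (c (t * (x - m)) * p x).
have intc (t : R) : mu.-integrable setT (EFin \o (fun x => c (t * (x - m)) * p x)).
  apply: (@integrable_normal_pdf_quadratic _ _ _ s0 (fun x => c (t * (x - m))) 1).
    exact: continuous_measurable_fun.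
  by move=> x; rewrite mul1r (le_trans (c1 _))// lerDl sqr_ge0.
have stein (t : R) : \int[mu]_x (c' (t * (x - m)) * (x - m) * p x) = - (s ^+ 2 * t * F t).
  transitivity (s ^+ 2 * \int[mu]_x (- t * c (t * (x - m)) * p x)); last first.
    under eq_Rintegral do rewrite -mulrA.
    by rewrite RintegralZl// -/(F t); ring.
  apply: (@normal_pdf_stein _ _ _ s0 _ _ (1 + `|t|)).
  - move=> x; have dax := daff t x; have dcx := dc' (t * (x - m)).
    rewrite (_ : - t * _ = - c (t * (x - m)) * t); last by ring.
    exact: (@is_derive1_comp _ c' (fun x : R => t * (x - m)) _ _ _ dcx dax).
  - by move=> x; apply: cvgM; [exact: cvg_cst|exact: ccaff].
  - move=> x; rewrite (le_trans (c'1 _))//.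
    by have := mulr_ge0 (normr_ge0 t) (normr_ge0 (x - m)); have := normr_ge0 t;
       have := normr_ge0 (x - m); lra.
  - move=> x; rewrite normrM normrN.
    have := ler_wpM2l (normr_ge0 t) (c1 (t * (x - m))).
    have := mulr_ge0 (normr_ge0 t) (sqr_ge0 (x - m)).
    have := sqr_ge0 (x - m); have := normr_ge0 t; lra.
have F0 : F 0 = c 0.
  rewrite /F; under eq_Rintegral do rewrite mul0r.
  rewrite RintegralZl//; last exact: integrable_normal_pdf.
  by rewrite /Rintegral integral_normal_pdf mulr1.
suff dF (t : R) : is_derive t 1 F (- (s ^+ 2 * t * F t)).
  by move=> t; rewrite -/(F t) -F0; exact: gaussian_ode.
have dfy (x y : R) : is_derive x 1 (fun t : R => c (t * (y - m)) * p y)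
    (c' (x * (y - m)) * (y - m) * p y).
  have dax := daff' x y; have dcx := dc (x * (y - m)).
  have dcc : is_derive x 1 (fun t : R => c (t * (y - m))) (c' (x * (y - m)) * (y - m)).
    exact: (@is_derive1_comp _ c (fun t : R => t * (y - m)) _ _ _ dcx dax).
  by apply: is_derive_eq; rewrite /GRing.scale/=; ring.
have pE x y : partial1of2 (fun t x => c (t * (x - m)) * p x) x y
    = c' (x * (y - m)) * (y - m) * p y.
  by rewrite partial1of2E; have [_] := dfy x y.
pose f t x := c (t * (x - m)) * p x.
pose G y := `|y - m| * p y.
have ta : `]t - 1, t + 1[%classic t.
  by rewrite /= in_itv/= ltrBlDr ltrDl ltr01.
have H1 : mu.-integrable setT (EFin \o G).
  apply: (@integrable_normal_pdf_quadratic _ _ _ s0 (fun x => `|x - m|) 1).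
    by apply: measurableT_comp => //; exact: measurable_funB.
  move=> x; rewrite normr_id mul1r -(real_normK (num_real (x - m))).
  by have := sqr_ge0 (`|x - m| - 1); have := normr_ge0 (x - m); lra.
have H2 x y : `]t - 1, t + 1[%classic x -> setT y -> derivable (f ^~ y) x 1.
  by move=> _ _; have [] := dfy x y.
have H3 x y : `]t - 1, t + 1[%classic x -> setT y -> `|partial1of2 f x y| <= G y.
  move=> _ _; rewrite pE 2!normrM (ger0_norm (normal_pdf_ge0 _ _ _)).
  by rewrite ler_wpM2r ?normal_pdf_ge0// ler_piMl.
have H0 x : `]t - 1, t + 1[%classic x -> mu.-integrable setT (EFin \o f x).
  by move=> _; exact: intc.
have G0 y : 0 <= G y by rewrite mulr_ge0// normal_pdf_ge0.
apply: DeriveDef; first exact: (derivable_under_integral measurableT ta H0 H2 G0 H1 H3).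
rewrite -derive1E.
rewrite (differentiation_under_integral measurableT ta H0 H2 G0 H1 H3).
by rewrite -stein; apply: eq_Rintegral => x _; rewrite pE.
Qed.

End gaussian_trigonometric_integrals.

Lemma integral_normal_prob (R : realType) (m s : R) (f : R -> \bar R) :
  measurable_fun setT f ->
  (\int[normal_prob m s]_x f x =
   \int[@lebesgue_measure R]_x (f x * (normal_pdf m s x)%:E))%E.
Proof.
move=> mf; apply: integral_density => //.
- exact: measurable_normal_pdf.
- by move=> x; exact: normal_pdf_ge0.
Qed.

(** Cosines with a free phase stand for the complex exponential: the phases [0] and [- pi / 2] are
    its real and imaginary parts. *)
Lemma normal_prob_cos (R : realType) (m s t theta : R) : s != 0 ->
  (\int[normal_prob m s]_x (cos (t * (x - m) + theta))%:E =
   (cos theta * expR (- (s ^+ 2 * t ^+ 2) / 2))%:E)%E.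
Proof.
move=> s0; rewrite integral_normal_prob; last first.
  apply/measurable_EFinP; apply: continuous_measurable_fun => x.
  apply: continuous_comp; last exact: continuous_cos.
  apply: cvgD; last exact: cvg_cst.
  apply: cvgM; first exact: cvg_cst.
  by apply: cvgB; [exact: cvg_id|exact: cvg_cst].
have dc (x : R) : is_derive x 1 (fun x => cos (x + theta)) (- sin (x + theta)).
  by apply: is_derive_eq; rewrite /GRing.scale/=; ring.
have ds (x : R) : is_derive x 1 (fun x => - sin (x + theta)) (- cos (x + theta)).
  by apply: is_derive_eq; rewrite /GRing.scale/=; ring.
have := normal_pdf_trigonometric m s0 dc ds _ _ t.
rewrite add0r => <-; last 2 first.
- by move=> x; rewrite ler_norml cos_geN1 cos_le1.
- by move=> x; rewrite normrN ler_norml sin_geN1 sin_le1.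
rewrite /Rintegral fineK//.
apply: integrable_fin_num => //.
apply: (@integrable_normal_pdf_quadratic _ _ _ s0 (fun x => cos (t * (x - m) + theta)) 1).
  apply: continuous_measurable_fun => x.
  apply: continuous_comp; last exact: continuous_cos.
  apply: cvgD; last exact: cvg_cst.
  apply: cvgM; first exact: cvg_cst.
  by apply: cvgB; [exact: cvg_id|exact: cvg_cst].
move=> x; rewrite mul1r (@le_trans _ _ 1)//; last by rewrite lerDl sqr_ge0.
by rewrite ler_norml cos_geN1 cos_le1.
Qed.

(* On [A], [normal_pdf m s <= expR (1 / 2 - a / s) * normal_pdf (m + e * s) s]
   by completing the square. *)
Lemma normal_prob_tail (R : realType) (m s a e : R)
    (A : set (measurableTypeR R)) : 0 < s -> e ^+ 2 = 1 ->
  measurable A -> (forall x, A x -> a <= e * (x - m)) ->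
  (normal_prob m s A <= (expR (1 / 2 - a / s))%:E)%E.
Proof.
move=> s_gt0 e1 mA Aa; have s0 : s != 0 by rewrite gt_eqF.
pose q x := expR (1 / 2 - a / s) * normal_pdf (m + e * s) s x.
have q0 x : 0 <= q x by rewrite mulr_ge0 ?expR_ge0// normal_pdf_ge0.
have mq : measurable_fun setT q.
  by apply: measurable_funM => //; exact: measurable_normal_pdf.
apply: (@le_trans _ _ (\int[lebesgue_measure]_(x in A) (q x)%:E)%E).
  apply: ge0_le_integral => //.
  - by move=> x _; rewrite lee_fin normal_pdf_ge0.
  - by apply/measurable_EFinP/measurable_funTS; exact: measurable_normal_pdf.
  - exact/measurable_EFinP/measurable_funTS.
  - move=> x Ax; rewrite lee_fin /q !normal_pdf_expR// mulrCA.
    rewrite ler_wpM2l ?normal_peak_ge0// -expRD ler_expR.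
    rewrite -subr_ge0 (_ : _ - _ = (e * (x - m) - a) / s
      + (1 - e ^+ 2) / 2); last by field.
    by rewrite e1 subrr mul0r addr0 divr_ge0 ?subr_ge0 ?Aa// ltW.
apply: (@le_trans _ _ (\int[lebesgue_measure]_x (q x)%:E)%E).
  apply: ge0_subset_integral => //; first exact/measurable_EFinP.
  by move=> x _; rewrite lee_fin.
rewrite /q; under eq_integral do rewrite EFinM.
rewrite ge0_integralZl//.
- by rewrite integral_normal_pdf mule1.
- by apply/measurable_EFinP; exact: measurable_normal_pdf.
- by move=> x _; rewrite lee_fin normal_pdf_ge0.
Qed.

(** * Uniqueness of the Fourier transform *)

Section fourier_uniqueness.
Context (R : realType).
Local Notation rT := (measurableTypeR R).
Implicit Types mu nu : {finite_measure set rT -> \bar R}.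

Lemma measurable_cos_affine (t theta : R) :
  measurable_fun setT (fun x : R => cos (t * x + theta)).
Proof.
apply: continuous_measurable_fun => x.
apply: continuous_comp; last exact: continuous_cos.
apply: cvgD; last exact: cvg_cst.
by apply: cvgM; [exact: cvg_cst|exact: cvg_id].
Qed.

Lemma measurable_normal_pdf2 (s : R) : s != 0 ->
  measurable_fun setT (fun z : rT * rT => normal_pdf z.1 s z.2).
Proof.
move=> s0; rewrite (_ : (fun z => _) = fun z : rT * rT => normal_peak s *
    expR (- (z.2 - z.1) ^+ 2 / (s ^+ 2 *+ 2))); last first.
  by apply/funext => z; rewrite normal_pdf_expR.
apply: measurable_funM => //; apply: measurableT_comp => //.
apply: measurable_funM => //; apply: measurableT_comp => //.
by apply: measurable_funX; exact: measurable_funB.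
Qed.

Lemma measurable_normal_prob (s : R) (A : set rT) : s != 0 -> measurable A ->
  measurable_fun setT (fun x : rT => normal_prob x s A).
Proof.
move=> s0 mA.
pose F (z : rT * rT) := ((normal_pdf z.1 s z.2 * \1_A z.2)%:E : \bar R).
have mF : measurable_fun setT F.
  apply/measurable_EFinP; apply: measurable_funM.
    exact: measurable_normal_pdf2.
  by apply: measurableT_comp => //; exact: measurable_indic.
have F0 z : (0 <= F z)%E by rewrite lee_fin mulr_ge0 ?normal_pdf_ge0.
have := measurable_fun_fubini_tonelli_F F mF F0 (m2 := lebesgue_measure).
rewrite (_ : fubini_F _ _ = fun x : rT => normal_prob x s A)//.
apply/funext => x; rewrite /normal_prob [RHS]integral_mkcond.
apply: eq_integral => y _; rewrite patchE /F/= indicE.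
by case: ifPn => _; rewrite ?mulr1 ?mulr0.
Qed.

(** A Gaussian bump is itself a characteristic function, hence an average of cosines over a Gaussian
    frequency [c]; Fubini takes this average out of the integral against [mu]. *)
Let integral_bump mu (s a : R) : s != 0 ->
  (\int[mu]_x (expR (- (s ^+ 2 * (x - a) ^+ 2) / 2))%:E =
   \int[normal_prob 0 s]_c \int[mu]_x (cos (c * x + - (c * a)))%:E)%E.
Proof.
move=> s0.
pose F (z : rT * rT) := (cos (z.2 * z.1 + - (z.2 * a)))%:E.
have mF : measurable_fun setT F.
  have mc : measurable_fun setT (@cos R).
    by apply: continuous_measurable_fun; exact: continuous_cos.
  apply/measurable_EFinP; apply: (measurableT_comp mc).
  apply: measurable_funB; apply: measurable_funM => //.
have F1 z : (`|F z| <= 1)%E.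
  by rewrite lee_fin ler_norml cos_geN1 cos_le1.
have iF : (mu \x normal_prob 0 s)%E.-integrable setT F.
  apply/integrableP; split => //.
  apply: (@le_lt_trans _ _ (1%:E * (mu \x normal_prob 0 s)%E setT)%E).
    by apply: integral_le_bound => //; apply: aeW => z _; exact: F1.
  rewrite mul1e -setXTT product_measure1E//.
  rewrite [X in (_ * X)%E](_ : _ = 1%E) ?mule1; last exact: probability_setT.
  by rewrite ltey_eq fin_num_measure.
rewrite -(Fubini iF); apply: eq_integral => x _.
have := @normal_prob_cos _ 0 s (x - a) 0 s0.
rewrite cos0 mul1r => <-; apply: eq_integral => y _.
rewrite /F/=; congr (cos _)%:E; ring.
Qed.

Let integral_normal_pdf_eq mu nu :
  (forall t theta : R, \int[mu]_x (cos (t * x + theta))%:E =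
                       \int[nu]_x (cos (t * x + theta))%:E)%E ->
  forall s a, s != 0 ->
  (\int[mu]_x (normal_pdf x s a)%:E = \int[nu]_x (normal_pdf x s a)%:E)%E.
Proof.
move=> munu s a s0.
have pE (x : R) : (normal_pdf x s a)%:E = ((normal_peak s)%:E *
    (expR (- (s^-1 ^+ 2 * (x - a) ^+ 2) / 2))%:E)%E.
  by rewrite normal_pdf_expR// -EFinM; congr (_ * expR _)%:E; field.
have mE : measurable_fun setT
    (fun x : R => (expR (- (s^-1 ^+ 2 * (x - a) ^+ 2) / 2))%:E).
  apply/measurable_EFinP/measurableT_comp => //.
  apply: measurable_funM => //; apply: measurableT_comp => //.
  apply: measurable_funM => //; apply: measurable_funX.
  exact: measurable_funB.
under eq_integral do rewrite pE; under [RHS]eq_integral do rewrite pE.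
rewrite !ge0_integralZl//; try by rewrite lee_fin normal_peak_ge0.
- rewrite !integral_bump ?invr_eq0//; congr (_ * _)%E.
  by apply: eq_integral => c _; exact: munu.
Qed.

(** By Tonelli, smoothing with a Gaussian gives both measures a Lebesgue density, and these
    densities agree pointwise. *)
Let integral_normal_prob_eq mu nu :
  (forall t theta : R, \int[mu]_x (cos (t * x + theta))%:E =
                       \int[nu]_x (cos (t * x + theta))%:E)%E ->
  forall s (A : set rT), s != 0 -> measurable A ->
  (\int[mu]_x normal_prob x s A = \int[nu]_x normal_prob x s A)%E.
Proof.
move=> munu s A s0 mA.
have tonelli (mu' : {finite_measure set rT -> \bar R}) :
  (\int[mu']_x normal_prob x s A =
   \int[lebesgue_measure]_(a in A) \int[mu']_x (normal_pdf x s a)%:E)%E.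
  pose F (z : rT * rT) := ((normal_pdf z.1 s z.2 * \1_A z.2)%:E : \bar R).
  have mF : measurable_fun setT F.
    apply/measurable_EFinP; apply: measurable_funM.
      exact: measurable_normal_pdf2.
    by apply: measurableT_comp => //; exact: measurable_indic.
  have F0 z : (0 <= F z)%E by rewrite lee_fin mulr_ge0 ?normal_pdf_ge0.
  have := fubini_tonelli F mF F0 (m1 := mu') (m2 := lebesgue_measure).
  rewrite (_ : (\int[lebesgue_measure]_y \int[mu']_x F (x, y))%E =
    (\int[lebesgue_measure]_(a in A) \int[mu']_x (normal_pdf x s a)%:E)%E); last first.
    rewrite [RHS]integral_mkcond; apply: eq_integral => y _; rewrite patchE.
    rewrite /F/= indicE; case: ifPn => _.
      by apply: eq_integral => x _; rewrite mulr1.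
    by apply: integral0_eq => x _; rewrite mulr0.
  move=> <-; apply: eq_integral => x _; rewrite /normal_prob integral_mkcond.
  apply: eq_integral => y _; rewrite patchE /F/= indicE.
  by case: ifPn => _; rewrite ?mulr1 ?mulr0.
rewrite !tonelli; apply: eq_integral => a _.
exact: integral_normal_pdf_eq.
Qed.

(** The half-line is enlarged by [harmonic n], far more than the standard deviation
    [harmonic n ^+ 2]. The limit is therefore the indicator at every point, including [b], where the
    half-line without enlargement would have mass 1/2. *)
Let cvg_normal_prob_half_line (b x : R) :
  fine (normal_prob x (harmonic n ^+ 2) `[b - harmonic n, +oo[%classic)
    @[n --> \oo] --> (\1_(`[b, +oo[%classic) x : R).
Proof.
pose h n : R := harmonic n.
have h0 n : 0 < h n by exact: harmonic_gt0.
have tl n (A : set rT) (c : R) : c ^+ 2 = 1 -> measurable A ->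
    (forall y, A y -> h n <= c * (y - x)) ->
    fine (normal_prob x (h n ^+ 2) A) <= expR (1 / 2) * h n.
  move=> c1 mA Ac.
  have hn2 : 0 < h n ^+ 2 by rewrite exprn_gt0.
  have := normal_prob_tail hn2 c1 mA Ac.
  rewrite -[X in (X <= _)%E]fineK ?fin_num_measure// lee_fin => /le_trans; apply.
  rewrite expRD ler_wpM2l ?expR_ge0// expRN /h /harmonic/= lef_pV2 ?posrE ?expR_gt0 ?ltr0n//.
  rewrite exprVn invrK expr2 mulKf ?pnatr_eq0//.
  by apply: le_trans (expR_ge1Dx _); rewrite lerDr.
have e0 : expR (1 / 2) * h n @[n --> \oo] --> (0 : R).
  by rewrite -(mulr0 (expR (1 / 2))); apply: cvgM; [exact: cvg_cst|exact: cvg_harmonic].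
have [bx|xb] := leP b x.
  rewrite indicE mem_set; last by rewrite /= in_itv/= bx.
  have e1 : 1 - expR (1 / 2) * h n @[n --> \oo] --> (1 : R).
    by rewrite -[X in _ --> X]subr0; apply: cvgB => //; exact: cvg_cst.
  apply: (squeeze_cvgr _ e1 (cvg_cst (1 : R))); apply: nearW => n.
  have mB : measurable `[b - h n, +oo[%classic by exact: measurable_itv.
  apply/andP; split; last first.
    by rewrite -lee_fin fineK ?fin_num_measure//; exact: probability_le1.
  have := @probability_setC _ _ _ (normal_prob x (h n ^+ 2)) _ mB.
  rewrite -[X in _ = (_ - X)%E]fineK ?fin_num_measure// -EFinB.
  move=> /(congr1 fine) E; rewrite [RHS]/= in E.
  rewrite lerBlDr -lerBlDl -E.
  apply: (tl n _ (- 1)); [by rewrite sqrrN expr1n|exact: measurableC|].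
  move=> y /= /negP; rewrite in_itv/= andbT -ltNge => yb; lra.
rewrite indicE memNset; last by rewrite /= in_itv/= andbT; apply/negP; rewrite -ltNge.
apply: (squeeze_cvgr _ (cvg_cst (0 : R)) e0).
have xb2 : 0 < (b - x) / 2 by rewrite divr_gt0 ?subr_gt0.
have ch : h n @[n --> \oo] --> (0 : R) by exact: cvg_harmonic.
move/cvgr0_norm_lt : (ch) => /(_ _ xb2).
apply: filterS => n; rewrite (ger0_norm (ltW (h0 n))) => hn.
apply/andP; split; first exact: fine_ge0.
apply: (tl n _ 1); [by rewrite expr1n|exact: measurable_itv|].
by move=> y; rewrite -/(h n) /= in_itv/= andbT => yb; lra.
Qed.

(** Equal cosine integrals give equal Gaussian smoothings; letting their width tend to 0 recovers
    the masses of half-lines. *)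
Lemma fourier_unique mu nu :
  (forall t theta : R, \int[mu]_x (cos (t * x + theta))%:E =
                       \int[nu]_x (cos (t * x + theta))%:E)%E ->
  forall A, measurable A -> mu A = nu A.
Proof.
move=> munu; apply: half_line_measure_unique => b; last first.
  by rewrite ltey_eq fin_num_measure.
pose h n x := fine (normal_prob x (harmonic n ^+ 2) `[b - harmonic n, +oo[%classic).
have cvgh (mu' : {finite_measure set rT -> \bar R}) :
    \int[mu']_x h n x @[n --> \oo] --> fine (mu' `[b, +oo[%classic).
  rewrite (_ : fine _ = \int[mu']_x (\1_(`[b, +oo[%classic) x)); last first.
    by rewrite /Rintegral integral_indic// setIT.
  apply: (@Rintegral_dominated_cvg _ rT R mu' h
    (\1_(`[b, +oo[%classic)) (cst 1)).
  - move=> n; apply: measurableT_comp => //; apply: measurable_normal_prob => //.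
    by rewrite expf_neq0// gt_eqF// harmonic_gt0.
  - exact: measurable_indic.
  - by apply: aeW => x; exact: cvg_normal_prob_half_line.
  - exact: finite_measure_integrable_cst.
  - apply: aeW => x n; rewrite ger0_norm ?fine_ge0// -lee_fin fineK ?fin_num_measure//.
    exact: probability_le1.
have hE n : \int[mu]_x h n x = \int[nu]_x h n x.
  rewrite /Rintegral; congr fine.
  have E (mu' : {finite_measure set rT -> \bar R}) : (\int[mu']_x (h n x)%:E =
    \int[mu']_x normal_prob x (harmonic n ^+ 2) `[(b - harmonic n)%R, +oo[%classic)%E.
    by apply: eq_integral => x _; rewrite fineK ?fin_num_measure.
  rewrite !E; apply: integral_normal_prob_eq => //.
  by rewrite expf_neq0// gt_eqF// harmonic_gt0.
have cmu := cvgh mu; rewrite (funext hE) in cmu.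
have := congr1 EFin (cvg_unique (@Rhausdorff R) cmu (cvgh nu)).
by rewrite !fineK ?fin_num_measure//; apply.
Qed.

End fourier_uniqueness.

(** * Markov chains with Gaussian innovations *)

Lemma weighted_image d (T : measurableType d) d' (T' : measurableType d')
    (R : realType) (mu : {measure set T -> \bar R}) (g : T -> R) (Y : T -> T') :
  measurable_fun setT g -> (forall x, 0 <= g x) -> measurable_fun setT Y ->
  (\int[mu]_x (g x)%:E < +oo)%E ->
  exists nu : {finite_measure set T' -> \bar R},
    forall f : T' -> \bar R, measurable_fun setT f ->
      (\int[nu]_y f y = \int[mu]_x (f (Y x) * (g x)%:E))%E.
Proof.
move=> mg g0 mY ig.
have [nu nuE] := ge0_weighted_image mu mg g0 mY.
have nufin : fin_num_fun nu.
  move=> A mA; rewrite ge0_fin_numE//.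
  apply: (@le_lt_trans _ _ (nu setT)); first by apply: le_measure; rewrite ?inE.
  rewrite -(mul1e (nu setT)) -integral_cst// nuE//.
  by under eq_integral do rewrite mul1e.
have {}nuE (f : T' -> \bar R) : measurable_fun setT f ->
    (\int[nu]_y f y = \int[mu]_x (f (Y x) * (g x)%:E))%E.
  move=> mf; rewrite integralE [RHS]integralE; congr (_ - _)%E.
  - rewrite (nuE f^\+)%E//; last exact: measurable_funepos.
    apply: eq_integral => x _; rewrite !funeposE !(muleC _ (g x)%:E).
    by rewrite maxe_pMr ?lee_fin// mule0.
  - rewrite (nuE f^\-)%E//; last exact: measurable_funeneg.
    apply: eq_integral => x _; rewrite !funenegE !(muleC _ (g x)%:E).
    by rewrite maxe_pMr ?lee_fin// mule0 muleN.
have sigfin : sigma_finite setT nu.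
  by apply: fin_num_fun_sigma_finite => //; rewrite measure0.
have sfin : sfinite_measure nu by exact: sfinite_measure_sigma_finite.
pose H1 := isFinite.Build _ _ _ _ nufin.
pose H2 := isSFinite.Build _ _ _ (Measure.sort nu) sfin.
pose H3 := isSigmaFinite.Build _ _ _ (Measure.sort nu) sigfin.
pose nu' := HB.pack_for (FiniteMeasure.type T' R) (Measure.sort nu) H1 H2 H3.
by exists nu'.
Qed.

Lemma bounded_integrable d (T : measurableType d) (R : realType)
    (mu : {finite_measure set T -> \bar R}) (f : T -> R) (M : R) :
  measurable_fun setT f -> (forall x, `|f x| <= M) ->
  mu.-integrable setT (EFin \o f).
Proof.
move=> mf fM; apply: (@le_integrable _ _ _ _ _ measurableT _ (cst M%:E)).
- exact/measurable_EFinP.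
- by move=> x _; rewrite /= lee_fin (le_trans (fM x))// ler_norm.
- exact: finite_measure_integrable_cst.
Qed.

Lemma EFin_bounded_Rintegral d (T : measurableType d) (R : realType)
    (mu : {finite_measure set T -> \bar R}) (f : T -> R) (M : R) :
  measurable_fun setT f -> (forall x, `|f x| <= M) ->
  (\int[mu]_x (f x)%:E = (\int[mu]_x f x)%:E)%E.
Proof.
move=> mf fM; rewrite /Rintegral fineK//.
by apply: integrable_fin_num => //; exact: bounded_integrable mf fM.
Qed.

Lemma measurable_cos_comp d (T : measurableType d) (R : realType) (c theta : R)
    (Y : T -> R) : measurable_fun setT Y ->
  measurable_fun setT (fun w => cos (c * Y w + theta)).
Proof. by move=> mY; apply: measurableT_comp (measurable_cos_affine _ _) mY. Qed.

Lemma norm_cos_le1 (R : realType) (x : R) : `|cos x| <= 1.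
Proof. by rewrite ler_norml cos_geN1 cos_le1. Qed.

(* The hypothesis says that under the measures of densities [G] and [Z], the
   law of [(X, Y)] is the product of a law of [X] and a centered Gaussian law;
   only the characteristic function of [Y] is needed. *)
Lemma gaussian_disintegration d (T : measurableType d) (R : realType)
    (P : probability T R) (G Z X Y : T -> R) (M s : R) : s != 0 ->
  measurable_fun setT G -> measurable_fun setT Z ->
  measurable_fun setT X -> measurable_fun setT Y ->
  (forall w, 0 <= G w <= M) -> (forall w, 0 <= Z w <= M) ->
  (forall (A : set (measurableTypeR R)) c theta, measurable A ->
    \int[P]_w (cos (c * Y w + theta) * (G w * \1_A (X w))) =
    cos theta * expR (- (s ^+ 2 * c ^+ 2) / 2) * \int[P]_w (Z w * \1_A (X w))) ->
  forall K : measurableTypeR R * measurableTypeR R -> \bar R,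
    measurable_fun setT K -> (forall z, 0 <= K z)%E ->
    (\int[P]_w (K (X w, Y w) * (G w)%:E) =
     \int[P]_w ((\int[normal_prob 0 s]_y K (X w, y)) * (Z w)%:E))%E.
Proof.
move=> s0 mG mZ mX mY G0 Z0 cosE K mK K0.
have G0' w : 0 <= G w by have /andP[] := G0 w.
have Z0' w : 0 <= Z w by have /andP[] := Z0 w.
have lty (f : T -> R) : (forall w, `|f w| <= M) -> measurable_fun setT f ->
    (\int[P]_w (f w)%:E < +oo)%E.
  by move=> fM mf; rewrite (EFin_bounded_Rintegral _ mf fM) ltry.
have GM w : `|G w| <= M by have /andP[G1 G2] := G0 w; rewrite ger0_norm.
have ZM w : `|Z w| <= M by have /andP[Z1 Z2] := Z0 w; rewrite ger0_norm.
(* On a rectangle, [A] can be absorbed into the density: under [G * \1_A (X)], the variable [Y] has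
   the cosine integrals of [z] times the Gaussian law, so that uniqueness is only needed in one
   dimension. *)
have rect (A B : set (measurableTypeR R)) : measurable A -> measurable B ->
    (\int[P]_w ((\1_A (X w) * \1_B (Y w)) * G w)%:E =
     (\int[P]_w (Z w * \1_A (X w)))%:E * normal_prob 0 s B)%E.
  move=> mA mB.
  have mAX : measurable_fun setT (fun w => \1_A (X w) : R).
    by apply: measurableT_comp => //; exact: measurable_indic.
  have i01 (x : R) : 0 <= (\1_A x : R) <= 1.
    by rewrite indicE; case: (x \in A); rewrite /= ?lexx ler01.
  have GA0 w : 0 <= G w * \1_A (X w) by rewrite mulr_ge0.
  have GAM w : `|G w * \1_A (X w)| <= M.
    by rewrite ger0_norm// -[leRHS]mulr1; have /andP[] := i01 (X w);
       have /andP[] := G0 w => *; exact: ler_pM.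
  have ZAM w : `|Z w * \1_A (X w)| <= M.
    have /andP[z1 z2] := Z0 w; have /andP[i1 i2] := i01 (X w).
    by rewrite ger0_norm ?mulr_ge0// -[leRHS]mulr1 ler_pM.
  have mGA : measurable_fun setT (fun w => G w * \1_A (X w)) by exact: measurable_funM.
  have mZA : measurable_fun setT (fun w => Z w * \1_A (X w)) by exact: measurable_funM.
  pose z := \int[P]_w (Z w * \1_A (X w)).
  have z0 : 0 <= z by apply: Rintegral_ge0 => w _; rewrite mulr_ge0.
  have [mu1 mu1E] := @weighted_image _ _ _ (measurableTypeR R) _ P _ _ mGA GA0 mY (lty _ GAM mGA).
  have [mu2 mu2E] : exists nu : {finite_measure set (measurableTypeR R) -> \bar R},
      forall f : measurableTypeR R -> \bar R, measurable_fun setT f ->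
      (\int[nu]_y f y = \int[normal_prob 0 s]_x (f x * z%:E))%E.
    apply: (@weighted_image _ _ _ _ _ (normal_prob 0 s) (cst z) id) => //.
    rewrite (_ : (fun x => (cst z x)%:E) = cst z%:E)// integral_cst//.
    by rewrite [X in (_ * X)%E](_ : _ = 1%E) ?mule1 ?ltry//; exact: probability_setT.
  have mu12 : mu1 B = mu2 B.
    apply: fourier_unique => // t theta.
    have mc : measurable_fun setT (fun x : measurableTypeR R => (cos (t * x + theta))%:E).
      by apply/measurable_EFinP; exact: measurable_cos_affine.
    rewrite mu1E// mu2E//.
    under eq_integral do rewrite -EFinM.
    rewrite (@EFin_bounded_Rintegral _ _ _ _ _ M); last 2 first.
      by apply: measurable_funM => //; exact: measurable_cos_comp.
      by move=> w; rewrite normrM -[leRHS]mul1r ler_pM// norm_cos_le1.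
    rewrite cosE// -/z EFinM.
    rewrite integralZr//; last first.
      apply: (@bounded_integrable _ _ _ _ _ 1); first exact: measurable_cos_affine.
      by move=> x; exact: norm_cos_le1.
    rewrite -(@normal_prob_cos _ 0)//; congr (_ * _)%E.
    by apply: eq_integral => x _; rewrite subr0.
  have indE (nu : {finite_measure set (measurableTypeR R) -> \bar R}) :
      nu B = (\int[nu]_x (\1_B x)%:E)%E by rewrite integral_indic// setIT.
  move: mu12; rewrite !indE mu1E ?mu2E; try (by apply/measurable_EFinP; exact: measurable_indic).
  rewrite integralZr//; last exact: integrable_indic.
  rewrite integral_indic// setIT muleC -/z => <-.
  by apply: eq_integral => w _; rewrite -EFinM; congr EFin; ring.
have [m1 m1E] := @weighted_image _ _ _ (measurableTypeR R) _ P _ _ mZ Z0' mX (lty _ ZM mZ).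
have mXY : measurable_fun setT (fun w => (X w, Y w)) by exact: measurable_fun_pair.
have [m2 m2E] := @weighted_image _ _ _ (measurableTypeR R * measurableTypeR R)%type
  _ P _ _ mG G0' mXY (lty _ GM mG).
rewrite -(m2E K)//.
(* Agreement on rectangles makes the law of [(X, Y)] under [G] a product, after which Tonelli
   computes the integral of [K]. *)
have m2prod C : measurable C -> (m1 \x normal_prob 0 s)%E C = m2 C.
  apply: product_measure_unique => A B mA mB.
  have mAB : measurable (A `*` B) by exact: measurableX.
  transitivity (\int[m2]_z (\1_(A `*` B) z)%:E)%E.
    by rewrite integral_indic// setIT.
  transitivity ((\int[m1]_x (\1_A x)%:E) * normal_prob 0 s B)%E; last first.
    by congr (_ * _)%E; rewrite integral_indic// setIT.
  rewrite m2E ?m1E; try (by apply/measurable_EFinP; exact: measurable_indic).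
  transitivity (\int[P]_w ((\1_A (X w) * \1_B (Y w)) * G w)%:E)%E.
    apply: eq_integral => w _; rewrite -EFinM; congr (_ * _)%:E.
    rewrite !indicE in_setX/=; case: (_ \in A); case: (_ \in B);
      by rewrite /= ?mulr0 ?mulr1 ?mul0r.
  rewrite rect//; congr (_ * _)%E.
  rewrite -(@EFin_bounded_Rintegral _ _ _ _ _ M); last 2 first.
    apply: measurable_funM => //.
    by apply: measurableT_comp => //; exact: measurable_indic.
    move=> w; have /andP[z1 z2] := Z0 w; rewrite indicE.
    by case: (X w \in A); rewrite /= ?mulr1 ?mulr0 ?normr0 ?(le_trans z1).
  by apply: eq_integral => w _; rewrite -EFinM mulrC.
rewrite (@eq_measure_integral _ _ _ _ (m1 \x normal_prob 0 s)%E); last first.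
  by move=> C mC _; apply/esym; exact: m2prod.
rewrite fubini_tonelli1// m1E//.
exact: measurable_fun_fubini_tonelli_F.
Qed.

(** The image of the centered law under the shift has the cosine integrals of the law of mean [a];
    Fourier uniqueness replaces a change of variables. *)
Lemma normal_prob_translation (R : realType) (s a : R)
    (g : measurableTypeR R -> \bar R) : s != 0 ->
  measurable_fun setT g ->
  (\int[normal_prob 0 s]_y g (a + y)%R = \int[normal_prob a s]_y g y)%E.
Proof.
move=> s0 mg.
have mT : measurable_fun setT (fun y : measurableTypeR R => a + y : measurableTypeR R).
  exact: measurable_funD.
have [nu nuE] : exists nu : {finite_measure set (measurableTypeR R) -> \bar R},
    forall f : measurableTypeR R -> \bar R, measurable_fun setT f ->
    (\int[nu]_y f y = \int[normal_prob 0 s]_x (f (a + x)%R * (cst 1 x)%:E))%E.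
  apply: (@weighted_image _ _ _ _ _ (normal_prob 0 s) (cst 1)) => //.
  rewrite (_ : (fun x => (cst 1 x)%:E) = cst 1%E)// integral_cst//.
  by rewrite [X in (_ * X)%E](_ : _ = 1%E) ?mule1 ?ltry//; exact: probability_setT.
transitivity (\int[nu]_y g y)%E.
  by rewrite nuE//; apply: eq_integral => x _; rewrite mule1.
apply: eq_measure_integral => A mA _; apply: fourier_unique => // t theta.
rewrite nuE; last by apply/measurable_EFinP; exact: measurable_cos_affine.
transitivity (cos (t * a + theta) * expR (- (s ^+ 2 * t ^+ 2) / 2))%:E.
  rewrite -(@normal_prob_cos _ 0)//; apply: eq_integral => x _.
  by rewrite mule1; congr (cos _)%:E; ring.
rewrite -(@normal_prob_cos _ a)//; apply: eq_integral => x _.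
by congr (cos _)%:E; ring.
Qed.

Fixpoint chain (R : realType) (D : nat -> R -> R) (y : nat -> R) (k : nat) : R :=
  if k is k'.+1 then D k' (chain D y k') + y k' else 0.

Fixpoint chain_weight (R : realType) (D w : nat -> R -> R) (y : nat -> R)
    (k : nat) : R :=
  if k is k'.+1 then chain_weight D w y k' * w k' (chain D y k'.+1) else 1.

Section gaussian_chain.
Context d (T : measurableType d) (R : realType) (P : probability T R).
Variables (Y : nat -> T -> R) (s : nat -> R) (D w : nat -> R -> R) (W : R).
Hypothesis mY : forall k, measurable_fun setT (Y k).
Hypothesis s0 : forall k, s k != 0.
Hypothesis mD : forall k, measurable_fun setT (D k).
Hypothesis mw : forall k, measurable_fun setT (w k).
Hypothesis w0W : forall k x, 0 <= w k x <= W.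
Hypothesis cosY : forall N (c : nat -> R) theta,
  \int[P]_t cos (\sum_(j < N) c j * Y j t + theta) =
  cos theta * expR (- (\sum_(j < N) s j ^+ 2 * c j ^+ 2) / 2).

Local Notation X k := (fun t => chain D (Y ^~ t) k).
Local Notation H k := (fun t => chain_weight D w (Y ^~ t) k).

Lemma measurable_chain k : measurable_fun setT (X k).
Proof.
elim: k => [|k IH] /=; first exact: measurable_cst.
by apply: measurable_funD => //; exact: measurableT_comp.
Qed.

Lemma measurable_chain_weight k : measurable_fun setT (H k).
Proof.
elim: k => [|k IH] /=; first exact: measurable_cst.
apply: measurable_funM => //; apply: measurableT_comp => //.
exact: (measurable_chain k.+1).
Qed.

Lemma chain_weight_bound k t : 0 <= H k t <= W ^+ k.
Proof.
elim: k => [|k /andP[h0 h1]] /=; first by rewrite ler01 expr0 lexx.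
have /andP[w0 w1] := w0W k (chain D (Y ^~ t) k.+1).
by rewrite mulr_ge0//= exprSr ler_pM.
Qed.

Let W0 : 0 <= W.
Proof. by have /andP[a b] := w0W 0 0; exact: le_trans b. Qed.

(* Fourier form of the independence of the future innovations from the chain
   up to time [k]; it is the induction hypothesis that propagates along it. *)
Let claim k := forall (A : set (measurableTypeR R)) N (c : nat -> R) theta,
  measurable A ->
  \int[P]_t (cos (\sum_(j < N) c j * Y (k + j)%N t + theta) *
             (H k t * \1_A (X k t))) =
  cos theta * expR (- (\sum_(j < N) s (k + j)%N ^+ 2 * c j ^+ 2) / 2) *
  \int[P]_t (H k t * \1_A (X k t)).

Let measurable_S k N (c : nat -> R) (theta : R) :
  measurable_fun setT (fun t => cos (\sum_(j < N) c j * Y (k + j)%N t + theta)).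
Proof.
rewrite (_ : (fun t => _) =
  fun t => cos (1 * (\sum_(j < N) c j * Y (k + j)%N t) + theta)); last first.
  by apply/funext => t; rewrite mul1r.
apply: measurable_cos_comp.
apply: measurable_sum => j; exact: measurable_funM.
Qed.

Let cosM (a b : R) : cos a * cos b = (cos (a + b) + cos (a - b)) / 2.
Proof. by rewrite cosD cosB; field. Qed.

Let integrable_claim k N (c : nat -> R) theta (A : set (measurableTypeR R)) b : measurable A ->
  P.-integrable setT (EFin \o (fun t => b *
     (cos (\sum_(j < N) c j * Y (k + j)%N t + theta) * (H k t * \1_A (X k t))))).
Proof.
move=> mA; apply: (@bounded_integrable _ _ _ _ _ (`|b| * W ^+ k)).
  apply: measurable_funM => //; apply: measurable_funM; first exact: measurable_S.
  apply: measurable_funM; first exact: measurable_chain_weight.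
  by apply: measurableT_comp; [exact: measurable_indic|exact: measurable_chain].
move=> t; rewrite normrM ler_wpM2l// normrM -[leRHS]mul1r ler_pM ?norm_cos_le1//.
have /andP[h0 h1] := chain_weight_bound k t.
by rewrite normrM -[leRHS]mulr1 ler_pM ?ger0_norm// indicE; case: (_ \in _).
Qed.

(** Densities must be nonnegative, so the future innovations enter through [1 + cos] rather than
    through the cosine alone. *)
Let claim_disintegration k N (c : nat -> R) theta (kappa : R) : claim k ->
  kappa = expR (- (\sum_(j < N) s (k.+1 + j)%N ^+ 2 * c j ^+ 2) / 2) ->
  forall K : measurableTypeR R * measurableTypeR R -> \bar R,
  measurable_fun setT K -> (forall z, 0 <= K z)%E ->
  (\int[P]_t (K (X k t, Y k t) *
    (H k t * (1 + cos (\sum_(j < N) c j * Y (k.+1 + j)%N t + theta)))%:E) =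
   \int[P]_t ((\int[normal_prob 0 (s k)]_y K (X k t, y)) *
     ((1 + cos theta * kappa) * H k t)%:E))%E.
Proof.
move=> ck kE.
have k01 : 0 <= kappa <= 1.
  rewrite kE expR_ge0 -[leRHS]expR0 ler_expR mulNr oppr_le0 divr_ge0//.
  by apply: sumr_ge0 => j _; rewrite mulr_ge0 ?sqr_ge0.
have cb : 0 <= 1 + cos theta * kappa <= 2.
  have := cos_geN1 theta; have := cos_le1 theta; have /andP[a b] := k01; nra.
apply: (@gaussian_disintegration _ _ _ P _ _ _ _ (2 * W ^+ k)) => //.
- apply: measurable_funM; first exact: measurable_chain_weight.
  by apply: measurable_funD => //; exact: measurable_S.
- by apply: measurable_funM => //; exact: measurable_chain_weight.
- exact: measurable_chain.
- move=> t; have /andP[h0 h1] := chain_weight_bound k t.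
  have c1 := cos_le1 (\sum_(j < N) c j * Y (k.+1 + j)%N t + theta).
  have c2 := cos_geN1 (\sum_(j < N) c j * Y (k.+1 + j)%N t + theta).
  move: (cos _) c1 c2 (chain_weight _ _ _ _) h0 h1 => C c1 c2 h h0 h1.
  rewrite mulr_ge0//=; last by lra.
  by rewrite mulrC ler_pM//; lra.
- move=> t; have /andP[h0 h1] := chain_weight_bound k t.
  by have /andP[c0 c1] := cb; rewrite mulr_ge0//= ler_pM.
move=> A a b mA.
(* The product of the cosine in [Y k] with the cosine in the future is half the sum of two cosines,
   whose frequencies are [a] followed by [c] and [a] followed by [- c]; [claim k] applies to
   each. *)
pose c1 j := if j is j'.+1 then c j' else a.
pose c2 j := if j is j'.+1 then - c j' else a.
have S1 t : \sum_(j < N.+1) c1 j * Y (k + j)%N t =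
    a * Y k t + \sum_(j < N) c j * Y (k.+1 + j)%N t.
  by rewrite big_ord_recl addn0; congr (_ + _); apply: eq_bigr => j _; rewrite addSnnS.
have S2 t : \sum_(j < N.+1) c2 j * Y (k + j)%N t =
    a * Y k t - \sum_(j < N) c j * Y (k.+1 + j)%N t.
  rewrite big_ord_recl addn0 -sumrN; congr (_ + _).
  by apply: eq_bigr => j _; rewrite addSnnS mulNr.
have S0 t : \sum_(j < 1) c1 j * Y (k + j)%N t = a * Y k t.
  by rewrite big_ord1 addn0.
have V1 : \sum_(j < N.+1) s (k + j)%N ^+ 2 * c1 j ^+ 2 =
    s k ^+ 2 * a ^+ 2 + \sum_(j < N) s (k.+1 + j)%N ^+ 2 * c j ^+ 2.
  by rewrite big_ord_recl addn0; congr (_ + _); apply: eq_bigr => j _; rewrite addSnnS.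
have V2 : \sum_(j < N.+1) s (k + j)%N ^+ 2 * c2 j ^+ 2 =
    s k ^+ 2 * a ^+ 2 + \sum_(j < N) s (k.+1 + j)%N ^+ 2 * c j ^+ 2.
  rewrite big_ord_recl addn0; congr (_ + _).
  by apply: eq_bigr => j _; rewrite addSnnS sqrrN.
have V0 : \sum_(j < 1) s (k + j)%N ^+ 2 * c1 j ^+ 2 = s k ^+ 2 * a ^+ 2.
  by rewrite big_ord1 addn0.
transitivity (\int[P]_t (1 * (cos (\sum_(j < 1) c1 j * Y (k + j)%N t + b) *
      (H k t * \1_A (X k t))) +
    (2^-1 * (cos (\sum_(j < N.+1) c1 j * Y (k + j)%N t + (b + theta)) *
      (H k t * \1_A (X k t))) +
     2^-1 * (cos (\sum_(j < N.+1) c2 j * Y (k + j)%N t + (b - theta)) *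
      (H k t * \1_A (X k t)))))).
  apply: eq_Rintegral => t _; rewrite S0 S1 S2.
  set S := \sum_(_ < _) _; set x := a * Y k t.
  have := cosM (x + b) (S + theta).
  rewrite (_ : x + b + (S + theta) = x + S + (b + theta)); last by ring.
  rewrite (_ : x + b - (S + theta) = x - S + (b - theta)); last by ring.
  set C1 := cos (x + S + _); set C2 := cos (x - S + _) => E.
  have -> : C1 = 2 * (cos (x + b) * cos (S + theta)) - C2 by rewrite E; field.
  by field.
have icl := integrable_claim.
rewrite RintegralD//; [|exact: icl|]; last first.
  by rewrite /comp; under eq_fun do rewrite EFinD; apply: integrableD => //; exact: icl.
rewrite RintegralD//; [|exact: icl..].
have icl1 N' (c' : nat -> R) th : P.-integrable setT (EFin \o (fun t =>
     (cos (\sum_(j < N') c' j * Y (k + j)%N t + th) * (H k t * \1_A (X k t))))).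
  by have := icl k N' c' th A 1 mA; rewrite /comp; under eq_fun do rewrite mul1r.
rewrite !RintegralZl//.
rewrite !ck// V0 V1 V2.
have -> : \int[P]_t ((1 + cos theta * kappa) * H k t * \1_A (X k t)) =
    (1 + cos theta * kappa) * \int[P]_t (H k t * \1_A (X k t)).
  under eq_Rintegral do rewrite -mulrA.
  rewrite RintegralZl//.
  by have := icl1 0%N c (0:R); rewrite /comp; under eq_fun do rewrite big_ord0 addr0 cos0 mul1r.
rewrite opprD mulrDl expRD -kE.
have := cosM b theta; set I := \int[P]_t _; set E := expR _.
set C1 := cos (b + theta); set C2 := cos (b - theta) => h.
have -> : C1 = 2 * (cos b * cos theta) - C2 by rewrite h; field.
by field.
Qed.

Let measurable_drift k : measurable_fun setT
    (fun z : measurableTypeR R * measurableTypeR R => D k z.1 + z.2).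
Proof.
apply: measurable_funD; last exact: measurable_snd.
exact: measurableT_comp (mD k) measurable_fst.
Qed.

Let measurable_indic_weight k (A : set (measurableTypeR R)) : measurable A ->
  measurable_fun setT (fun z : measurableTypeR R * measurableTypeR R =>
    (w k (D k z.1 + z.2) * \1_A (D k z.1 + z.2))%:E).
Proof.
move=> mA; have mDz := measurable_drift k.
apply/measurable_EFinP; apply: measurable_funM; first exact: measurableT_comp.
by apply: measurableT_comp => //; exact: measurable_indic.
Qed.

Let chain_disintegration k : claim k ->
  forall K : measurableTypeR R * measurableTypeR R -> \bar R,
  measurable_fun setT K -> (forall z, 0 <= K z)%E ->
  (\int[P]_t (K (X k t, Y k t) * (H k t)%:E) =
   \int[P]_t ((\int[normal_prob 0 (s k)]_y K (X k t, y)) * (H k t)%:E))%E.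
Proof.
move=> ck K mK K0.
(* With no future innovation and the phase [pi / 2] the cosine vanishes and the density [1 + cos]
   becomes 1. *)
have := @claim_disintegration k 0 (fun=> 0) (pi / 2) 1 ck _ K mK K0.
rewrite big_ord0 oppr0 mul0r expR0 => /(_ erefl).
under eq_integral do rewrite big_ord0 add0r cos_pihalf addr0 mulr1.
by under [RHS]eq_integral do rewrite cos_pihalf mul0r addr0 mul1r.
Qed.

(** Disintegration of the one-step integrand [K] pulls out the factor [1 + cos theta * kappa];
    subtracting the part without cosine leaves the claim for the next time. *)
Let claimS k : claim k -> claim k.+1.
Proof.
move=> ck A N c theta mA.
pose kappa := expR (- (\sum_(j < N) s (k.+1 + j)%N ^+ 2 * c j ^+ 2) / 2).
pose K (z : measurableTypeR R * measurableTypeR R) :=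
  (w k (D k z.1 + z.2) * \1_A (D k z.1 + z.2))%:E.
have mK := measurable_indic_weight k mA.
have K0 z : (0 <= K z)%E.
  by rewrite lee_fin mulr_ge0//; have /andP[] := w0W k (D k z.1 + z.2).
have := @claim_disintegration k N c theta kappa ck erefl K mK K0.
have k01 : 0 <= kappa <= 1.
  rewrite expR_ge0 -[leRHS]expR0 ler_expR mulNr oppr_le0 divr_ge0//.
  by apply: sumr_ge0 => j _; rewrite mulr_ge0 ?sqr_ge0.
have cb : 0 <= 1 + cos theta * kappa.
  have := cos_geN1 theta; have := cos_le1 theta; have /andP[a b] := k01; nra.
under [in RHS]eq_integral do rewrite EFinM muleCA.
rewrite ge0_integralZl//; last 2 first.
  apply: emeasurable_funM.
    have := measurable_fun_fubini_tonelli_F K mK K0 (m2 := normal_prob 0 (s k)).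
    by move=> /measurableT_comp; apply; exact: measurable_chain.
    by apply/measurable_EFinP; exact: measurable_chain_weight.
  move=> t _; rewrite mule_ge0//; first exact: integral_ge0.
  by rewrite lee_fin; have /andP[] := chain_weight_bound k t.
rewrite -(chain_disintegration ck mK K0).
have mHA : measurable_fun setT (fun t => H k.+1 t * \1_A (X k.+1 t)).
  apply: measurable_funM; first exact: (measurable_chain_weight k.+1).
  apply: measurableT_comp; first exact: measurable_indic.
  exact: (measurable_chain k.+1).
have HAW t : `|H k.+1 t * \1_A (X k.+1 t)| <= W ^+ k.+1.
  have /andP[h0 h1] := chain_weight_bound k.+1 t.
  by rewrite normrM -[leRHS]mulr1 ler_pM ?ger0_norm// indicE; case: (_ \in _).
have -> : (\int[P]_t (K (X k t, Y k t) * (H k t)%:E) =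
    (\int[P]_t (H k.+1 t * \1_A (X k.+1 t)))%:E)%E.
  rewrite -(EFin_bounded_Rintegral _ mHA HAW); apply: eq_integral => t _.
  by rewrite /K -EFinM/=; congr EFin; ring.
have mS := measurable_S k.+1 N c theta.
have -> : (\int[P]_t (K (X k t, Y k t) * (H k t * (1 +
      cos (\sum_(j < N) c j * Y (k.+1 + j)%N t + theta)))%:E) =
    (\int[P]_t (H k.+1 t * \1_A (X k.+1 t) +
     cos (\sum_(j < N) c j * Y (k.+1 + j)%N t + theta) *
      (H k.+1 t * \1_A (X k.+1 t))))%:E)%E.
  rewrite -(@EFin_bounded_Rintegral _ _ _ _ _ (W ^+ k.+1 + W ^+ k.+1)).
  - apply: eq_integral => t _.
    by rewrite /K -EFinM/=; congr EFin; ring.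
  - by apply: measurable_funD => //; exact: measurable_funM.
  - move=> t; rewrite (le_trans (ler_normD _ _))// lerD// normrM -[leRHS]mul1r.
    by rewrite ler_pM// norm_cos_le1.
rewrite -EFinM => -[].
rewrite RintegralD//; last 2 first.
- by apply: (@bounded_integrable _ _ _ _ _ (W ^+ k.+1)).
- have := integrable_claim k.+1 N c theta 1 mA.
  by rewrite /comp; under eq_fun do rewrite mul1r.
rewrite mulrDl mul1r => /addrI; rewrite -/kappa => ->; ring.
Qed.

Let claim0 : claim 0.
Proof.
move=> A N c theta mA /=.
under eq_Rintegral do rewrite mul1r; under [in RHS]eq_Rintegral do rewrite mul1r.
have ic N' (c' : nat -> R) th : P.-integrable setT (EFin \o (fun t =>
    cos (\sum_(j < N') c' j * Y j t + th))).
  apply: (@bounded_integrable _ _ _ _ _ 1); first exact: (measurable_S 0).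
  by move=> t; exact: norm_cos_le1.
rewrite RintegralZr//; last exact: ic.
rewrite cosY; congr (_ * _).
rewrite -[RHS]/(\int[P]_t (cst (\1_A 0) t)) Rintegral_cst//.
by rewrite [Z in fine Z](_ : _ = 1%E) ?mulr1//; exact: probability_setT.
Qed.

Let claim_chain k : claim k.
Proof. by elim: k => [|k]; [exact: claim0|exact: claimS]. Qed.

(** The Markov property of the weighted chain: the innovation is integrated out conditionally on the
    past, and its law is then moved to the mean [D k (X k t)]. *)
Lemma chain_step k (psi : measurableTypeR R -> \bar R) :
  measurable_fun setT psi -> (forall x, 0 <= psi x)%E ->
  (\int[P]_t (psi (X k.+1 t) * (H k.+1 t)%:E) =
   \int[P]_t ((\int[normal_prob (D k (X k t)) (s k)]_y (psi y * (w k y)%:E)) *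
      (H k t)%:E))%E.
Proof.
move=> mpsi psi0.
pose K (z : measurableTypeR R * measurableTypeR R) :=
  (psi (D k z.1 + z.2)%R * (w k (D k z.1 + z.2))%:E)%E.
have w0 x : 0 <= w k x by have /andP[] := w0W k x.
have mDz := measurable_drift k.
have mg : measurable_fun setT (fun y => psi y * (w k y)%:E)%E.
  apply: emeasurable_funM; first exact: mpsi.
  by apply/measurable_EFinP; exact: mw.
have mK : measurable_fun setT K by exact: (measurableT_comp mg mDz).
have K0 z : (0 <= K z)%E by rewrite mule_ge0// lee_fin.
transitivity (\int[P]_t (K (X k t, Y k t) * (H k t)%:E))%E.
  by apply: eq_integral => t _; rewrite /K/= -muleA -EFinM; congr (_ * _%:E)%E; ring.
rewrite (chain_disintegration (claim_chain k) mK K0).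
have tr a := @normal_prob_translation R (s k) a _ (s0 k) mg.
by apply: eq_integral => t _; rewrite -tr.
Qed.

End gaussian_chain.

(** * Approximate reversibility of one Euler step *)

Lemma expR_ge_cube (R : realType) (t : R) : 0 <= t -> t ^+ 3 <= 27 * expR t.
Proof.
move=> t0; have -> : expR t = expR (t / 3) ^+ 3.
  by rewrite -expRM_natl; congr expR; field.
have h := expR_ge1Dx (t / 3).
have h3 : t / 3 <= expR (t / 3) by lra.
have : (t / 3) ^+ 3 <= expR (t / 3) ^+ 3 by rewrite lerXn2r ?nnegrE ?expR_ge0// divr_ge0.
by rewrite (_ : (t / 3) ^+ 3 = t ^+ 3 / 27); [lra|field].
Qed.

Lemma expR_norm_le (R : realType) (t : R) : expR `|t| <= expR t + expR (- t).
Proof.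
by case: (ger0P t) => _; have := expR_ge0 t; have := expR_ge0 (- t); lra.
Qed.

Lemma ler_dist_expR (R : realType) (u v : R) :
  `|expR u - expR v| <= `|u - v| * (expR u + expR v).
Proof.
wlog uv : u v / u <= v => [H|].
  by case: (leP u v) => [/H//|/ltW/H]; rewrite distrC (distrC v) (addrC (expR v)).
rewrite distrC ger0_norm ?subr_ge0 ?ler_expR// distrC ger0_norm ?subr_ge0//.
have : 1 + (u - v) <= expR (u - v) by exact: expR_ge1Dx.
move=> h; have := ler_wpM2l (expR_ge0 v) h; rewrite -expRD.
rewrite (_ : v + (u - v) = u); last by ring.
have : 0 <= (v - u) * expR u by rewrite mulr_ge0 ?subr_ge0 ?expR_ge0.
lra.
Qed.

Section one_step_exponents.
Context (R : realType) (m a s r M p q : R) (V v : R -> R).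
Hypothesis m_gt0 : 0 < m.
Hypothesis s_gt0 : 0 < s.
Hypothesis r01 : 0 < r <= 1.
Hypothesis s_le : s <= r.
Hypothesis a01 : 0 <= a <= 1.
Hypothesis a_le : 1 - a <= m ^+ 2 * r ^+ 2.
Hypothesis sE : 2 * m ^+ 2 * s ^+ 2 = 1 - a ^+ 2.
Hypothesis VM : forall x, `|V x| <= M.
Hypothesis vM : forall x, `|v x| <= M.
Hypothesis vL : forall x y, `|v y - v x| <= M * `|y - x|.
Hypothesis trapezoid : forall x y,
  `|2 * (V y - V x) - (v x + v y) * (y - x)| <= M * `|y - x| ^+ 3.
Hypothesis pM : `|p| <= M.
Hypothesis qM : `|q| <= M.

Let D x := a * x - s ^+ 2 * (p * v x).

(** Up to the factor [normal_peak s], its exponential is the Gibbs density of coupling [p] at [x],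
    times the transition density from [x] to [y], times the weight that turns [p] into [q]. Here [v]
    plays the derivative of [V] and [r] the square root of the time step. *)
Definition forward_exponent x y :=
  - m ^+ 2 * x ^+ 2 - 2 * p * V x - (y - D x) ^+ 2 / (s ^+ 2 *+ 2)
  - 2 * (q - p) * V y.

(** The Gibbs density of coupling [q] at [y], times the reversed transition. The drift still carries
    [p]; integrating [x] out leaves exactly the Gibbs density for [q]. *)
Definition backward_exponent x y :=
  - m ^+ 2 * y ^+ 2 - 2 * q * V y - (x - D y) ^+ 2 / (s ^+ 2 *+ 2).

Let M0 : 0 <= M. Proof. exact: le_trans (VM 0). Qed.

(* Reversibility of the Ornstein-Uhlenbeck step cancels the quadratic terms. *)
Lemma forward_backward_exponent x y :
  forward_exponent x y - backward_exponent x y =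
  p * ((2 * (V y - V x) - (v x + v y) * (y - x))
       - (1 - a) * (v x * x - v y * y)
       + s ^+ 2 / 2 * (p * (v y ^+ 2 - v x ^+ 2))).
Proof.
have s0 : s != 0 by rewrite gt_eqF.
rewrite /forward_exponent /backward_exponent /D.
have -> : m ^+ 2 = (1 - a ^+ 2) / (2 * s ^+ 2) by rewrite -sE; field.
by field.
Qed.

(** The outer [M] bounds [p]; the three terms bound the trapezoid remainder, the [1 - a] term and
    the squared drifts. *)
Let C1 := M * (M + m ^+ 2 * M + M ^+ 3).

Let exponent_bound1 x y :
  `|forward_exponent x y - backward_exponent x y| <=
  C1 * (`|y - x| ^+ 3 + r ^+ 2 * `|y - x| * (1 + `|x|)).
Proof.
rewrite forward_backward_exponent normrM /C1 -[leRHS]mulrA.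
apply: ler_pM => //.
set d := `|y - x|.
have d0 : 0 <= d by exact: normr_ge0.
have x0 : 0 <= `|x| by exact: normr_ge0.
have m0 := ltW m_gt0; have rge0 : 0 <= r by case/andP: r01 => /ltW.
have /andP[r0 r1] := r01; have /andP[a0 a1] := a01.
have t1 := trapezoid x y.
have t2 : `|(1 - a) * (v x * x - v y * y)| <= m ^+ 2 * r ^+ 2 * (M * d * (1 + `|x|)).
  rewrite normrM; apply: ler_pM => //; first by rewrite ger0_norm// subr_ge0.
  rewrite (_ : v x * x - v y * y = - ((v y - v x) * x + v y * (y - x))); last by ring.
  rewrite normrN (le_trans (ler_normD _ _))// !normrM mulrDr mulr1 addrC.
  apply: lerD; [exact: ler_wpM2r|exact: ler_wpM2r].
have t3 : `|s ^+ 2 / 2 * (p * (v y ^+ 2 - v x ^+ 2))| <= r ^+ 2 * (M ^+ 3 * d).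
  rewrite subr_sqr normrM (_ : r ^+ 2 * (M ^+ 3 * d) = (r ^+ 2 / 2) * (M * ((M * d) * (2 * M)))); last by field.
  apply: ler_pM => //.
    rewrite ger0_norm ?divr_ge0 ?sqr_ge0// ler_pM2r// lerXn2r// nnegrE; exact: ltW.
  rewrite normrM; apply: ler_pM => //; rewrite normrM; apply: ler_pM => //.
  by rewrite (le_trans (ler_normD _ _))//; have := vM x; have := vM y; lra.
rewrite (le_trans (ler_normD _ _))// (le_trans (lerD (ler_normB _ _) t3))//.
rewrite (le_trans (lerD (lerD t1 t2) (lexx _)))// -/d.
have h1 : 0 <= M * (r ^+ 2 * d * (1 + `|x|)) by rewrite !mulr_ge0 ?addr_ge0.
have h2 : 0 <= m ^+ 2 * M * d ^+ 3 by rewrite !mulr_ge0.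
have h3 : 0 <= M ^+ 3 * d ^+ 3 by rewrite !mulr_ge0 ?exprn_ge0.
have h4 : 0 <= M ^+ 3 * (r ^+ 2 * d * `|x|) by rewrite !mulr_ge0.
rewrite -subr_ge0.
rewrite (_ : _ - _ = M * (r ^+ 2 * d * (1 + `|x|)) + m ^+ 2 * M * d ^+ 3 +
  M ^+ 3 * d ^+ 3 + M ^+ 3 * (r ^+ 2 * d * `|x|)); last by ring.
by rewrite !addr_ge0.
Qed.

Let C2 := m ^+ 2 + M ^+ 2 + 1.

(** The normalised innovation [(y - D x) / s] is the variable of order 1: the noise has size
    [s <= r], and both the contraction and the drift have size [r ^+ 2 <= r]. *)
Let increment_bound x y :
  `|y - x| <= C2 * r * (1 + `|x| + `|(y - D x) / s|).
Proof.
have m0 := ltW m_gt0; have rge0 : 0 <= r by case/andP: r01 => /ltW.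
have /andP[r0 r1] := r01; have /andP[a0 a1] := a01.
have s0 : s != 0 by rewrite gt_eqF.
rewrite (_ : y - x = - ((1 - a) * x) - s ^+ 2 * (p * v x) + s * ((y - D x) / s)); last first.
  by rewrite /D; field.
rewrite (le_trans (ler_normD _ _))// (le_trans (lerD (ler_normB _ _) (lexx _)))//.
rewrite normrN !normrM.
set n := (y - D x) / s.
rewrite -(normrM _ s^-1) -/n.
have rr : r ^+ 2 <= r by rewrite expr2 ger_pMl.
have t1 : `|1 - a| * `|x| <= m ^+ 2 * r * `|x|.
  rewrite ler_wpM2r// ger0_norm ?subr_ge0// (le_trans a_le)//.
  by rewrite ler_wpM2l// sqr_ge0.
have t2 : `|s| * `|s| * (`|p| * `|v x|) <= r * M ^+ 2.
  have t21 : `|s| * `|s| <= r.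
    by rewrite (le_trans _ rr)// expr2 ler_pM// gtr0_norm.
  have t22 : `|p| * `|v x| <= M ^+ 2 by rewrite expr2 ler_pM.
  by rewrite ler_pM// mulr_ge0.
have t3 : `|s| * `|n| <= r * `|n| by rewrite ler_wpM2r// gtr0_norm.
rewrite (le_trans (lerD (lerD t1 t2) t3))//.
have x0 := normr_ge0 x; have n0 := normr_ge0 n.
have h1 : 0 <= m ^+ 2 * r * (1 + `|n|) by rewrite !mulr_ge0 ?addr_ge0.
have h2 : 0 <= M ^+ 2 * r * (`|x| + `|n|) by rewrite !mulr_ge0 ?addr_ge0.
have h3 : 0 <= r * (1 + `|x|) by rewrite mulr_ge0 ?addr_ge0// ltW.
rewrite -subr_ge0 (_ : _ - _ = m ^+ 2 * r * (1 + `|n|) +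
  M ^+ 2 * r * (`|x| + `|n|) + r * (1 + `|x|)); last by rewrite /C2; ring.
by rewrite !addr_ge0.
Qed.

(** As increments have order [r], every term of the difference has order [r ^+ 3]. The cubic growth
    in [1 + |x| + |n|] is traded for exponentials by [t ^+ 3 <= 27 * expR t], because these
    factorise and have explicit Gaussian moments. *)
Lemma exponent_bound x y :
  `|forward_exponent x y - backward_exponent x y| <=
  27 * expR 1 * (C1 * (C2 ^+ 3 + C2)) * r ^+ 3 * (expR `|x| * expR `|(y - D x) / s|).
Proof.
have m0 := ltW m_gt0; have rge0 : 0 <= r by case/andP: r01 => /ltW.
have /andP[r0 r1] := r01.
rewrite (le_trans (exponent_bound1 x y))//.
set n := `|(y - D x) / s|; set X := `|x|.
have x0 : 0 <= X by exact: normr_ge0.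
have n0 : 0 <= n by exact: normr_ge0.
pose E := 1 + X + n.
have E1 : 1 <= E by rewrite /E; lra.
have C20 : 0 <= C2 by rewrite /C2 !addr_ge0 ?sqr_ge0.
have C10 : 0 <= C1 by rewrite /C1 mulr_ge0// !addr_ge0 ?mulr_ge0 ?sqr_ge0// exprn_ge0.
have i := increment_bound x y; rewrite -/n -/X -/E in i.
have E3 : E ^+ 3 <= 27 * (expR 1 * expR X * expR n).
  by rewrite -!expRD expR_ge_cube// /E; lra.
have b1 : `|y - x| ^+ 3 <= C2 ^+ 3 * (r ^+ 3 * E ^+ 3).
  by rewrite -!exprMn mulrA lerXn2r ?nnegrE// (le_trans _ i).
have b2 : r ^+ 2 * `|y - x| * (1 + X) <= C2 * (r ^+ 3 * E ^+ 3).
  have b3 : r ^+ 2 * `|y - x| * (1 + X) <= r ^+ 2 * (C2 * r * E) * E.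
    apply: ler_pM; rewrite ?mulr_ge0 ?sqr_ge0 ?addr_ge0//; last by rewrite /E lerDl.
    by rewrite ler_wpM2l ?sqr_ge0.
  rewrite (le_trans b3)//.
  rewrite (_ : r ^+ 2 * _ * _ = C2 * (r ^+ 3 * E ^+ 2)); last by ring.
  rewrite ler_wpM2l// ler_wpM2l ?exprn_ge0//.
  by rewrite ler_weXn2l.
apply: (@le_trans _ _ (C1 * ((C2 ^+ 3 + C2) * (r ^+ 3 * (27 * (expR 1 * expR X * expR n)))))).
  rewrite ler_wpM2l// (le_trans (lerD b1 b2))// -mulrDl ler_wpM2l//.
    by rewrite addr_ge0// exprn_ge0.
  by rewrite ler_wpM2l// exprn_ge0// ltW.
by rewrite le_eqVlt; apply/orP; left; apply/eqP; ring.
Qed.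

End one_step_exponents.

Section gaussian_exponential_moments.
Context (R : realType).
Local Notation mu := (@lebesgue_measure R).

Let expR_norm_integral (f g : R -> R) (c : R) :
  measurable_fun setT f -> measurable_fun setT g ->
  (forall x, 0 <= f x) ->
  0 <= c ->
  (\int[mu]_x (expR (g x) * f x)%:E = c%:E)%E ->
  (\int[mu]_x (expR (- g x) * f x)%:E = c%:E)%E ->
  (\int[mu]_x (expR `|g x| * f x)%:E <= (2 * c)%:E)%E.
Proof.
move=> mf mg f0 c0 E1 E2.
have m1 : measurable_fun setT (fun x => (expR (g x) * f x)%:E).
  by apply/measurable_EFinP/measurable_funM => //; exact: measurableT_comp.
have m2 : measurable_fun setT (fun x => (expR (- g x) * f x)%:E).
  apply/measurable_EFinP/measurable_funM => //; apply: measurableT_comp => //.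
  exact: measurableT_comp.
rewrite mulrDl mul1r EFinD -{1}E1 -E2 -ge0_integralD//; last 2 first.
- by move=> x _; rewrite lee_fin mulr_ge0 ?expR_ge0.
- by move=> x _; rewrite lee_fin mulr_ge0 ?expR_ge0.
apply: ge0_le_integral => //.
- by move=> x _; rewrite lee_fin mulr_ge0 ?expR_ge0.
- apply/measurable_EFinP/measurable_funM => //; apply: measurableT_comp => //.
  exact: measurableT_comp.
- exact: emeasurable_funD.
- by move=> x _; rewrite -EFinD lee_fin -mulrDl ler_wpM2r// expR_norm_le.
Qed.

(** Completing the square: the factor [expR (e * z)], for [e] equal to 1 or -1, shifts the mean by
    [e * s] and costs [expR (1 / 2)]. The two signs together dominate the absolute value. *)
Lemma normal_pdf_expR_norm (D s : R) : 0 < s ->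
  (\int[mu]_y (expR `|(y - D) / s| * normal_pdf D s y)%:E <=
   (2 * expR (1 / 2))%:E)%E.
Proof.
move=> s_gt0; have s0 : s != 0 by rewrite gt_eqF.
have key (e : R) : e ^+ 2 = 1 -> (\int[mu]_y
    (expR (e * ((y - D) / s)) * normal_pdf D s y)%:E = (expR (1 / 2))%:E)%E.
  move=> e1.
  have E y : (expR (e * ((y - D) / s)) * normal_pdf D s y)%:E =
      ((expR (1 / 2))%:E * (normal_pdf (D + e * s) s y)%:E)%E.
    rewrite -EFinM; congr EFin; rewrite !normal_pdf_expR// mulrCA [RHS]mulrCA.
    congr (_ * _); rewrite -!expRD; congr expR.
    have -> : 1 / 2 = e ^+ 2 / 2 by rewrite e1.
    by field.
  under eq_integral do rewrite E.
  rewrite ge0_integralZl//.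
  - by rewrite integral_normal_pdf mule1.
  - by apply/measurable_EFinP; exact: measurable_normal_pdf.
  - by move=> x _; rewrite lee_fin normal_pdf_ge0.
apply: expR_norm_integral => //; rewrite ?expR_ge0//.
- exact: measurable_normal_pdf.
- by apply: measurable_funM => //; exact: measurable_funB.
- by move=> x; exact: normal_pdf_ge0.
- by rewrite -(key 1) ?expr1n//; apply: eq_integral => y _; rewrite mul1r.
- by rewrite -(key (- 1)) ?sqrrN ?expr1n//; apply: eq_integral => y _; rewrite mulN1r.
Qed.

Lemma gaussian_expR_norm (m : R) : 0 < m ->
  exists G : R, (\int[mu]_x (expR `|x| * expR (- m ^+ 2 * x ^+ 2))%:E <= G%:E)%E.
Proof.
move=> m0; pose s := Num.sqrt ((2 * m ^+ 2)^-1).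
have s2 : s ^+ 2 = (2 * m ^+ 2)^-1.
  by rewrite sqr_sqrtr// invr_ge0 mulr_ge0// sqr_ge0.
have s_gt0 : 0 < s by rewrite sqrtr_gt0 invr_gt0 mulr_gt0// exprn_gt0.
have s0 : s != 0 by rewrite gt_eqF.
have mn0 : m != 0 by rewrite gt_eqF.
exists (2 * (expR (1 / (4 * m ^+ 2)) / normal_peak s)).
have key (e : R) : e ^+ 2 = 1 -> (\int[mu]_y
    (expR (e * y) * expR (- m ^+ 2 * y ^+ 2))%:E =
    (expR (1 / (4 * m ^+ 2)) / normal_peak s)%:E)%E.
  move=> e1.
  have E y : (expR (e * y) * expR (- m ^+ 2 * y ^+ 2))%:E =
      ((expR (1 / (4 * m ^+ 2)) / normal_peak s)%:E *
       (normal_pdf (e / (2 * m ^+ 2)) s y)%:E)%E.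
    rewrite -EFinM; congr EFin; rewrite normal_pdf_expR//.
    rewrite [RHS]mulrA divfK ?gt_eqF ?normal_peak_gt0// -!expRD; congr expR.
    have -> : 1 / (4 * m ^+ 2) = e ^+ 2 / (4 * m ^+ 2) by rewrite e1.
    by rewrite s2; field.
  under eq_integral do rewrite E.
  rewrite ge0_integralZl//.
  - by rewrite integral_normal_pdf mule1.
  - by apply/measurable_EFinP; exact: measurable_normal_pdf.
  - by move=> x _; rewrite lee_fin normal_pdf_ge0.
  - by rewrite lee_fin divr_ge0 ?expR_ge0 ?normal_peak_ge0.
apply: expR_norm_integral => //.
- by apply: measurableT_comp => //; exact: measurable_funM.
- by rewrite divr_ge0 ?expR_ge0 ?normal_peak_ge0.
- by rewrite -(key 1) ?expr1n//; apply: eq_integral => y _; rewrite mul1r.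
- by rewrite -(key (- 1)) ?sqrrN ?expr1n//; apply: eq_integral => y _; rewrite mulN1r.
Qed.

End gaussian_exponential_moments.

Section one_step.
Context (R : realType) (m a s r M p q G : R) (V v : R -> R).
Hypothesis m_gt0 : 0 < m.
Hypothesis s_gt0 : 0 < s.
Hypothesis r01 : 0 < r <= 1.
Hypothesis s_le : s <= r.
Hypothesis a01 : 0 <= a <= 1.
Hypothesis a_le : 1 - a <= m ^+ 2 * r ^+ 2.
Hypothesis sE : 2 * m ^+ 2 * s ^+ 2 = 1 - a ^+ 2.
Hypothesis VM : forall x, `|V x| <= M.
Hypothesis vM : forall x, `|v x| <= M.
Hypothesis vL : forall x y, `|v y - v x| <= M * `|y - x|.
Hypothesis trapezoid : forall x y,
  `|2 * (V y - V x) - (v x + v y) * (y - x)| <= M * `|y - x| ^+ 3.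
Hypothesis pM : `|p| <= M.
Hypothesis qM : `|q| <= M.
Hypothesis mV : measurable_fun setT V.
Hypothesis mv : measurable_fun setT v.
Hypothesis GE : (\int[@lebesgue_measure R]_x
  (expR `|x| * expR (- m ^+ 2 * x ^+ 2))%:E <= G%:E)%E.

Local Notation mu := (@lebesgue_measure R).
Local Notation rT := (measurableTypeR R).
Let D x := a * x - s ^+ 2 * (p * v x).
Let A := forward_exponent m a s p q V v.
Let B := backward_exponent m a s p q V v.

(** Product of the constant of [exponent_bound], the bound [expR (6 * M ^+ 2)] on the factors
    containing [V], the exponential moment of the normalised innovation and that of [x]. The leading
    2 counts the contributions [c1] and [c2]. *)
Definition one_step_constant : R :=
  let C1 := M * (M + m ^+ 2 * M + M ^+ 3) in
  let C2 := m ^+ 2 + M ^+ 2 + 1 in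
  2 * (27 * expR 1 * (C1 * (C2 ^+ 3 + C2)) * expR (6 * M ^+ 2) *
       (2 * expR (1 / 2)) * G).

Let M0 : 0 <= M. Proof. exact: le_trans (VM 0). Qed.
Let s0 : s != 0. Proof. by rewrite gt_eqF. Qed.

Let mD : measurable_fun setT D.
Proof.
apply: measurable_funB; first exact: measurable_funM.
by apply: measurable_funM => //; exact: measurable_funM.
Qed.

Let tonelli (f : rT * rT -> \bar R) : measurable_fun setT f -> (forall z, 0 <= f z)%E ->
  (\int[mu]_x \int[mu]_y f (x, y) = \int[mu]_y \int[mu]_x f (x, y))%E.
Proof. by move=> mf f0; exact: fubini_tonelli. Qed.

Let double_integral_le (f g h : rT * rT -> \bar R) (c : \bar R) :
  measurable_fun setT f -> measurable_fun setT g -> measurable_fun setT h ->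
  (forall z, 0 <= f z)%E -> (forall z, 0 <= g z)%E -> (forall z, 0 <= h z)%E ->
  (forall z, f z <= g z + h z)%E -> (\int[mu]_x \int[mu]_y h (x, y) <= c)%E ->
  (\int[mu]_x \int[mu]_y f (x, y) <= \int[mu]_x \int[mu]_y g (x, y) + c)%E.
Proof.
move=> mf mg mh f0 g0 h0 fgh hc.
apply: le_trans (leeD2l _ hc).
have E (k : rT * rT -> \bar R) : measurable_fun setT k -> (forall z, 0 <= k z)%E ->
    (\int[mu]_x \int[mu]_y k (x, y) = \int[mu \x mu]_z k z)%E.
  by move=> mk k0; rewrite fubini_tonelli1.
rewrite !E// -ge0_integralD//.
by apply: ge0_le_integral => //; exact: emeasurable_funD.
Qed.

Let m1 (f : rT -> R) : measurable_fun setT f ->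
  measurable_fun setT (fun z : rT * rT => f z.1).
Proof. by move=> mf; exact: measurableT_comp mf measurable_fst. Qed.

Let m2 (f : rT -> R) : measurable_fun setT f ->
  measurable_fun setT (fun z : rT * rT => f z.2).
Proof. by move=> mf; exact: measurableT_comp mf measurable_snd. Qed.

Let mA : measurable_fun setT (fun z : rT * rT => A z.1 z.2).
Proof.
apply: measurable_funB.
  apply: measurable_funB.
    apply: measurable_funB.
      apply: measurable_funM => //; apply: measurable_funX; exact: measurable_fst.
    apply: measurable_funM => //; exact: (m1 mV).
  apply: measurable_funM => //; apply: measurable_funX; apply: measurable_funB.
    exact: measurable_snd.
  exact: (m1 mD).
apply: measurable_funM => //; exact: (m2 mV).
Qed.

Let mB : measurable_fun setT (fun z : rT * rT => B z.1 z.2).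
Proof.
apply: measurable_funB.
  apply: measurable_funB.
    apply: measurable_funM => //; apply: measurable_funX; exact: measurable_snd.
  apply: measurable_funM => //; exact: (m2 mV).
apply: measurable_funM => //; apply: measurable_funX; apply: measurable_funB.
  exact: measurable_fst.
exact: (m2 mD).
Qed.

(** [c1] and [c2] are the two terms by which [ler_dist_expR] dominates the difference of the
    exponentials. They are kept apart since each is integrated in its own order. *)
Let c1 (z : rT * rT) :=
  (normal_peak s * (`|A z.1 z.2 - B z.1 z.2| * expR (A z.1 z.2)))%:E.
Let c2 (z : rT * rT) :=
  (normal_peak s * (`|A z.1 z.2 - B z.1 z.2| * expR (B z.1 z.2)))%:E.

Let mc1 : measurable_fun setT c1.
Proof.
apply/measurable_EFinP; apply: measurable_funM => //.
apply: measurable_funM; last exact: measurableT_comp mA.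
by apply: measurableT_comp => //; exact: measurable_funB.
Qed.

Let mc2 : measurable_fun setT c2.
Proof.
apply/measurable_EFinP; apply: measurable_funM => //.
apply: measurable_funM; last exact: measurableT_comp mB.
by apply: measurableT_comp => //; exact: measurable_funB.
Qed.

Let c1_ge0 z : (0 <= c1 z)%E.
Proof. by rewrite lee_fin !mulr_ge0 ?normal_peak_ge0 ?expR_ge0. Qed.

Let c2_ge0 z : (0 <= c2 z)%E.
Proof. by rewrite lee_fin !mulr_ge0 ?normal_peak_ge0 ?expR_ge0. Qed.

Let K := 27 * expR 1 * (M * (M + m ^+ 2 * M + M ^+ 3) *
   ((m ^+ 2 + M ^+ 2 + 1) ^+ 3 + (m ^+ 2 + M ^+ 2 + 1))) * r ^+ 3.

Let bnd x y := K * (expR `|x| * expR `|(y - D x) / s|) * expR (6 * M ^+ 2) *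
   expR (- m ^+ 2 * x ^+ 2) * normal_pdf (D x) s y.

Let K0 : 0 <= K.
Proof.
have m0 := ltW m_gt0; have /andP[/ltW r0 _] := r01.
by rewrite /K !(mulr_ge0, addr_ge0, exprn_ge0, expR_ge0).
Qed.

Let pqV x y : - (2 * p * V x) - 2 * (q - p) * V y <= 6 * M ^+ 2.
Proof.
have h (u : R) w : `|u| <= M -> `|V w| <= M -> `|u * V w| <= M ^+ 2.
  by move=> hu hw; rewrite normrM expr2 ler_pM.
have := h p x pM (VM x); have := h p y pM (VM y); have := h q y qM (VM y).
rewrite !ler_norml => /andP[? ?] /andP[? ?] /andP[? ?]; nra.
Qed.

Let qV y : - (2 * q * V y) <= 6 * M ^+ 2.
Proof.
have : `|q * V y| <= M ^+ 2 by rewrite normrM expr2 ler_pM.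
by have := sqr_ge0 M; rewrite ler_norml => ? /andP[? ?]; nra.
Qed.

Let bndE x y : bnd x y = normal_peak s * (K * (expR `|x| * expR `|(y - D x) / s|) *
  expR (6 * M ^+ 2 + - m ^+ 2 * x ^+ 2 + - (y - D x) ^+ 2 / (s ^+ 2 *+ 2))).
Proof. by rewrite /bnd normal_pdf_expR// !expRD; ring. Qed.

Let distAB x y :
  `|A x y - B x y| <= K * (expR `|x| * expR `|(y - D x) / s|).
Proof. exact: exponent_bound. Qed.

Let c1_le z : (c1 z <= (bnd z.1 z.2)%:E)%E.
Proof.
rewrite lee_fin bndE ler_wpM2l ?normal_peak_ge0//.
apply: ler_pM => //.
rewrite ler_expR /A /forward_exponent -/(D z.1).
have := pqV z.1 z.2; lra.
Qed.

(** The closed form of [A - B] is odd under the exchange of the variables. The term weighted by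
    [expR B], which is Gaussian around [D y], thereby gets the bound of the other term with [x] and
    [y] swapped. *)
Let antisym x y : A x y - B x y = - (A y x - B y x).
Proof. by rewrite /A /B !forward_backward_exponent//; ring. Qed.

Let c2_le z : (c2 z <= (bnd z.2 z.1)%:E)%E.
Proof.
rewrite lee_fin bndE ler_wpM2l ?normal_peak_ge0//.
rewrite antisym normrN.
apply: ler_pM => //.
rewrite ler_expR /B /backward_exponent -/(D z.2).
have := qV z.2; lra.
Qed.

Let mbnd : measurable_fun setT (fun z : rT * rT => (bnd z.1 z.2)%:E).
Proof.
apply/measurable_EFinP; rewrite (_ : (fun z => _) = fun z : rT * rT =>
    normal_peak s * (K * (expR `|z.1| * expR `|(z.2 - D z.1) / s|) *
    expR (6 * M ^+ 2 + - m ^+ 2 * z.1 ^+ 2 + - (z.2 - D z.1) ^+ 2 / (s ^+ 2 *+ 2)))); last first.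
  by apply/funext => z; exact: bndE.
have mzD : measurable_fun setT (fun z : rT * rT => z.2 - D z.1).
  by apply: measurable_funB; [exact: measurable_snd|exact: (m1 mD)].
apply: measurable_funM => //; apply: measurable_funM.
  apply: measurable_funM => //; apply: measurable_funM.
    apply: measurableT_comp => //; apply: measurableT_comp => //; exact: measurable_fst.
  apply: measurableT_comp => //; apply: measurableT_comp => //.
  exact: measurable_funM.
apply: measurableT_comp => //; apply: measurable_funD.
  apply: measurable_funD => //; apply: measurable_funM => //.
  apply: measurable_funX; exact: measurable_fst.
apply: measurable_funM => //; apply: measurableT_comp => //.
exact: measurable_funX.
Qed.

Let integral_bnd : (\int[mu]_x \int[mu]_y (bnd x y)%:E <=
  (one_step_constant / 2 * r ^+ 3)%:E)%E.
Proof.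
have bnd_ge0 x y : (0 <= (bnd x y)%:E)%E.
  rewrite lee_fin bndE.
  exact: mulr_ge0 (normal_peak_ge0 _) (mulr_ge0 (mulr_ge0 K0 (mulr_ge0 (expR_ge0 _) (expR_ge0 _))) (expR_ge0 _)).
have KE0 : 0 <= K * expR (6 * M ^+ 2) by exact: mulr_ge0 K0 (expR_ge0 _).
have KC0 : 0 <= K * expR (6 * M ^+ 2) * (2 * expR (1 / 2)).
  by apply: mulr_ge0 => //; rewrite mulr_ge0 ?expR_ge0.
have gg0 x : 0 <= expR `|x| * expR (- m ^+ 2 * x ^+ 2) by exact: mulr_ge0 (expR_ge0 _) (expR_ge0 _).
have mg : measurable_fun setT (fun x : rT => expR `|x| * expR (- m ^+ 2 * x ^+ 2)).
  apply: measurable_funM; first by apply: measurableT_comp => //; exact: measurableT_comp.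
  by apply: measurableT_comp => //; exact: measurable_funM.
have inner x : (\int[mu]_y (bnd x y)%:E <=
    (K * expR (6 * M ^+ 2) * (2 * expR (1 / 2)))%:E *
    (expR `|x| * expR (- m ^+ 2 * x ^+ 2))%:E)%E.
  have E y : (bnd x y)%:E =
     ((K * expR (6 * M ^+ 2) * (expR `|x| * expR (- m ^+ 2 * x ^+ 2)))%:E *
      (expR `|(y - D x) / s| * normal_pdf (D x) s y)%:E)%E.
    by rewrite -EFinM; congr EFin; rewrite /bnd; ring.
  under eq_integral do rewrite E.
  rewrite ge0_integralZl//; last 3 first.
  - apply/measurable_EFinP; apply: measurable_funM; last exact: measurable_normal_pdf.
    apply: measurableT_comp => //; apply: measurableT_comp => //.
    by apply: measurable_funM => //; exact: measurable_funB.
  - by move=> y _; rewrite lee_fin mulr_ge0 ?expR_ge0 ?normal_pdf_ge0.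
  - by rewrite lee_fin; exact: mulr_ge0.
  apply: (le_trans (lee_wpmul2l _ (normal_pdf_expR_norm (D x) s_gt0))).
    by rewrite lee_fin; exact: mulr_ge0.
  by rewrite -!EFinM lee_fin le_eqVlt; apply/orP; left; apply/eqP; ring.
pose KC := K * expR (6 * M ^+ 2) * (2 * expR (1 / 2)).
apply: (@le_trans _ _ (\int[mu]_x (KC%:E *
    (expR `|x| * expR (- m ^+ 2 * x ^+ 2))%:E))%E).
  apply: ge0_le_integral => //.
  - by move=> x _; apply: integral_ge0 => y _; exact: bnd_ge0.
  - exact: (measurable_fun_fubini_tonelli_F _ mbnd (fun z => bnd_ge0 z.1 z.2)).
  - by apply: emeasurable_funM => //; exact/measurable_EFinP.
rewrite ge0_integralZl//; last exact/measurable_EFinP.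
apply: (le_trans (lee_wpmul2l _ GE)) => //.
rewrite -EFinM lee_fin /one_step_constant /KC /K le_eqVlt; apply/orP; left; apply/eqP.
by field.
Qed.

Let integral_c : (\int[mu]_x \int[mu]_y (c1 (x, y) + c2 (x, y)) <=
  (one_step_constant * r ^+ 3)%:E)%E.
Proof.
have E x : (\int[mu]_y (c1 (x, y) + c2 (x, y)) =
    \int[mu]_y c1 (x, y) + \int[mu]_y c2 (x, y))%E.
  rewrite ge0_integralD//; first by move: mc1 => /measurableT_comp; apply; exact: pair1_measurable.
  by move: mc2 => /measurableT_comp; apply; exact: pair1_measurable.
under eq_integral do rewrite E.
rewrite ge0_integralD//; last 4 first.
- by move=> x _; exact: integral_ge0.
- exact: measurable_fun_fubini_tonelli_F mc1 c1_ge0.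
- by move=> x _; exact: integral_ge0.
- exact: measurable_fun_fubini_tonelli_F mc2 c2_ge0.
have -> : one_step_constant * r ^+ 3 =
  one_step_constant / 2 * r ^+ 3 + one_step_constant / 2 * r ^+ 3 by field.
have bnd_ge0 x y : (0 <= (bnd x y)%:E)%E.
  rewrite lee_fin bndE.
  exact: mulr_ge0 (normal_peak_ge0 _) (mulr_ge0 (mulr_ge0 K0 (mulr_ge0 (expR_ge0 _) (expR_ge0 _))) (expR_ge0 _)).
rewrite EFinD; apply: leeD.
  apply: le_trans integral_bnd; apply: ge0_le_integral => //.
  - by move=> x _; exact: integral_ge0.
  - exact: measurable_fun_fubini_tonelli_F mc1 c1_ge0.
  - exact: (measurable_fun_fubini_tonelli_F _ mbnd (fun z => bnd_ge0 z.1 z.2)).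
  - move=> x _; apply: ge0_le_integral => //.
    + by move: mc1 => /measurableT_comp; apply; exact: pair1_measurable.
    + exact: (measurableT_comp mbnd (pair1_measurable x)).
rewrite (tonelli mc2 c2_ge0).
apply: le_trans integral_bnd; apply: ge0_le_integral => //.
- by move=> x _; exact: integral_ge0.
- exact: measurable_fun_fubini_tonelli_G mc2 c2_ge0.
- exact: (measurable_fun_fubini_tonelli_F _ mbnd (fun z => bnd_ge0 z.1 z.2)).
- move=> y _; apply: ge0_le_integral => //.
  + by move: mc2 => /measurableT_comp; apply; exact: pair2_measurable.
  + exact: (measurableT_comp mbnd (pair1_measurable y)).
Qed.

(** Both sides are double integrals of [psi y], one against [expR A] and the other against [expR B],
    which is a full Gaussian in [x]. As [psi <= 1], only the difference of the exponentials matters.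
    Two inequalities avoid subtracting extended reals. *)
Lemma one_step_le (psi : rT -> R) : measurable_fun setT psi ->
  (forall y, 0 <= psi y <= 1) ->
  let left := (\int[mu]_x ((\int[normal_prob (D x) s]_y
      (psi y * expR (- 2 * (q - p) * V y))%:E) *
      (expR (- m ^+ 2 * x ^+ 2 - 2 * p * V x))%:E))%E in
  let right := (\int[mu]_y (psi y * expR (- m ^+ 2 * y ^+ 2 - 2 * q * V y))%:E)%E in
  (left <= right + (one_step_constant * r ^+ 3)%:E /\
   right <= left + (one_step_constant * r ^+ 3)%:E)%E.
Proof.
move=> mpsi psi01 left right.
have psi0 y : 0 <= psi y by have /andP[] := psi01 y.
pose fa (z : rT * rT) := (normal_peak s * (psi z.2 * expR (A z.1 z.2)))%:E.
pose fb (z : rT * rT) := (normal_peak s * (psi z.2 * expR (B z.1 z.2)))%:E.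
have mfa : measurable_fun setT fa.
  apply/measurable_EFinP; apply: measurable_funM => //.
  by apply: measurable_funM; [exact: m2|exact: measurableT_comp mA].
have mfb : measurable_fun setT fb.
  apply/measurable_EFinP; apply: measurable_funM => //.
  by apply: measurable_funM; [exact: m2|exact: measurableT_comp mB].
have fa0 z : (0 <= fa z)%E by rewrite lee_fin !mulr_ge0 ?normal_peak_ge0 ?expR_ge0.
have fb0 z : (0 <= fb z)%E by rewrite lee_fin !mulr_ge0 ?normal_peak_ge0 ?expR_ge0.
have leftE : (left = \int[mu]_x \int[mu]_y fa (x, y))%E.
  apply: eq_integral => x _; rewrite integral_normal_prob; last first.
    apply/measurable_EFinP; apply: measurable_funM => //.
    by apply: measurableT_comp => //; exact: measurable_funM.
  have mpE : measurable_fun setT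
      (fun y : rT => (psi y * expR (- 2 * (q - p) * V y))%:E * (normal_pdf (D x) s y)%:E)%E.
    apply: emeasurable_funM; apply/measurable_EFinP; last exact: measurable_normal_pdf.
    apply: measurable_funM => //.
    by apply: measurableT_comp => //; exact: measurable_funM.
  have pE0 (y : rT) : (0 <= (psi y * expR (- 2 * (q - p) * V y))%:E * (normal_pdf (D x) s y)%:E)%E.
    by rewrite -EFinM lee_fin; exact: mulr_ge0 (mulr_ge0 (psi0 y) (expR_ge0 _)) (normal_pdf_ge0 _ _ _).
  rewrite -(ge0_integralZr mu measurableT mpE (fun y _ => pE0 y)) ?lee_fin ?expR_ge0//.
  apply: eq_integral => y _; rewrite -!EFinM /fa/=; congr EFin.
  rewrite normal_pdf_expR// /A /forward_exponent -/(D x) !expRD.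
  rewrite (_ : - (2 * (q - p) * V y) = - 2 * (q - p) * V y); last by ring.
  by rewrite [- _ ^+ 2 / _]mulNr; ring.
have rightE : (right = \int[mu]_x \int[mu]_y fb (x, y))%E.
  rewrite (tonelli mfb fb0); apply: eq_integral => y _.
  have E x : fb (x, y) = ((psi y * expR (- m ^+ 2 * y ^+ 2 - 2 * q * V y))%:E *
      (normal_pdf (D y) s x)%:E)%E.
    rewrite -EFinM /fb/=; congr EFin.
    by rewrite normal_pdf_expR// /B /backward_exponent -/(D y) !expRD [- _ ^+ 2 / _]mulNr; ring.
  under eq_integral do rewrite E.
  rewrite ge0_integralZl//.
  - by rewrite integral_normal_pdf mule1.
  - by apply/measurable_EFinP; exact: measurable_normal_pdf.
  - by move=> x _; rewrite lee_fin normal_pdf_ge0.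
  - by rewrite lee_fin mulr_ge0// expR_ge0.
have absE z : normal_peak s * (psi z.2 * `|expR (A z.1 z.2) - expR (B z.1 z.2)|) <=
    normal_peak s * (`|A z.1 z.2 - B z.1 z.2| * expR (A z.1 z.2)) +
    normal_peak s * (`|A z.1 z.2 - B z.1 z.2| * expR (B z.1 z.2)).
  rewrite -mulrDr -mulrDr ler_wpM2l ?normal_peak_ge0//.
  apply: le_trans (ler_dist_expR _ _); apply: ler_piMl => //.
  by have /andP[] := psi01 z.2.
have le12 z : (fa z <= fb z + (c1 z + c2 z))%E.
  rewrite -!EFinD lee_fin -lerBlDl; apply: le_trans (absE z).
  rewrite -mulrBr -mulrBr ler_wpM2l ?normal_peak_ge0// ler_wpM2l//.
  exact: ler_norm.
have le21 z : (fb z <= fa z + (c1 z + c2 z))%E.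
  rewrite -!EFinD lee_fin -lerBlDl; apply: le_trans (absE z).
  rewrite -mulrBr -mulrBr ler_wpM2l ?normal_peak_ge0// ler_wpM2l// distrC.
  exact: ler_norm.
have mc12 : measurable_fun setT (fun z => c1 z + c2 z)%E by exact: emeasurable_funD.
have c120 z : (0 <= c1 z + c2 z)%E by rewrite adde_ge0.
rewrite leftE rightE; split.
  have := @double_integral_le fa fb (fun z => c1 z + c2 z)%E _ mfa mfb mc12 fa0 fb0 c120 le12 integral_c.
  by [].
have := @double_integral_le fb fa (fun z => c1 z + c2 z)%E _ mfb mfa mc12 fb0 fa0 c120 le21 integral_c.
  by [].
Qed.

End one_step.

(** * Innovations of the Ornstein-Uhlenbeck process *)

Lemma integral_gaussian_rv d (T : measurableType d) (R : realType)
    (P : probability T R) (S : T -> R) : gaussian_rv P S ->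
  (exists a, forall f : measurableTypeR R -> \bar R, measurable_fun setT f ->
    (\int[P]_w f (S w) = f a)%E) \/
  (exists a s, s != 0 /\ forall f : measurableTypeR R -> \bar R, measurable_fun setT f ->
    (\int[P]_w f (S w) = \int[normal_prob a s]_x f x)%E).
Proof.
move=> [mS [a [s [s_ge0 law]]]].
have [nu nuE] : exists nu : {finite_measure set (measurableTypeR R) -> \bar R},
    forall f : measurableTypeR R -> \bar R, measurable_fun setT f ->
    (\int[nu]_y f y = \int[P]_w (f (S w) * (cst 1 w)%:E))%E.
  apply: (@weighted_image _ _ _ (measurableTypeR R) R P (cst 1) S) => //.
  rewrite (_ : (fun x => (cst 1 x)%:E) = cst 1%E)// integral_cst//.
  by rewrite [Z in (_ * Z)%E](_ : _ = 1%E) ?mule1 ?ltry//; exact: probability_setT.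
have {}nuE (f : measurableTypeR R -> \bar R) : measurable_fun setT f ->
    (\int[P]_w f (S w) = \int[nu]_y f y)%E.
  by move=> mf; rewrite nuE//; apply: eq_integral => w _; rewrite mule1.
have nuA (A : set (measurableTypeR R)) : measurable A -> nu A = gaussian_law a s A.
  move=> mA; rewrite -law//.
  have mSA : measurable (S @^-1` A) by rewrite -[Z in measurable Z]setTI; exact: mS.
  have := nuE (fun x => (\1_A x)%:E).
  rewrite (integral_indic nu measurableT mA) setIT => <-; last first.
    by apply/measurable_EFinP; exact: measurable_indic.
  by rewrite -[in RHS](setIT (S @^-1` A)) -integral_indic.
rewrite /gaussian_law in nuA; move: nuA; case: eqVneq => [_|s0] nuA.
- left; exists a => f mf; rewrite nuE//.
  transitivity (\int[\d_(a : measurableTypeR R)]_y f y)%E.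
    by apply: eq_measure_integral => A mA _; exact: nuA.
  by rewrite integral_dirac// diracT mul1e.
- right; exists a, s; split => // f mf; rewrite nuE//.
  by apply: eq_measure_integral => A mA _; exact: nuA.
Qed.

Section centered_gaussian.
Context d (T : measurableType d) (R : realType) (P : probability T R).
Variables (S : T -> R) (v theta : R).
Hypothesis gS : gaussian_rv P S.
Hypothesis ES : (\int[P]_w (S w)%:E = 0)%E.
Hypothesis ES2 : (\int[P]_w (S w ^+ 2)%:E = v%:E)%E.

Let mid : measurable_fun setT (fun x : measurableTypeR R => x%:E).
Proof. exact/measurable_EFinP. Qed.

Let msqr : measurable_fun setT (fun x : measurableTypeR R => (x ^+ 2)%:E).
Proof. by apply/measurable_EFinP; exact: measurable_funX. Qed.

Let mcos : measurable_fun setT (fun x : measurableTypeR R => (cos (x + theta))%:E).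
Proof.
apply/measurable_EFinP; have := @measurable_cos_affine R 1 theta.
by under eq_fun do rewrite mul1r.
Qed.

(** The parameters of the law are only known to exist. Stein's identity with [u = 1] and with
    [u = x - a] reads them off the first two moments; the degenerate law has a deterministic value,
    which the first moment forces to be 0. *)
Lemma centered_gaussian_cos :
  \int[P]_w cos (S w + theta) = cos theta * expR (- v / 2).
Proof.
have [[a aE]|[a [s [s0 sE]]]] := integral_gaussian_rv gS.
  have := aE _ mid; rewrite ES => -[a0].
  have := aE _ msqr; rewrite ES2 => -[v0].
  by rewrite /Rintegral (aE _ mcos)/= v0 -a0 expr0n/= add0r oppr0 mul0r expR0 mulr1.
pose p := normal_pdf a s.
have Ep (f : R -> R) : measurable_fun setT (fun x : measurableTypeR R => (f x)%:E) ->
    (\int[P]_w (f (S w))%:E = \int[@lebesgue_measure R]_x (f x * p x)%:E)%E.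
  move=> mf; rewrite (sE _ mf) integral_normal_prob//.
have ip (f : R -> R) (C : R) : measurable_fun setT f ->
    (forall x, `|f x| <= C * (1 + (x - a) ^+ 2)) ->
    lebesgue_measure.-integrable setT (fun x => (f x * p x)%:E).
  exact: integrable_normal_pdf_quadratic.
have p1 : \int[@lebesgue_measure R]_x p x = 1.
  by rewrite /Rintegral integral_normal_pdf.
have iq : lebesgue_measure.-integrable setT (fun x => ((x - a) * p x)%:E).
  apply: (ip _ 1); first exact: measurable_funB.
  move=> x; move: (x - a) => y; rewrite mul1r ler_norml; apply/andP.
  have := sqr_ge0 (y - 1 / 2); have := sqr_ge0 (y + 1 / 2).
  by rewrite !expr2 => h1 h2; split; lra.
have i1 : lebesgue_measure.-integrable setT (fun x => (a * p x)%:E).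
  apply: (ip (cst a) `|a|); first exact: measurable_cst.
  by move=> x; rewrite ler_peMr// lerDl sqr_ge0.
have a0 : a = 0.
  have stein1 := @normal_pdf_stein R a s s0 (cst 1) (cst 0) 1 (fun x => is_derive_cst _ _ _).
  have h0 : \int[@lebesgue_measure R]_x ((x - a) * p x) = 0.
    transitivity (s ^+ 2 * \int[@lebesgue_measure R]_x (cst 0 x * p x)).
      rewrite -stein1//.
      + by apply: eq_Rintegral => x _; rewrite mul1r.
    - by move=> x; exact: cst_continuous.
    - by move=> x; rewrite normr1 mul1r lerDl.
    - by move=> x; rewrite normr0 mul1r addr_ge0// sqr_ge0.
    - under eq_Rintegral do rewrite mul0r.
      by rewrite /Rintegral integral0 mulr0.
  have : \int[@lebesgue_measure R]_x ((x - a) * p x + a * p x) = 0.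
    have := congr1 fine (Ep id mid); rewrite ES/= => E.
    rewrite [RHS]E; apply: eq_Rintegral => x _ /=; ring.
  rewrite RintegralD// h0 add0r RintegralZl ?p1 ?mulr1//.
  rewrite (_ : EFin \o p = fun x => (cst 1 x * p x)%:E); last first.
    by apply/funext => x; rewrite /= mul1r.
  apply: (ip (cst 1) 1); first exact: measurable_cst.
  by move=> x; rewrite normr1 mul1r lerDl sqr_ge0.
have v2 : v = s ^+ 2.
  have := congr1 fine (Ep _ msqr); rewrite ES2/= => ->.
  transitivity (\int[@lebesgue_measure R]_x ((x - a) * (x - a) * p x)).
    by apply: eq_Rintegral => x _; rewrite a0 subr0 expr2.
  have d1 (x : R) : is_derive x 1 (fun x : R => x - a) (cst 1 x).
    rewrite (_ : cst 1 x = 1 - 0); last by rewrite subr0.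
    exact: is_deriveB.
  rewrite (@normal_pdf_stein R a s s0 (fun x => x - a) (cst 1) 1 d1).
  - by under eq_Rintegral do rewrite /= mul1r; rewrite -/p p1 mulr1.
  - by move=> x; exact: cst_continuous.
  - by move=> x; rewrite mul1r lerDr.
  - by move=> x; rewrite normr1 mul1r lerDl sqr_ge0.
rewrite v2 /Rintegral (sE _ mcos).
have := @normal_prob_cos R a s 1 theta s0.
rewrite expr1n mulr1 => /(congr1 fine) /= <-; congr fine.
by apply: eq_integral => x _; rewrite mul1r a0 subr0.
Qed.

End centered_gaussian.

(** The initial value counts as the innovation of index 0, so that the innovations determine the
    whole sampled path. *)
Definition innovation (R : realType) (o : nat -> R) (a : R) (k : nat) : R :=
  if k is k'.+1 then o k - a * o k' else o 0%N.

Definition innovation_variance (R : realType) (a v : R) (k : nat) : R :=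
  if k is _.+1 then v * (1 - a ^+ 2) else v.

Section autoregressive_innovations.
Context d (T : measurableType d) (R : realType) (P : probability T R).
Variables (O : nat -> T -> R) (a v : R).
Hypothesis mO : forall k, measurable_fun setT (O k).
Hypothesis EO : forall k, (\int[P]_w (O k w)%:E = 0)%E.
Hypothesis EOO : forall i k,
  (\int[P]_w (O i w * O (i + k)%N w)%:E = (v * a ^+ k)%:E)%E.
Hypothesis gO : forall n (c : nat -> R),
  gaussian_rv P (fun w => \sum_(k < n) c k * O k w).

Local Notation Y k := (fun w => innovation (O ^~ w) a k).

(** Integrability travels with the value, so that moments combine by linearity without side
    conditions. *)
Let mean (f : T -> R) (x : R) :=
  P.-integrable setT (EFin \o f) /\ \int[P]_w f w = x.

Let iD (f g : T -> R) : P.-integrable setT (EFin \o f) ->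
  P.-integrable setT (EFin \o g) ->
  P.-integrable setT (EFin \o (fun w => f w + g w)).
Proof. by move=> iF ig; have := integrableD measurableT iF ig. Qed.

Let meanD f g x y : mean f x -> mean g y -> mean (fun w => f w + g w) (x + y).
Proof.
move=> [iF fx] [ig gy]; split; last by rewrite RintegralD// fx gy.
exact: iD.
Qed.

Let meanZ b f x : mean f x -> mean (fun w => b * f w) (b * x).
Proof.
move=> [iF fx]; split; last by rewrite RintegralZl// fx.
by have := integrableZl measurableT b iF.
Qed.

Let mean_eq f g x y : f =1 g -> x = y -> mean f x -> mean g y.
Proof. by move=> /funext -> ->. Qed.

Let integral_mean f x : mean f x -> (\int[P]_w (f w)%:E = x%:E)%E.
Proof.
move=> [iF fx]; rewrite -fx /Rintegral fineK//; exact: integrable_fin_num.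
Qed.

Let integrable_sqr i : P.-integrable setT (EFin \o (fun w => O i w ^+ 2)).
Proof.
apply/integrableP; split.
  by apply/measurable_EFinP; exact: measurable_funX.
under eq_integral do rewrite /= ger0_norm ?sqr_ge0// expr2.
have := EOO i 0; rewrite addn0 => ->; exact: ltry.
Qed.

Let integrable_mul i j : P.-integrable setT (EFin \o (fun w => O i w * O j w)).
Proof.
apply: (@le_integrable _ _ R P setT measurableT _
  (EFin \o (fun w => O i w ^+ 2 + O j w ^+ 2))).
- by apply/measurable_EFinP; exact: measurable_funM.
- move=> w _; rewrite /= lee_fin.
  rewrite [leRHS]ger0_norm ?addr_ge0 ?sqr_ge0// ler_norml.
  have := sqr_ge0 (O i w - O j w); have := sqr_ge0 (O i w + O j w).
  have := sqr_ge0 (O i w); have := sqr_ge0 (O j w).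
  rewrite !expr2 => h1 h2 h3 h4; apply/andP; split; nra.
- exact: iD.
Qed.

Let mean0 i : mean (O i) 0.
Proof.
split; last by rewrite /Rintegral EO.
apply: (@le_integrable _ _ R P setT measurableT _
  (EFin \o (fun w => cst 1 w + O i w ^+ 2))).
- exact/measurable_EFinP.
- move=> w _; rewrite /= lee_fin.
  rewrite [leRHS]ger0_norm ?addr_ge0 ?sqr_ge0// ler_norml.
  have := sqr_ge0 (O i w - 1 / 2); have := sqr_ge0 (O i w + 1 / 2).
  by rewrite !expr2 => h1 h2; apply/andP; split; lra.
- apply: iD => //; exact: finite_measure_integrable_cst.
Qed.

Let meanOO i k : mean (fun w => O i w * O (i + k)%N w) (v * a ^+ k).
Proof. by split; [exact: integrable_mul|rewrite /Rintegral EOO]. Qed.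

(** For a geometric covariance an innovation is orthogonal to all earlier values:
    [v * a ^+ k.+1 - a * (v * a ^+ k) = 0]. *)
Let meanOY i k : (i < k)%N -> mean (fun w => O i w * Y k w) 0.
Proof.
case: k => // k; rewrite ltnS => /subnKC <-; move: (k - i)%N => {}k.
have := meanD (meanOO i k.+1) (meanZ (- a) (meanOO i k)).
apply: mean_eq => [w|]; last by rewrite exprS; ring.
by rewrite /= addnS; ring.
Qed.

Let meanYY j k : (j < k)%N -> mean (fun w => Y j w * Y k w) 0.
Proof.
case: j => [|j] jk; first exact: meanOY.
have := meanD (meanOY jk) (meanZ (- a) (meanOY (ltnW jk))).
by apply: mean_eq => [w|]; rewrite /=; ring.
Qed.

Let meanY2 k : mean (fun w => Y k w ^+ 2) (innovation_variance a v k).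
Proof.
case: k => [|k] /=.
  by have := meanOO 0 0; apply: mean_eq => [w|]; rewrite /= ?expr2 ?mulr1.
have h1 := meanOO k.+1 0; have h2 := meanOO k 1; have h3 := meanOO k 0.
have := meanD h1 (meanD (meanZ (- 2 * a) h2) (meanZ (a ^+ 2) h3)).
by apply: mean_eq => [w|]; rewrite ?addn0 ?addn1/=; ring.
Qed.

Let meanY k : mean (Y k) 0.
Proof.
case: k => [|k]; first exact: mean0.
have := meanD (mean0 k.+1) (meanZ (- a) (mean0 k)).
by apply: mean_eq => [w|]; rewrite /=; ring.
Qed.

Let meanS N (c : nat -> R) : mean (fun w => \sum_(j < N) c j * Y j w) 0.
Proof.
elim: N => [|N IH].
  have := meanZ 0 (meanY 0).
  by apply: mean_eq => [w|]; rewrite ?big_ord0 ?mul0r.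
have := meanD IH (meanZ (c N) (meanY N)).
by apply: mean_eq => [w|]; rewrite ?big_ord_recr// mulr0 addr0.
Qed.

Let meanSY N k (c : nat -> R) : (N <= k)%N ->
  mean (fun w => (\sum_(j < N) c j * Y j w) * Y k w) 0.
Proof.
elim: N => [|N IH] Nk.
  have := meanZ 0 (meanY 0).
  by apply: mean_eq => [w|]; rewrite ?big_ord0 ?mul0r.
have := meanD (IH (ltnW Nk)) (meanZ (c N) (meanYY Nk)).
by apply: mean_eq => [w|]; rewrite ?big_ord_recr/=; ring.
Qed.

Let meanS2 N (c : nat -> R) : mean (fun w => (\sum_(j < N) c j * Y j w) ^+ 2)
  (\sum_(j < N) innovation_variance a v j * c j ^+ 2).
Proof.
elim: N => [|N IH].
  have := meanZ 0 (meanY 0).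
  by apply: mean_eq => [w|]; rewrite ?big_ord0 ?mul0r ?expr0n.
have := meanD IH (meanD (meanZ (2 * c N) (meanSY c (leqnn N)))
  (meanZ (c N ^+ 2) (meanY2 N))).
by apply: mean_eq => [w|]; rewrite !big_ord_recr/=; ring.
Qed.

Let sum_innovation N (c : nat -> R) w : \sum_(j < N.+1) c j * Y j w =
  \sum_(k < N.+1) (c k - a * c k.+1) * O k w + a * c N.+1 * O N w.
Proof.
elim: N => [|N IH]; first by rewrite !big_ord_recr !big_ord0/=; ring.
by rewrite big_ord_recr IH [in RHS]big_ord_recr/=; ring.
Qed.

Let gaussian_sum N (c : nat -> R) :
  gaussian_rv P (fun w => \sum_(j < N) c j * Y j w).
Proof.
case: N => [|N].
  by have := gO 0 c; congr gaussian_rv; apply/funext => w; rewrite !big_ord0.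
(* Truncating the coefficients after [N] kills the boundary term of the summation by parts in
   [sum_innovation]. *)
pose b k := if (k <= N)%N then c k else 0.
have := gO N.+1 (fun k => b k - a * b k.+1).
congr gaussian_rv; apply/funext => w.
have bN : a * b N.+1 * O N w = 0 by rewrite /b ltnn mulr0 mul0r.
rewrite -[LHS]addr0 -[Z in _ + Z]bN -sum_innovation; apply: eq_bigr => j _.
by rewrite /b -ltnS ltn_ord.
Qed.

Lemma innovation_cos N (c : nat -> R) theta :
  \int[P]_w cos (\sum_(j < N) c j * innovation (O ^~ w) a j + theta) =
  cos theta * expR (- (\sum_(j < N) innovation_variance a v j * c j ^+ 2) / 2).
Proof.
apply: (centered_gaussian_cos _ (gaussian_sum N c)); apply: integral_mean.
- exact: meanS.
- exact: meanS2.
Qed.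

End autoregressive_innovations.

Lemma measurable_innovation d (T : measurableType d) (R : realType)
    (O : nat -> T -> R) (a : R) (k : nat) :
  (forall j, measurable_fun setT (O j)) -> measurable_fun setT (fun w => innovation (O ^~ w) a k).
Proof.
move=> mO; case: k => [|k]; first exact: (mO 0%N).
by apply: measurable_funB => //; exact: measurable_funM.
Qed.

Section OU_kernel.
Context (R : realType) (m : R).
Hypothesis m_gt0 : 0 < m.
Local Notation mu := (@lebesgue_measure R).
Local Notation K t := (fun u : R => OU_kernel m (t - u)).

Let m2 : 0 < 2 * m ^+ 2. Proof. by rewrite mulr_gt0// exprn_gt0. Qed.

Lemma OU_kernel_ge0 (t : R) : 0 <= OU_kernel m t.
Proof. by rewrite /OU_kernel; case: ifP; rewrite ?expR_ge0. Qed.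

Lemma measurable_OU_kernel (t : R) : measurable_fun setT (K t).
Proof.
rewrite /OU_kernel; apply: measurable_fun_ifT => //.
  apply: measurable_fun_ltr => //; exact: measurable_funB.
apply: measurableT_comp => //; apply: measurable_funM => //.
exact: measurable_funB.
Qed.

Lemma integral_OU_kernel (s t : R) : s <= t ->
  (\int[mu]_u (K s u * K t u)%:E =
   (expR (- m ^+ 2 * (t - s)) / (2 * m ^+ 2))%:E)%E.
Proof.
move=> st.
(* [c = - 2] gives the product of the kernels on the half-line to the left of [s]; [c = 2] gives its
   reflection, to which the fundamental theorem on a right half-line applies. *)
pose f (c x : R) := expR (- m ^+ 2 * (s + t + c * x)).
have df (c x : R) : is_derive x 1 (f c) (- m ^+ 2 * c * f c x).
  rewrite /f; apply: is_derive_eq.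
  by rewrite /GRing.scale/=; ring.
have cf c : continuous (f c) by exact: is_derive_continuous (df c).
transitivity (\int[mu]_(u in `]-oo, (- - s)%R]) (f (- 2) u)%:E)%E.
  rewrite -(@integral_itv_bndo_bndc _ (-oo)%O _ (fun u => (f (-2) u)%:E)).
    rewrite [RHS]integral_mkcond; apply: eq_integral => u _.
    rewrite patchE mem_setE in_itv/= opprK /OU_kernel !subr_gt0.
    case: ifPn => us; last by rewrite mul0r.
    by rewrite (lt_le_trans us st) -expRD /f; congr (expR _)%:E; ring.
  by apply/measurable_EFinP; apply: measurable_funTS; exact: continuous_measurable_fun.
rewrite ge0_integration_by_substitutionNy//; last 2 first.
- exact: continuous_subspaceT.
- by move=> u _; exact: expR_ge0.
have dF (x : R) : is_derive x 1 (fun x => - f 2 x / (2 * m ^+ 2)) (f 2 x).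
  rewrite (_ : (fun x => _) = fun x => - (2 * m ^+ 2)^-1 * f 2 x); last first.
    by apply/funext => y; rewrite mulNr mulrC mulNr.
  apply: is_derive_eq; rewrite /GRing.scale/=.
  by field; rewrite gt_eqF.
rewrite (@ge0_continuous_FTC2y _ _ (fun x => - f 2 x / (2 * m ^+ 2)) _ 0).
- by rewrite sub0e -EFinN mulNr opprK /f; congr (expR _ / _)%:E; ring.
- by move=> x _; exact: expR_ge0.
- apply: continuous_subspaceT => x.
  by apply: continuous_comp; [exact: opp_continuous|exact: cf].
- rewrite (_ : (fun x => _) = fun x =>
      - (expR (- m ^+ 2 * (s + t)) / (2 * m ^+ 2)) * expR (- (2 * m ^+ 2 * x))); last first.
    apply/funext => x; rewrite /f (_ : - m ^+ 2 * (s + t + 2 * x) =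
      - m ^+ 2 * (s + t) + - (2 * m ^+ 2 * x)); last by ring.
    by rewrite expRD; ring.
  rewrite -(mulr0 (- (expR (- m ^+ 2 * (s + t)) / (2 * m ^+ 2)))).
  apply: cvgM; first exact: cvg_cst.
  rewrite (_ : (fun x => _) = (fun z => expR (- z)) \o (fun z => 2 * m ^+ 2 * z))//.
  apply: (@cvg_comp _ _ _ _ _ _ (pinfty_nbhs R)); last exact: cvgr_expR.
  exact: gt0_cvgMry.
- by move=> x _; exact: ex_derive.
- by apply/cvg_at_right_filter; exact: (is_derive_continuous dF).
- move=> x _; rewrite derive1E derive_val /f/=; congr (expR _); ring.
Qed.

Lemma OU_kernel_Lfun2 (t : R) : K t \in Lfun mu 2%:E.
Proof.
have mK := measurable_OU_kernel t.
rewrite inE; apply/andP; split; rewrite inE//= /finite_norm unlock.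
apply: poweR_lty.
rewrite (_ : (\int[mu]_x _)%E = (\int[mu]_u (K t u * K t u)%:E)%E).
  by rewrite integral_OU_kernel// ltry.
apply: eq_integral => u _; rewrite /= -expr2; congr EFin.
by rewrite ger0_norm ?OU_kernel_ge0// powR_mulrn// OU_kernel_ge0.
Qed.

End OU_kernel.

Lemma white_noise_innovation_cos d (T : measurableType d) (R : realType)
    (P : probability T R) (m : R) (xi : (R -> R) -> {RV P >-> R})
    (ou : R -> {RV P >-> R}) (t0 h : R) :
  0 < m -> 0 <= h -> white_noise xi ->
  (forall t, {ae P, forall w, ou t w = xi (fun s => OU_kernel m (t - s)) w}) ->
  let a := expR (- m ^+ 2 * h) in
  let v := (2 * m ^+ 2)^-1 in
  forall N (c : nat -> R) theta,
  \int[P]_w cos (\sum_(j < N)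
    c j * innovation (fun k => ou (t0 + k%:R * h) w) a j + theta) =
  cos theta * expR (- (\sum_(j < N) innovation_variance a v j * c j ^+ 2) / 2).
Proof.
move=> m_gt0 h0 [gxi cxi vxi] ouE a v N c theta.
pose O k w := xi (fun s => OU_kernel m (t0 + k%:R * h - s)) w.
pose O' k w := ou (t0 + k%:R * h) w.
have mO k : measurable_fun setT (O k) by exact: measurable_funPT.
have mO' k : measurable_fun setT (O' k) by exact: measurable_funPT.
have L2 (k : nat) := OU_kernel_Lfun2 m_gt0 (t0 + k%:R * h).
have EO k : (\int[P]_w (O k w)%:E = 0)%E by have := cxi _ (L2 k); rewrite unlock.
have EOO i k : (\int[P]_w (O i w * O (i + k)%N w)%:E = (v * a ^+ k)%:E)%E.
  have := vxi _ _ (L2 i) (L2 (i + k)%N); rewrite unlock => ->.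
  have le : t0 + i%:R * h <= t0 + (i + k)%:R * h.
    by rewrite lerD2l ler_wpM2r// ler_nat leq_addr.
  rewrite /Rintegral; have /= -> := integral_OU_kernel m_gt0 le.
  rewrite mulrC /v /a -expRM_natl natrD; congr (_ * expR _)%:E; ring.
have gO n (b : nat -> R) : gaussian_rv P (fun w => \sum_(k < n) b k * O k w).
  exact: (gxi n (fun k s => OU_kernel m (t0 + k%:R * h - s)) b).
have mS (Q : nat -> T -> R) : (forall k, measurable_fun setT (Q k)) ->
    measurable_fun setT (fun w => (cos (\sum_(j < N) c j * innovation (Q ^~ w) a j + theta))%:E).
  move=> mQ; apply/measurable_EFinP; rewrite (_ : (fun w => _) = fun w =>
    cos (1 * (\sum_(j < N) c j * innovation (Q ^~ w) a j) + theta)); last first.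
    by apply/funext => w; rewrite mul1r.
  apply: measurable_cos_comp; apply: measurable_sum => j.
  by apply: measurable_funM => //; exact: measurable_innovation.
rewrite -(innovation_cos mO EO EOO gO) /Rintegral; congr fine.
apply: ae_eq_integral => //; [exact: mS|exact: mS|].
(* Only countably many grid times occur, so the continuous modification agrees with the noise at all
   of them off a single null set. *)
have := ae_foralln (fun k => ouE (t0 + k%:R * h)).
apply: filterS => w OO' _; congr (cos (_ + _))%:E; apply: eq_bigr => j _.
by case: (j : nat) => [|k]; rewrite /innovation !OO'.
Qed.

(** * Pathwise convergence of the Euler scheme *)

Lemma mean_value (R : realType) (g g' : R -> R) :
  (forall x : R, is_derive x 1 g (g' x)) -> forall x y, exists c,
  [/\ `|c - x| <= `|y - x|, `|c - y| <= `|y - x| & g y - g x = g' c * (y - x)].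
Proof.
move=> dg x y; have cg := is_derive_continuous dg.
case: (leP x y) => xy.
  have [|c] := @MVT_segment R g g' x y xy (fun t _ => dg t).
    exact: continuous_subspaceT.
  rewrite in_itv/= => /andP[xc cy] E; exists c; split => //.
    by rewrite !ger0_norm ?subr_ge0//; lra.
  by rewrite distrC !ger0_norm ?subr_ge0//; lra.
have [|c] := @MVT_segment R g g' y x (ltW xy) (fun t _ => dg t).
  exact: continuous_subspaceT.
rewrite in_itv/= => /andP[yc cx] E; exists c; split.
- by rewrite distrC (distrC y) !ger0_norm ?subr_ge0//; lra.
- by rewrite (distrC y) !ger0_norm ?subr_ge0//; lra.
- by rewrite -opprB E; ring.
Qed.

(** Three nested mean value theorems, applied to the remainder as a function of the right endpoint.
    The optimal constant [M / 6] is not sought. *)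
Lemma trapezoid_rule (R : realType) (V v v' v'' : R -> R) (M : R) :
  (forall x : R, is_derive x 1 V (v x)) -> (forall x : R, is_derive x 1 v (v' x)) ->
  (forall x : R, is_derive x 1 v' (v'' x)) -> (forall x, `|v'' x| <= M) ->
  forall x y, `|2 * (V y - V x) - (v x + v y) * (y - x)| <= M * `|y - x| ^+ 3.
Proof.
move=> dV dv dv' vM x y.
pose g t := 2 * (V t - V x) - (v x + v t) * (t - x).
pose g' t := v t - v x - v' t * (t - x).
have dg (t : R) : is_derive t 1 g (g' t).
  apply: is_derive_eq; rewrite /GRing.scale/= /g'; ring.
have [c [cx cy E]] := mean_value dg x y.
have [e [ex ec Ee]] := mean_value dv x c.
have [u [ue uc Eu]] := mean_value dv' c e.
have -> : 2 * (V y - V x) - (v x + v y) * (y - x) = g y - g x by rewrite /g; ring.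
have -> : g y - g x = v'' u * (e - c) * (c - x) * (y - x).
  by rewrite E /g' Ee -Eu; ring.
rewrite !normrM -[leRHS]mulr1 exprS expr2.
rewrite mulr1 !mulrA; apply: ler_pM => //; apply: ler_pM => //; apply: ler_pM => //.
exact: le_trans ec cx.
Qed.

Lemma itv_uniform_continuity (R : realType) (g : R -> R) (a b : R) : continuous g ->
  forall e, 0 < e -> \forall d \near (0:R)^'+, forall x y, a <= x <= b ->
    `|x - y| < d -> `|g x - g y| < e.
Proof.
move=> cg e e0.
have := @segment_compact R a b; rewrite compact_near_coveringP.
move=> /(_ R (0^'+) (fun d x => forall y, `|x - y| < d -> `|g x - g y| < e)) cov.
have {cov} : \forall d \near (0:R)^'+, `[a, b]%classic `<=`
    (fun x => forall y, `|x - y| < d -> `|g x - g y| < e).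
  apply: cov => x0 _.
  have e2 : 0 < e / 2 by rewrite divr_gt0.
  have /cvgrPdist_lt/(_ _ e2) := cg x0.
  move=> /nbhs_ballP[eta /= eta0 h].
  have eta2 : 0 < eta / 2 by rewrite divr_gt0.
  exists (ball x0 (eta / 2), [set d : R | d < eta / 2]).
    split; first exact: nbhsx_ballx.
    exact: nbhs_right_lt.
  move=> [x d] [/= xx0 dlt] y xy.
  have h1 : `|g x0 - g x| < e / 2.
    by apply: h; move: xx0; rewrite /ball/= => /lt_trans; apply; lra.
  have h2 : `|g x0 - g y| < e / 2.
    apply: h; rewrite /ball/=; move: xx0; rewrite /ball/= => xx0.
    rewrite (_ : x0 - y = (x0 - x) + (x - y)); last by ring.
    rewrite (le_lt_trans (ler_normD _ _))//; lra.
  rewrite (_ : g x - g y = (g x0 - g y) - (g x0 - g x)); last by ring.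
  by rewrite (le_lt_trans (ler_normB _ _))//; lra.
apply: filterS => d h x y xab xy.
by apply: h xy; rewrite /= in_itv/=.
Qed.

Section integral_increments.
Context (R : realType) (g : R -> R).
Hypothesis cg : continuous g.
Local Notation mu := (@lebesgue_measure R).

Let integrable_itv (a b : R) : mu.-integrable `[a, b] (EFin \o g).
Proof.
apply: continuous_compact_integrable; first exact: segment_compact.
exact: continuous_subspaceT.
Qed.

Lemma integral_mean_value (a x y : R) : a <= x -> x <= y ->
  exists2 c, x <= c <= y &
    \int[mu]_(t in `[a, y]) g t - \int[mu]_(t in `[a, x]) g t = (y - x) * g c.
Proof.
move=> ax xy.
pose F z := \int[mu]_(t in `[a, z]) g t.
have ay := le_trans ax xy.
have [z||c] := @MVT_segment R F g x y xy.
- rewrite in_itv/= => /andP[xz zy].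
  have az := le_lt_trans ax xz.
  have cgz : {for z, continuous g} by exact: cg.
  have [d e] := continuous_FTC1_closed zy (integrable_itv a y) az cgz.
  by split; [exact: d|rewrite -derive1E e].
- apply: (@continuous_subspaceW _ _ _ `[a, y]).
    by apply: subset_itvr; rewrite bnd_simp.
  exact: (parameterized_integral_continuous ay (integrable_itv a y)).
rewrite in_itv/= => cxy E; exists c => //; by rewrite mulrC.
Qed.

End integral_increments.

Lemma discrete_gronwall (R : realType) (e : nat -> R) (E eta : R) (n : nat) :
  1 <= E -> 0 <= eta -> e 0%N = 0 ->
  (forall k, (k < n)%N -> e k.+1 <= E * e k + eta) ->
  forall k, (k <= n)%N -> e k <= k%:R * eta * E ^+ k.
Proof.
move=> E1 eta0 e0 eS; elim=> [|k IH] kn; first by rewrite e0 !mul0r.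
have E0 : 0 <= E by exact: le_trans E1.
apply: (le_trans (eS k kn)).
have h1 := ler_wpM2l E0 (IH (ltnW kn)).
have h2 : eta <= eta * E ^+ k.+1 by rewrite ler_peMr// exprn_ege1.
rewrite -natr1 !mulrDl mul1r; apply: lerD => //.
by rewrite (le_trans h1)// exprS le_eqVlt; apply/orP; left; apply/eqP; ring.
Qed.

Lemma onem_expRN_bounds (R : realType) (x : R) : 0 <= x ->
  x - x ^+ 2 <= 1 - expR (- x) <= x.
Proof.
move=> x0; have h1 := expR_ge1Dx (- x); have h2 := expR_ge1Dx x.
apply/andP; split; last by lra.
have h3 : expR x * expR (- x) = 1 by rewrite -expRD subrr expR0.
have h4 : (1 + x) * expR (- x) <= expR x * expR (- x) by rewrite ler_wpM2r ?expR_ge0.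
have h5 := ler_wpM2l x0 h1.
rewrite h3 in h4; rewrite expr2; lra.
Qed.

(* Step 0 only installs the initial value, so the state at the [k]-th grid point
   is [chain _ _ k.+1]; [(1 - a ^+ 2) / (2 * m ^+ 2)] is the exact variance of
   the innovations, which is the time step to leading order. *)
Definition euler_drift (R : realType) (m h : R) (p : nat -> R) (v : R -> R)
    (k : nat) (x : R) : R :=
  let a := expR (- m ^+ 2 * h) in
  if k is k'.+1 then a * x - (1 - a ^+ 2) / (2 * m ^+ 2) * (p k' * v x) else 0.

Definition euler_weight (R : realType) (p : nat -> R) (V : R -> R)
    (k : nat) (y : R) : R :=
  if k is k'.+1 then expR (- 2 * (p k'.+1 - p k') * V y) else 1.

Section pathwise.
Context (R : realType) (m tau M : R) (f f' V v v' o phi : R -> R).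
Hypothesis m_gt0 : 0 < m.
Hypothesis tau_gt0 : 0 < tau.
Hypothesis df : forall x : R, is_derive x 1 f (f' x).
Hypothesis cf' : continuous f'.
Hypothesis f0 : forall t, t <= - tau -> f t = 0.
Hypothesis f'0 : forall t, t < - tau -> f' t = 0.
Hypothesis fM : forall t, t <= 0 -> `|f t| <= M.
Hypothesis f'M : forall t, t <= 0 -> `|f' t| <= M.
Hypothesis dV : forall x : R, is_derive x 1 V (v x).
Hypothesis dv : forall x : R, is_derive x 1 v (v' x).
Hypothesis VM : forall x, `|V x| <= M.
Hypothesis vM : forall x, `|v x| <= M.
Hypothesis v'M : forall x, `|v' x| <= M.
Hypothesis cphi : continuous phi.
Hypothesis sol : forall t : R,
  phi t + convolution (OU_kernel m) (fun s => f s * v (phi s)) t = o t.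
Local Notation mu := (@lebesgue_measure R).

Let M0 : 0 <= M. Proof. exact: le_trans (VM 0). Qed.
Let b s := f s * v (phi s).

Let cV : continuous V. Proof. exact: is_derive_continuous dV. Qed.
Let cv : continuous v. Proof. exact: is_derive_continuous dv. Qed.

Let cb : continuous b.
Proof.
move=> x; apply: cvgM; first exact: (is_derive_continuous df).
by apply: continuous_comp; [exact: cphi|exact: cv].
Qed.

Let beta s := expR (m ^+ 2 * s) * b s.

Let cbeta : continuous beta.
Proof.
move=> x; apply: cvgM; last exact: cb.
apply: continuous_comp; last exact: continuous_expR.
by apply: cvgM; [exact: cvg_cst|exact: cvg_id].
Qed.

Let integrable_itv g (a c : R) : continuous g -> mu.-integrable `[a, c] (EFin \o g).
Proof.
move=> cg; apply: continuous_compact_integrable; first exact: segment_compact.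
exact: continuous_subspaceT.
Qed.

(** [f] vanishes to the left of [- tau] and the kernel to the right of [t]. With
    [expR (- m ^+ 2 * t)] taken out, the integrand no longer depends on [t], and time increments
    become integrals over one step. *)
Let convolutionE t : convolution (OU_kernel m) b t =
  expR (- m ^+ 2 * t) * \int[mu]_(s in `[- tau, t]) beta s.
Proof.
rewrite -RintegralZl//; last exact: integrable_itv.
rewrite -Rintegral_itv_bndo_bndc; last first.
  have intf : mu.-integrable `[- tau, t] (EFin \o (fun x => expR (- m ^+ 2 * t) * beta x)).
    by apply: integrable_itv => x; apply: cvgM; [exact: cvg_cst|exact: cbeta].
  by apply: integrableS intf => //; apply: subset_itvl; rewrite bnd_simp.
rewrite /convolution [in RHS]Rintegral_mkcond; apply: eq_Rintegral => s _.
rewrite patchE mem_setE in_itv/= /OU_kernel subr_gt0.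
case: (leP (- tau) s) => ts /=; last by rewrite /b f0 ?ltW// !(mul0r, mulr0).
case: ifPn => st; last by rewrite mul0r.
by rewrite /beta mulrA -expRD; congr (expR _ * _); ring.
Qed.

Lemma mild_solution_start : phi (- tau) = o (- tau).
Proof.
by rewrite -sol -/b convolutionE set_itv1 Rintegral_set1 mulr0 addr0.
Qed.

(** Variation of constants over one step. The noise enters through the same innovation of [o] as in
    the Euler scheme, so it cancels when the two are compared. *)
Lemma mild_solution_step t h : - tau <= t -> 0 <= h ->
  exists2 c, t <= c <= t + h &
  phi (t + h) = expR (- m ^+ 2 * h) * phi t + (o (t + h) - expR (- m ^+ 2 * h) * o t)
    - h * expR (- m ^+ 2 * (t + h - c)) * b c.
Proof.
move=> tt h0; have tth : t <= t + h by rewrite lerDl.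
have [c cth E] := integral_mean_value cbeta tt tth.
exists c => //; rewrite -(sol (t + h)) -(sol t) -/b !convolutionE.
move/eqP : E; rewrite subr_eq => /eqP ->.
rewrite /beta.
have e1 : expR (- m ^+ 2 * (t + h)) = expR (- m ^+ 2 * h) * expR (- m ^+ 2 * t).
  by rewrite -expRD; congr expR; ring.
have e2 : expR (- m ^+ 2 * (t + h - c)) =
    expR (- m ^+ 2 * (t + h)) * expR (m ^+ 2 * c).
  by rewrite -expRD; congr expR; ring.
by rewrite e2 e1; ring.
Qed.

Section discretisation.
Variables (h : R) (n : nat).
Hypothesis h_gt0 : 0 < h.
Hypothesis nh : n%:R * h = tau.

Let t (k : nat) : R := - tau + k%:R * h.
Let a := expR (- m ^+ 2 * h).
Let p (k : nat) := f (t k).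
Let y := innovation (fun k => o (t k)) a.
Let X k := chain (euler_drift m h p v) y k.
Let H k := chain_weight (euler_drift m h p v) (euler_weight p V) y k.

Let tS k : t k.+1 = t k + h.
Proof. by rewrite /t -natr1; ring. Qed.

Let t_ge k : - tau <= t k.
Proof. by rewrite /t lerDl mulr_ge0// ltW. Qed.

Let t_le k : (k <= n)%N -> t k <= 0.
Proof. by move=> kn; rewrite /t addrC subr_le0 -nh ler_wpM2r ?ler_nat// ltW. Qed.

(** [M ^+ 2] is a Lipschitz constant of the drift and gives the Gronwall factor. The second
    condition on [eta] collects the replacement of the innovation variance by [h], counted twice,
    and of the kernel by 1, counted once; with the modulus of continuity of [b] the error per step
    is [2 * h * eta]. *)
Lemma chain_error (eta : R) :
  (forall x z, - tau <= x <= 0 -> `|x - z| <= h -> `|b x - b z| <= eta) ->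
  3 * m ^+ 2 * M ^+ 2 * h <= eta ->
  forall k, (k <= n)%N ->
  `|X k.+1 - phi (t k)| <= 2 * tau * eta * expR (tau * M ^+ 2).
Proof.
move=> b_unif heta k kn.
have h0 := ltW h_gt0; have m0 := ltW m_gt0.
have eta0 : 0 <= eta by apply: le_trans heta; rewrite !mulr_ge0 ?sqr_ge0.
pose e j := `|X j.+1 - phi (t j)|.
have E1 : 1 <= expR (h * M ^+ 2) by rewrite -expR0 ler_expR mulr_ge0 ?sqr_ge0.
have e0 : e 0%N = 0.
  rewrite /e /X /= /y /t mul0r addr0 add0r mild_solution_start subrr normr0//.
have eS j : (j < n)%N -> e j.+1 <= expR (h * M ^+ 2) * e j + h * (2 * eta).
  move=> jn.
  have [c /andP[tc ct] E] := mild_solution_step (t_ge j) h0.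
  have c0 : c <= 0 by rewrite (le_trans ct)// -tS t_le.
  have XE : X j.+2 = a * X j.+1 - (1 - a ^+ 2) / (2 * m ^+ 2) * (p j * v (X j.+1)) +
     (o (t j.+1) - a * o (t j)) by [].
  pose s2 := (1 - a ^+ 2) / (2 * m ^+ 2).
  pose theta := expR (- m ^+ 2 * (t j + h - c)).
  (* After cancellation of the innovation, the four corrections are: variance [s2] against step [h],
     dependence of the drift on the state, variation of [b] within the step, and kernel value
     [theta] against 1. *)
  have -> : e j.+1 = `|a * (X j.+1 - phi (t j)) - ((s2 - h) * (p j * v (X j.+1)) +
      h * (p j * (v (X j.+1) - v (phi (t j)))) + h * (b (t j) - b c) +
      h * ((1 - theta) * b c))|.
    rewrite /e XE tS E -/a -/s2 -/theta; congr `|_|; rewrite /b /p; ring.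
  have pM : `|p j| <= M by apply: fM; exact: t_le (ltnW jn).
  have bM : `|b c| <= M ^+ 2 by rewrite normrM expr2 ler_pM// fM.
  have x0 : 0 <= 2 * m ^+ 2 * h by rewrite !mulr_ge0 ?sqr_ge0.
  have /andP[s21 s22] := onem_expRN_bounds x0.
  have aE : a ^+ 2 = expR (- (2 * m ^+ 2 * h)).
    by rewrite /a -expRM_natl; congr expR; ring.
  have m2 : 0 < 2 * m ^+ 2 by rewrite mulr_gt0// exprn_gt0.
  have s2h : `|s2 - h| <= 2 * m ^+ 2 * h ^+ 2.
    rewrite (_ : s2 - h = (1 - a ^+ 2 - 2 * m ^+ 2 * h) / (2 * m ^+ 2)); last first.
      by rewrite /s2; field; rewrite gt_eqF.
    rewrite normrM (@gtr0_norm _ (_^-1)) ?invr_gt0// ler_pdivrMr// aE ler_norml.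
    rewrite (_ : 2 * m ^+ 2 * h ^+ 2 * _ = (2 * m ^+ 2 * h) ^+ 2); last by ring.
    have := sqr_ge0 (2 * m ^+ 2 * h); move: s21 s22; rewrite !expr2 => *.
    by apply/andP; split; lra.
  have th : `|1 - theta| <= m ^+ 2 * h.
    have y0 : 0 <= m ^+ 2 * (t j + h - c).
      by rewrite mulr_ge0 ?sqr_ge0// subr_ge0.
    have /andP[th1 th2] := onem_expRN_bounds y0.
    rewrite /theta mulNr ger0_norm; last first.
      by rewrite subr_ge0 -expR0 ler_expR oppr_le0.
    rewrite (le_trans th2)// ler_wpM2l ?sqr_ge0//; lra.
  have vL : `|v (X j.+1) - v (phi (t j))| <= M * e j.
    have [z [_ _ ->]] := mean_value dv (phi (t j)) (X j.+1).
    by rewrite normrM ler_wpM2r.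
  have b1 : `|(s2 - h) * (p j * v (X j.+1))| <= 2 * m ^+ 2 * h ^+ 2 * M ^+ 2.
    by rewrite normrM ler_pM// normrM expr2 ler_pM.
  have b2 : `|h * (p j * (v (X j.+1) - v (phi (t j))))| <= h * (M * (M * e j)).
    by rewrite normrM gtr0_norm// ler_wpM2l// normrM ler_pM.
  have b3 : `|h * (b (t j) - b c)| <= h * eta.
    rewrite normrM gtr0_norm// ler_wpM2l// b_unif ?t_ge ?t_le ?(ltnW jn)//.
    by rewrite distrC ger0_norm ?subr_ge0//; lra.
  have b4 : `|h * ((1 - theta) * b c)| <= h * (m ^+ 2 * h * M ^+ 2).
    by rewrite normrM gtr0_norm// ler_wpM2l// normrM ler_pM.
  have b5 : `|a * (X j.+1 - phi (t j))| <= e j.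
    rewrite normrM ler_piMl// ger0_norm ?expR_ge0// -expR0 ler_expR.
    by rewrite mulNr oppr_le0 mulr_ge0 ?sqr_ge0.
  rewrite (le_trans (ler_normB _ _))//.
  have b6 := le_trans (ler_normD _ _) (lerD (le_trans (ler_normD _ _)
     (lerD (le_trans (ler_normD _ _) (lerD b1 b2)) b3)) b4).
  apply: (le_trans (lerD b5 b6)).
  have g1 : (1 + h * M ^+ 2) * e j <= expR (h * M ^+ 2) * e j.
    by rewrite ler_wpM2r ?expR_ge1Dx//; exact: normr_ge0.
  have g2 : h * (3 * m ^+ 2 * M ^+ 2 * h) <= h * eta by rewrite ler_wpM2l.
  apply: le_trans (lerD g1 (lexx _)).
  rewrite (_ : h * (2 * eta) = h * eta + h * eta); last by ring.
  move: g2; move: (e j) => ej; rewrite !expr2 => g2; lra.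
have := discrete_gronwall E1 (mulr_ge0 h0 (mulr_ge0 (ler0n _ 2) eta0)) e0 eS kn.
move=> /le_trans; apply.
rewrite -expRM_natl.
have kh : k%:R * h <= tau by rewrite -nh ler_wpM2r// ler_nat.
rewrite (_ : 2 * tau * eta = tau * (2 * eta)); last by ring.
apply: ler_pM; rewrite ?expR_ge0// ?mulr_ge0//.
  by rewrite [leLHS]mulrA ler_wpM2r// mulr_ge0.
by rewrite ler_expR [leLHS]mulrA ler_wpM2r ?sqr_ge0.
Qed.

Let g s := f' s * V (phi s).

Let cVphi : continuous (V \o phi).
Proof. by move=> x; apply: continuous_comp; [exact: cphi|exact: cV]. Qed.

Let cg : continuous g.
Proof. by move=> x; apply: cvgM; [exact: cf'|exact: cVphi]. Qed.

Let integral_g : \int[mu]_(s in `]-oo, 0%R]) g s = \int[mu]_(s in `[- tau, t n]) g s.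
Proof.
have -> : t n = 0 by rewrite /t nh addNr.
rewrite Rintegral_mkcond [RHS]Rintegral_mkcond; apply: eq_Rintegral => s _.
rewrite !patchE !mem_setE !in_itv/=; case: (leP (- tau) s) => //= st.
by rewrite /g f'0// mul0r; case: ifP.
Qed.

(** [L] is a Riemann sum. Per unit of time, replacing the chain by [phi] costs [M ^+ 2 * eps],
    moving [phi] to the mean value point of the integral costs [M * eps], and moving [f'] there,
    through the right grid point, costs [2 * M * eps]. *)
Lemma chain_weight_error (eps : R) :
  (forall x z, - tau <= x <= 0 -> `|x - z| <= h -> `|V (phi x) - V (phi z)| <= eps) ->
  (forall x z, - tau <= x <= 0 -> `|x - z| <= h -> `|f' x - f' z| <= eps) ->
  (forall k, (k <= n)%N -> `|X k.+1 - phi (t k)| <= eps) ->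
  exists2 L, H n.+1 = expR (- 2 * L) &
    `|L - \int[mu]_(s in `]-oo, 0%R]) (f' s * V (phi s))| <=
      tau * ((M ^+ 2 + 3 * M) * eps).
Proof.
move=> V_unif f'_unif Xphi.
have h0 := ltW h_gt0.
pose L k := \sum_(j < k) (p j.+1 - p j) * V (X j.+2).
have HL k : H k.+1 = expR (- 2 * L k).
  elim: k => [|k IH]; first by rewrite /L big_ord0 mulr0 expR0 /H /= mulr1.
  rewrite (_ : H k.+2 = H k.+1 * expR (- 2 * (p k.+1 - p k) * V (X k.+2)))//.
  by rewrite IH -expRD /L big_ord_recr/=; congr expR; ring.
exists (L n) => //; rewrite integral_g.
pose A k := \int[mu]_(s in `[- tau, t k]) g s.
pose kappa := h * ((M ^+ 2 + 3 * M) * eps).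
have eps0 : 0 <= eps by apply: le_trans (Xphi 0%N _).
have kappa0 : 0 <= kappa by rewrite /kappa !mulr_ge0// addr_ge0// ?sqr_ge0// mulr_ge0.
suff : forall k, (k <= n)%N -> `|L k - A k| <= k%:R * kappa.
  by move=> /(_ n (leqnn n)) /le_trans; apply; rewrite /kappa mulrA nh.
elim=> [|k IH] kn.
  by rewrite /L big_ord0 /A /t mul0r addr0 set_itv1 Rintegral_set1 subrr normr0 mul0r.
have tk : t k <= t k.+1 by rewrite tS lerDl.
have [z /andP[zt tz] Ez] := integral_mean_value cg (t_ge k) tk.
have [x [xt tx Ex]] := mean_value df (t k) (t k.+1).
have dt : t k.+1 - t k = h by rewrite tS; ring.
rewrite dt in Ez Ex xt tx; rewrite (gtr0_norm h_gt0) in xt tx.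
have tk0 : t k.+1 <= 0 by exact: t_le.
have x0 : x <= 0 by move: xt tx; rewrite !ler_norml => /andP[? ?] /andP[? ?]; lra.
have z0 : z <= 0 by lra.
have itk : - tau <= t k.+1 <= 0 by rewrite t_ge.
have d1 : `|V (X k.+2) - V (phi (t k.+1))| <= M * eps.
  have [u [_ _ ->]] := mean_value dV (phi (t k.+1)) (X k.+2).
  by rewrite normrM ler_pM// Xphi.
have d2 : `|V (phi (t k.+1)) - V (phi z)| <= eps.
  by apply: V_unif => //; rewrite ger0_norm ?subr_ge0//; lra.
have d3 : `|f' x - f' z| <= 2 * eps.
  rewrite (_ : f' x - f' z = - (f' (t k.+1) - f' x) + (f' (t k.+1) - f' z)); last by ring.
  rewrite (le_trans (ler_normD _ _))// normrN mulrDl mul1r lerD//.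
    by apply: f'_unif => //; rewrite distrC.
  by apply: f'_unif => //; rewrite ger0_norm ?subr_ge0//; lra.
have -> : L k.+1 - A k.+1 = (L k - A k) + h * (f' x * (V (X k.+2) - V (phi (t k.+1))) +
    f' x * (V (phi (t k.+1)) - V (phi z)) + (f' x - f' z) * V (phi z)).
  have -> : A k.+1 = A k + h * g z by rewrite -Ez /A; ring.
  by rewrite /L big_ord_recr/= -/(L k) /p Ex /g; ring.
rewrite (le_trans (ler_normD _ _))//.
rewrite (_ : k.+1%:R * kappa = k%:R * kappa + kappa); last by rewrite -natr1; ring.
apply: lerD; first by apply: IH; exact: ltnW.
rewrite normrM gtr0_norm// /kappa ler_wpM2l//.
rewrite (le_trans (ler_normD _ _))//.
have b1 : `|f' x * (V (X k.+2) - V (phi (t k.+1)))| <= M * (M * eps).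
  by rewrite normrM ler_pM// f'M.
have b2 : `|f' x * (V (phi (t k.+1)) - V (phi z))| <= M * eps.
  by rewrite normrM ler_pM// f'M.
have b3 : `|(f' x - f' z) * V (phi z)| <= 2 * eps * M.
  by rewrite normrM ler_pM.
have := ler_normD (f' x * (V (X k.+2) - V (phi (t k.+1)))) (f' x * (V (phi (t k.+1)) - V (phi z))).
rewrite expr2; lra.
Qed.

End discretisation.

Let h (N : nat) := tau / N.+1%:R.
Let t (N k : nat) := - tau + k%:R * h N.
Let y N := innovation (fun k => o (t N k)) (expR (- m ^+ 2 * h N)).
Let D N := euler_drift m (h N) (fun k => f (t N k)) v.
Let w N := euler_weight (fun k => f (t N k)) V.

Let h_gt0 N : 0 < h N. Proof. by rewrite divr_gt0. Qed.

Let nh N : N.+1%:R * h N = tau.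
Proof. by rewrite /h mulrC divfK. Qed.

Let h_cvg0 : h N @[N --> \oo] --> (0 : R).
Proof.
by rewrite -(mulr0 tau); apply: cvgM; [exact: cvg_cst|exact: cvg_harmonic].
Qed.

(** The factor 2 turns the strict condition [|x - y| < d] of uniform continuity into the closed one
    [|x - z| <= h N]. *)
Let near_h (Q : R -> Prop) : (\forall d \near (0:R)^'+, Q d) ->
  \forall N \near \oo, Q (2 * h N).
Proof.
have h2 : 2 * h N @[N --> \oo] --> (0 : R).
  by rewrite -(mulr0 2); apply: cvgM; [exact: cvg_cst|exact: h_cvg0].
move=> Qd; have {}Qd : \forall N \near \oo, 0 < 2 * h N -> Q (2 * h N) by exact: (h2 _ Qd).
by apply: filterS Qd => N; apply; rewrite mulr_gt0.
Qed.

Let near_unif (q : R -> R) (eps : R) : continuous q -> 0 < eps ->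
  \forall N \near \oo, forall x z, - tau <= x <= 0 -> `|x - z| <= h N ->
    `|q x - q z| <= eps.
Proof.
move=> cq eps0; have := near_h (itv_uniform_continuity (- tau) 0 cq eps0).
apply: filterS => N u x z x0 xz; apply: ltW; apply: u => //.
by apply: le_lt_trans xz _; rewrite ltr_pMl// ltr1n.
Qed.

Let chain_near (eps : R) : 0 < eps -> \forall N \near \oo,
  forall k, (k <= N.+1)%N -> `|chain (D N) (y N) k.+1 - phi (t N k)| <= eps.
Proof.
move=> eps0; pose C := 2 * tau * expR (tau * M ^+ 2).
have C0 : 0 < C by rewrite !mulr_gt0 ?expR_gt0.
have eta0 : 0 < eps / C by rewrite divr_gt0.
have u1 := near_unif cb eta0.
have u2 : \forall N \near \oo, 3 * m ^+ 2 * M ^+ 2 * h N <= eps / C.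
  have c0 : 3 * m ^+ 2 * M ^+ 2 * h N @[N --> \oo] --> (0 : R).
    by rewrite -(mulr0 (3 * m ^+ 2 * M ^+ 2)); apply: cvgM; [exact: cvg_cst|exact: h_cvg0].
  move/cvgr0_norm_le : c0 => /(_ _ eta0); apply: filterS => N.
  exact: le_trans (ler_norm _).
near=> N => k kN.
rewrite (le_trans (chain_error (h_gt0 N) (nh N) (eta := eps / C) _ _ kN))//.
- by near: N.
- by near: N.
- rewrite le_eqVlt; apply/orP; left; apply/eqP; rewrite /C; field.
  by rewrite !gt_eqF ?expR_gt0.
Unshelve. all: by end_near. Qed.

Lemma chain_cvg : chain (D N) (y N) N.+2 @[N --> \oo] --> phi 0.
Proof.
apply/cvgrPdist_le => eps eps0; have := chain_near eps0; apply: filterS => N.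
move=> /(_ N.+1 (leqnn _)); rewrite distrC (_ : t N N.+1 = 0)//.
by rewrite /t nh addNr.
Qed.

Lemma chain_weight_cvg : chain_weight (D N) (w N) (y N) N.+2 @[N --> \oo] -->
  expR (- 2 * \int[mu]_(s in `]-oo, 0%R]) (f' s * V (phi s))).
Proof.
set A := \int[mu]_(s in _) _.
(* The exponent is recovered by a logarithm so as to be defined for every [N]; [chain_weight_error]
   supplies it only for large [N]. *)
pose L N := - ln (chain_weight (D N) (w N) (y N) N.+2) / 2.
have HL N : chain_weight (D N) (w N) (y N) N.+2 = expR (- 2 * L N).
  have : 0 < chain_weight (D N) (w N) (y N) N.+2.
    elim: N.+2 => //= k IH; rewrite mulr_gt0//.
    by case: k {IH} => //= k; exact: expR_gt0.
  move=> H0; rewrite /L (_ : - 2 * _ = ln (chain_weight (D N) (w N) (y N) N.+2)).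
    by rewrite lnK.
  by field.
under eq_fun do rewrite HL.
suff LA : L N @[N --> \oo] --> A.
  apply: (@cvg_comp _ _ _ _ expR _ (nbhs (- 2 * A))).
    by apply: cvgM => //; exact: cvg_cst.
  exact: continuous_expR.
apply/cvgrPdist_le => eps eps0.
pose C := tau * (M ^+ 2 + 3 * M + 1).
have C0 : 0 < C.
  by rewrite mulr_gt0// ltr_wpDl// addr_ge0// ?sqr_ge0// mulr_ge0.
have eta0 : 0 < eps / C by rewrite divr_gt0.
have u1 := chain_near eta0.
have cVphi : continuous (V \o phi).
  by move=> x; apply: continuous_comp; [exact: cphi|exact: cV].
have u2 := near_unif cVphi eta0.
have u3 := near_unif cf' eta0.
near=> N.
have [|||L' HL' LA] := @chain_weight_error (h N) N.+1 (h_gt0 N) (nh N) (eps / C).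
- by near: N.
- by near: N.
- by near: N.
have -> : L N = L'.
  by rewrite /L HL' expRK; field.
rewrite distrC (le_trans LA)//.
apply: (@le_trans _ _ (C * (eps / C))).
  rewrite /C -mulrA ler_wpM2l ?(ltW tau_gt0)// ler_wpM2r ?(ltW eta0)//.
  by rewrite lerDl.
by rewrite mulrC divfK// gt_eqF.
Unshelve. all: by end_near. Qed.

End pathwise.

(** * Propagation of the one-step error *)

Lemma measurable_euler_drift (R : realType) (m h : R) (p : nat -> R) (v : R -> R)
    (k : nat) : measurable_fun setT v ->
  measurable_fun setT (euler_drift m h p v k).
Proof.
move=> mv; case: k => [|k]; first exact: measurable_cst.
apply: measurable_funB; first exact: measurable_funM.
by apply: measurable_funM => //; exact: measurable_funM.
Qed.

Lemma measurable_euler_weight (R : realType) (p : nat -> R) (V : R -> R)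
    (k : nat) : measurable_fun setT V ->
  measurable_fun setT (euler_weight p V k).
Proof.
move=> mV; case: k => [|k]; first exact: measurable_cst.
by apply: measurableT_comp => //; exact: measurable_funM.
Qed.

(** Each weight is at most 1 up to order [h], so that products over about [tau / h] steps stay
    bounded. *)
Lemma euler_weight_bound (R : realType) (h M : R) (p : nat -> R) (V : R -> R)
    (k : nat) (x : R) : 0 <= h ->
  (forall j, `|p j.+1 - p j| <= M * h) -> (forall y, `|V y| <= M) ->
  0 <= euler_weight p V k x <= expR (2 * M ^+ 2 * h).
Proof.
move=> h0 dpM VM; case: k => [|k] /=.
  rewrite ler01/=; apply: le_trans (expR_ge1Dx _).
  by rewrite lerDl; apply: mulr_ge0 => //; rewrite mulr_ge0 ?sqr_ge0.
rewrite expR_ge0 ler_expR.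
have : `|(p k.+1 - p k) * V x| <= M * h * M by rewrite normrM ler_pM.
by rewrite ler_norml => /andP[? ?]; rewrite expr2; lra.
Qed.

Section euler_chain.
Context d (T : measurableType d) (R : realType) (P : probability T R).
Variables (m h M G : R) (p : nat -> R) (V v : R -> R) (Y : nat -> T -> R).
Hypothesis m_gt0 : 0 < m.
Hypothesis h01 : 0 < h <= 1.
Hypothesis p0 : p 0%N = 0.
Hypothesis pM : forall k, `|p k| <= M.
Hypothesis dpM : forall k, `|p k.+1 - p k| <= M * h.
Hypothesis VM : forall x, `|V x| <= M.
Hypothesis vM : forall x, `|v x| <= M.
Hypothesis vL : forall x y, `|v y - v x| <= M * `|y - x|.
Hypothesis trapezoid : forall x y,
  `|2 * (V y - V x) - (v x + v y) * (y - x)| <= M * `|y - x| ^+ 3.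
Hypothesis mV : measurable_fun setT V.
Hypothesis mv : measurable_fun setT v.
Hypothesis GE : (\int[@lebesgue_measure R]_x
  (expR `|x| * expR (- m ^+ 2 * x ^+ 2))%:E <= G%:E)%E.

Local Notation mu := (@lebesgue_measure R).
Local Notation rT := (measurableTypeR R).
Let a := expR (- m ^+ 2 * h).
Let s k := Num.sqrt (innovation_variance a (2 * m ^+ 2)^-1 k).

Hypothesis mY : forall k, measurable_fun setT (Y k).
Hypothesis cosY : forall N (c : nat -> R) theta,
  \int[P]_t cos (\sum_(j < N) c j * Y j t + theta) =
  cos theta *
  expR (- (\sum_(j < N) innovation_variance a (2 * m ^+ 2)^-1 j * c j ^+ 2) / 2).

Let D := euler_drift m h p v.
Let w := euler_weight p V.
Let X k := fun t => chain D (Y ^~ t) k.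
Let H k := fun t => chain_weight D w (Y ^~ t) k.
Let W := expR (2 * M ^+ 2 * h).
Let r := Num.sqrt h.
Let c0 := normal_peak (s 0).
Let rho k (x : R) := expR (- m ^+ 2 * x ^+ 2 - 2 * p k * V x).

Let h0 : 0 < h. Proof. by case/andP: h01. Qed.
Let M0 : 0 <= M. Proof. exact: le_trans (VM 0). Qed.
Let m0 : 0 <= m. Proof. exact: ltW. Qed.
Let W1 : 1 <= W.
Proof. by rewrite -expR0 ler_expR !mulr_ge0 ?sqr_ge0// ltW. Qed.
Let W0 : 0 <= W. Proof. exact: le_trans W1. Qed.

Let mh : 0 < m ^+ 2 * h. Proof. by rewrite mulr_gt0// exprn_gt0. Qed.

Let a01 : 0 < a < 1.
Proof. by rewrite expR_gt0 -[ltRHS]expR0 ltr_expR mulNr oppr_lt0. Qed.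

Let var_gt0 k : 0 < innovation_variance a (2 * m ^+ 2)^-1 k.
Proof.
have v0 : 0 < (2 * m ^+ 2)^-1 by rewrite invr_gt0 mulr_gt0// exprn_gt0.
have /andP[a0 a1] := a01.
by case: k => [//|k] /=; rewrite mulr_gt0// subr_gt0 expr_lt1// ltW.
Qed.

Let s_gt0 k : 0 < s k. Proof. by rewrite sqrtr_gt0. Qed.

Let s_neq0 k : s k != 0. Proof. by rewrite gt_eqF. Qed.

Let sqr_s k : s k ^+ 2 = innovation_variance a (2 * m ^+ 2)^-1 k.
Proof. by rewrite sqr_sqrtr// ltW. Qed.

Let sqr_r : r ^+ 2 = h. Proof. by rewrite sqr_sqrtr// ltW. Qed.

Let mD k : measurable_fun setT (D k). Proof. exact: measurable_euler_drift. Qed.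

Let mw k : measurable_fun setT (w k). Proof. exact: measurable_euler_weight. Qed.

Let w0W k x : 0 <= w k x <= W. Proof. by apply: euler_weight_bound => //; exact: ltW. Qed.

Let cosY' N (c : nat -> R) theta :
  \int[P]_t cos (\sum_(j < N) c j * Y j t + theta) =
  cos theta * expR (- (\sum_(j < N) s j ^+ 2 * c j ^+ 2) / 2).
Proof. by rewrite cosY; under [in RHS]eq_bigr do rewrite sqr_s. Qed.

Let mX k : measurable_fun setT (X k).
Proof. exact: measurable_chain. Qed.

Let mH k : measurable_fun setT (H k).
Proof. exact: measurable_chain_weight. Qed.

Let H0 k t : 0 <= H k t.
Proof. by have /andP[] := chain_weight_bound Y D w0W k t. Qed.

Let step k (psi : rT -> R) : measurable_fun setT psi -> (forall x, 0 <= psi x <= 1) ->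
  (\int[P]_t (psi (X k.+1 t) * H k.+1 t)%:E =
   \int[P]_t ((\int[normal_prob (D k (X k t)) (s k)]_y (psi y * w k y)%:E) * (H k t)%:E))%E.
Proof.
move=> mpsi psi01.
have := @chain_step _ T R P Y s D w W mY s_neq0 mD mw w0W cosY' k (EFin \o psi).
apply.
- by apply/measurable_EFinP.
- by move=> x; rewrite lee_fin; have /andP[] := psi01 x.
Qed.

(** Since [p 0 = 0], [rho 0] is the stationary Gaussian density without its normalisation, which is
    [c0]. *)
Let start (psi : rT -> R) : measurable_fun setT psi -> (forall x, 0 <= psi x <= 1) ->
  (\int[P]_t (psi (X 1 t) * H 1 t)%:E = c0%:E * \int[mu]_x (psi x * rho 0 x)%:E)%E.
Proof.
move=> mpsi psi01; rewrite step//.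
transitivity (\int[P]_t cst (\int[normal_prob 0 (s 0)]_y (psi y)%:E) t)%E.
  apply: eq_integral => t _; rewrite /H /= mule1.
  by apply: eq_integral => y _; rewrite mulr1.
rewrite integral_cst// [Z in (_ * Z)%E](_ : _ = 1%E) ?mule1; last exact: probability_setT.
rewrite integral_normal_prob; last exact/measurable_EFinP.
rewrite -ge0_integralZl//.
- apply: eq_integral => x _; rewrite -!EFinM; congr EFin.
  rewrite normal_pdf_expR// mulrCA; congr (_ * (_ * expR _)).
  rewrite p0 subr0 sqr_s/= mulr0 mul0r subr0; field; rewrite gt_eqF//.
- apply/measurable_EFinP; apply: measurable_funM => //; apply: measurableT_comp => //.
  by apply: measurable_funB; apply: measurable_funM => //; apply: measurable_funX.
- by move=> x _; rewrite lee_fin mulr_ge0 ?expR_ge0//; have /andP[] := psi01 x.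
- by rewrite lee_fin normal_peak_ge0.
Qed.

Let Q k (psi : rT -> R) (x : R) :=
  (\int[normal_prob (D k x) (s k)]_y (psi y * w k y)%:E)%E.

Let Q_bound k (psi : rT -> R) (x : R) : measurable_fun setT psi -> (forall x, 0 <= psi x <= 1) ->
  (0 <= Q k psi x <= W%:E)%E.
Proof.
move=> mpsi psi01.
have pw y : 0 <= psi y * w k y <= W.
  have /andP[p1 p2] := psi01 y; have /andP[w1 w2] := w0W k y.
  by rewrite mulr_ge0//= -[leRHS]mul1r ler_pM.
have pw0 y : 0 <= psi y * w k y by have /andP[] := pw y.
apply/andP; split; first by apply: integral_ge0 => y _; rewrite lee_fin.
apply: (@le_trans _ _ (\int[normal_prob (D k x) (s k)]_y cst W%:E y)%E).
  apply: ge0_le_integral => //.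
  - by move=> y _; rewrite lee_fin.
  - by apply/measurable_EFinP; exact: (measurable_funM mpsi (mw k)).
  - by move=> y _; rewrite lee_fin; have /andP[] := pw y.
rewrite integral_cst// [Z in (_ * Z)%E](_ : _ = 1%E) ?mule1//.
exact: probability_setT.
Qed.

Let measurable_Q k (psi : rT -> R) : measurable_fun setT psi -> (forall x, 0 <= psi x <= 1) ->
  measurable_fun setT (Q k psi : rT -> \bar R).
Proof.
move=> mpsi psi01.
pose F (z : rT * rT) := (psi z.2 * w k z.2 * normal_pdf (D k z.1) (s k) z.2)%:E.
have mF : measurable_fun setT F.
  apply/measurable_EFinP; apply: measurable_funM.
    exact: (measurableT_comp (measurable_funM mpsi (mw k)) measurable_snd).
  have mDz : measurable_fun setT (fun z : rT * rT => (D k z.1, z.2) : rT * rT).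
    apply: measurable_fun_pair; last exact: measurable_snd.
    exact: measurableT_comp (mD k) measurable_fst.
  exact: (measurableT_comp (measurable_normal_pdf2 (s_neq0 k)) mDz).
have F0 z : (0 <= F z)%E.
  rewrite lee_fin mulr_ge0 ?normal_pdf_ge0// mulr_ge0//.
    by have /andP[] := psi01 z.2.
  by have /andP[] := w0W k z.2.
have -> : Q k psi = fubini_F mu F.
  apply/funext => x; rewrite /Q integral_normal_prob//.
  by apply/measurable_EFinP; exact: (measurable_funM mpsi (mw k)).
exact: measurable_fun_fubini_tonelli_F F mF F0.
Qed.

Let C := one_step_constant m M G.
(** [k] one-step errors, each amplified by [W] at every later step because test functions are
    renormalised by [W]. *)
Let e k := k%:R * (c0 * (C * r ^+ 3)) * W ^+ k.
Let cC_ge0 : 0 <= c0 * (C * r ^+ 3).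
Proof.
have G0 : 0 <= G.
  rewrite -lee_fin; apply: le_trans GE; apply: integral_ge0 => x _.
  by rewrite lee_fin mulr_ge0 ?expR_ge0.
rewrite mulr_ge0 ?normal_peak_ge0// mulr_ge0 ?exprn_ge0 ?sqrtr_ge0//.
by rewrite /C /one_step_constant !(mulr_ge0, addr_ge0, exprn_ge0, expR_ge0).
Qed.

(** [lam] integrates against the weighted law of the chain at the [k]-th grid point, and [gib]
    against the Gibbs density there. The factor [c0] remains that of the initial law throughout. *)
Let lam k (psi : rT -> R) := (\int[P]_t (psi (X k.+1 t) * H k.+1 t)%:E)%E.
Let gib k (psi : rT -> R) := (c0%:E * \int[mu]_x (psi x * rho k x)%:E)%E.

Let one_step k (psi : rT -> R) : measurable_fun setT psi -> (forall x, 0 <= psi x <= 1) ->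
  let left := (\int[mu]_x (Q k.+1 psi x * (rho k x)%:E))%E in
  let right := (\int[mu]_x (psi x * rho k.+1 x)%:E)%E in
  (left <= right + (C * r ^+ 3)%:E /\ right <= left + (C * r ^+ 3)%:E)%E.
Proof.
move=> mpsi psi01.
have r01 : 0 < r <= 1.
  rewrite sqrtr_gt0 h0/= -sqrtr1 ler_sqrt//; by case/andP: h01.
have /andP[a0 a1] := a01.
have sr2 : s k.+1 ^+ 2 = (1 - a ^+ 2) / (2 * m ^+ 2) by rewrite sqr_s/= mulrC.
have sE : 2 * m ^+ 2 * s k.+1 ^+ 2 = 1 - a ^+ 2.
  by rewrite sr2; field; rewrite gt_eqF.
have a_le : 1 - a <= m ^+ 2 * r ^+ 2.
  rewrite sqr_r /a mulNr; have := onem_expRN_bounds (ltW mh).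
  by case/andP.
have s_le : s k.+1 <= r.
  rewrite -ler_sqr ?nnegrE ?sqrtr_ge0// sr2 sqr_r ler_pdivrMr; last first.
    by rewrite mulr_gt0// exprn_gt0.
  have -> : a ^+ 2 = expR (- (2 * m ^+ 2 * h)).
    by rewrite /a -expRM_natl; congr expR; ring.
  have x0 : 0 <= 2 * m ^+ 2 * h by rewrite !mulr_ge0 ?sqr_ge0// ltW.
  have /andP[_] := onem_expRN_bounds x0.
  by rewrite (mulrC h).
have a01' : 0 <= a <= 1 by rewrite !ltW.
have := one_step_le m_gt0 (s_gt0 k.+1) r01 s_le a01' a_le sE VM vM vL trapezoid
  (pM k) (pM k.+1) mV mv GE mpsi psi01.
rewrite -/C /rho; move=> h'; move: h' => /=.
rewrite /Q /D /w /euler_drift /euler_weight -/a sr2; exact.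
Qed.

Let scale_le (c b : R) (A B : \bar R) : 0 <= c -> (A <= B + b%:E)%E ->
  (c%:E * A <= c%:E * B + (c * b)%:E)%E.
Proof.
move=> c_ge0 AB; rewrite EFinM -muleDr ?fin_num_adde_defl//.
by apply: lee_wpmul2l; rewrite ?lee_fin.
Qed.

(** The induction generalises over [psi]: the last weighted transition is moved onto the test
    function, and [Q k.+1 psi / W] is again measurable with values in [[0, 1]]. The one-step
    estimate then replaces the transition of the Gibbs density by the next Gibbs density. *)
Lemma euler_chain_estimate k (psi : rT -> R) : measurable_fun setT psi ->
  (forall x, 0 <= psi x <= 1) ->
  (lam k psi <= gib k psi + (e k)%:E /\ gib k psi <= lam k psi + (e k)%:E)%E.
Proof.
elim: k psi => [|k IH] psi mpsi psi01.
  by rewrite /lam start// -/(gib 0 psi) /e !mul0r !adde0 lexx.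
pose psi' x := fine (Q k.+1 psi x) / W.
have Wgt0 : 0 < W by exact: lt_le_trans W1.
have QE x : Q k.+1 psi x = (W * psi' x)%:E.
  have /andP[Q0 QW] := Q_bound k.+1 x mpsi psi01.
  rewrite /psi' mulrC divfK ?gt_eqF// fineK// ge0_fin_numE// (le_lt_trans QW)//.
  exact: ltry.
have psi'01 x : 0 <= psi' x <= 1.
  have := Q_bound k.+1 x mpsi psi01; rewrite QE !lee_fin => /andP[q0 q1].
  rewrite -(pmulr_rge0 _ Wgt0) q0/= -(ler_pM2l Wgt0) mulr1//.
have mpsi' : measurable_fun setT (psi' : rT -> R).
  apply: measurable_funM => //; apply: measurableT_comp => //.
  exact: measurable_Q.
have psi'0 x : 0 <= psi' x by have /andP[] := psi'01 x.
have [IH1 IH2] := IH psi' mpsi' psi'01.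
have [st1 st2] := one_step k mpsi psi01.
have rho0 x : 0 <= rho k x by exact: expR_ge0.
have mrho : measurable_fun setT (rho k).
  apply: measurableT_comp => //.
  by apply: measurable_funB; apply: measurable_funM => //; apply: measurable_funX.
have lamE : lam k.+1 psi = (W%:E * lam k psi')%E.
  rewrite /lam step// -ge0_integralZl//.
  - apply: eq_integral => t _; rewrite -/(Q k.+1 psi (X k.+1 t)) QE -!EFinM; congr EFin.
    by rewrite [RHS]mulrA.
  - apply/measurable_EFinP; apply: measurable_funM; last exact: mH.
    exact: measurableT_comp mpsi' (mX k.+1).
  - by move=> t _; rewrite lee_fin mulr_ge0.
have gibE : (W%:E * gib k psi' = c0%:E * \int[mu]_x (Q k.+1 psi x * (rho k x)%:E))%E.
  rewrite /gib muleCA; congr (_ * _)%E; rewrite -ge0_integralZl//.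
  - by apply: eq_integral => x _; rewrite QE -!EFinM; congr EFin; rewrite [LHS]mulrA.
  - by apply/measurable_EFinP; exact: measurable_funM.
  - by move=> t _; rewrite lee_fin mulr_ge0.
have c00 : 0 <= c0 by exact: normal_peak_ge0.
have st1' := scale_le c00 st1; rewrite -gibE in st1'.
have st2' := scale_le c00 st2; rewrite -gibE in st2'.
have IH1' := scale_le W0 IH1; rewrite -lamE in IH1'.
have IH2' := scale_le W0 IH2; rewrite -lamE in IH2'.
have eS : (((c0 * (C * r ^+ 3))%:E + (W * e k)%:E <= (e k.+1)%:E))%E.
  rewrite -EFinD lee_fin /e.
  move: cC_ge0; move: (c0 * (C * r ^+ 3)) => B B0.
  rewrite (_ : k.+1%:R * B * W ^+ k.+1 = B * W ^+ k.+1 + W * (k%:R * B * W ^+ k)).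
    by rewrite lerD2r ler_peMr// exprn_ege1.
  by rewrite -natr1 exprS; ring.
split.
- apply: (le_trans IH1'); apply: (le_trans (leeD2r _ st1')).
  by rewrite -addeA; exact: leeD2l.
- apply: (le_trans st2'); apply: (le_trans (leeD2r _ IH2')).
  by rewrite -addeA (addeC (W * e k)%:E); exact: leeD2l.
Qed.

End euler_chain.

(** * The continuum limit *)

(* The integral of a function that is not measurable is still defined, through
   the nonnegative simple functions below its positive and negative parts. *)
Section nonmeasurable_integrand.
Import HBNNSimple.
Context d (T : measurableType d) (R : realType) (mu : {measure set T -> \bar R}).
Variable N : set T.
Hypothesis mN : measurable N.
Hypothesis N0 : mu N = 0%E.

Let ge0_integral_le (f g : T -> \bar R) :
  (forall x, 0 <= f x)%E -> (forall x, 0 <= g x)%E ->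
  (forall x, ~ N x -> f x = g x) -> (\int[mu]_x f x <= \int[mu]_x g x)%E.
Proof.
move=> f0 g0 fg; rewrite !ge0_integralTE//.
apply: ge_ereal_sup => _ [h hf <-].
(* Cutting a simple function below [f] off the null set keeps its integral and puts it below [g]. *)
pose h' := proj_nnsfun h (measurableC mN).
rewrite -integralT_nnsfun.
have -> : (\int[mu]_x (h x)%:E = \int[mu]_x (h' x)%:E)%E.
  apply: ae_eq_integral => //; [exact/measurable_EFinP|exact/measurable_EFinP|].
  exists N; split => // x /=; apply: contra_notP => Nx _.
  by rewrite mindicE mem_set// mulr1.
rewrite integralT_nnsfun; apply: ereal_sup_ubound; exists h' => // x /=.
rewrite mindicE; have [Nx|Nx] := pselect (N x).
  by rewrite memNset ?mulr0// => /(_ Nx).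
by rewrite mem_set// mulr1 -fg.
Qed.

Lemma eq_integral_negligible (f g : T -> \bar R) :
  (forall x, ~ N x -> f x = g x) -> (\int[mu]_x f x = \int[mu]_x g x)%E.
Proof.
move=> fg; rewrite integralE [RHS]integralE; congr (_ - _)%E; apply/eqP;
  by rewrite eq_le !ge0_integral_le// => x Nx; rewrite ?funeposE ?funenegE fg.
Qed.

End nonmeasurable_integrand.

(** Indicators of closed half-lines are pointwise limits of the continuous ramps of slope [n] that
    reach 1 at [b]. *)
Lemma continuous_test_unique (R : realType)
    (mu nu : {finite_measure set (measurableTypeR R) -> \bar R}) :
  (forall psi : R -> R, continuous psi -> (forall x, 0 <= psi x <= 1) ->
    \int[mu]_x psi x = \int[nu]_x psi x) ->
  forall A, measurable A -> mu A = nu A.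
Proof.
move=> munu; apply: half_line_measure_unique => b; last first.
  by rewrite ltey_eq fin_num_measure.
pose psi (n : nat) (x : R) := Num.max 0 (Num.min 1 (1 + n%:R * (x - b))).
have psi01 n x : 0 <= psi n x <= 1.
  by rewrite /psi le_max lexx ge_max ler01 ge_min lexx.
have cpsi n : continuous (psi n).
  pose g x : R := 1 + n%:R * (x - b).
  have cg : continuous g.
    move=> x; apply: cvgD; first exact: cvg_cst.
    apply: cvgM; first exact: cvg_cst.
    by apply: cvgB; [exact: cvg_id|exact: cvg_cst].
  move=> x.
  have := @continuous_min _ _ (cst 1) g x (@cst_continuous _ _ _ _) (cg x).
  by move=> /(@continuous_max _ _ (cst 0) _ x (@cst_continuous _ _ _ _)).
have cvgpsi x : psi n x @[n --> \oo] --> (\1_(`[b, +oo[%classic) x : R).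
  rewrite indicE; have [bx|xb] := leP b x.
    rewrite mem_set/=; last by rewrite in_itv/= bx.
    rewrite (_ : psi ^~ x = cst 1); first exact: cvg_cst.
    apply/funext => n; rewrite /psi min_l ?max_r//.
    by rewrite lerDl mulr_ge0// subr_ge0.
  rewrite memNset/=; last by rewrite /= in_itv/= andbT; apply/negP; rewrite -ltNge.
  apply/cvgrPdist_le => e e0.
  near=> n.
  have bx : 0 < b - x by rewrite subr_gt0.
  have le0 : Num.min 1 (1 + n%:R * (x - b)) <= 0.
    rewrite ge_min; apply/orP; right.
    have h : (b - x)^-1 <= n%:R by near: n; exact: nbhs_infty_ger.
    have := ler_wpM2r (ltW bx) h; rewrite mulVf ?gt_eqF//; lra.
  by rewrite sub0r normrN /psi max_l// normr0 ltW.
have cvgi (mu' : {finite_measure set (measurableTypeR R) -> \bar R}) :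
    \int[mu']_x psi n x @[n --> \oo] --> fine (mu' `[b, +oo[%classic).
  rewrite (_ : fine _ = \int[mu']_x (\1_(`[b, +oo[%classic) x)); last first.
    by rewrite /Rintegral integral_indic// setIT.
  apply: (@Rintegral_dominated_cvg _ (measurableTypeR R) R mu' psi
    (\1_(`[b, +oo[%classic)) (cst 1)).
  - by move=> n; exact: continuous_measurable_fun.
  - exact: measurable_indic.
  - by apply: aeW => x; exact: cvgpsi.
  - exact: finite_measure_integrable_cst.
  - apply: aeW => x n; have /andP[? ?] := psi01 n x; by rewrite ger0_norm.
have hE n : \int[mu]_x psi n x = \int[nu]_x psi n x by exact: munu.
have cmu := cvgi mu; rewrite (funext hE) in cmu.
have := congr1 EFin (cvg_unique (@Rhausdorff R) cmu (cvgi nu)).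
by rewrite !fineK ?fin_num_measure//; apply.
Unshelve. all: by end_near. Qed.

Section compact_support.
Context (R : realType).
Implicit Types (g : R -> R) (tau : R).

Lemma smooth_is_derive g (n : nat) (x : R) : smooth g ->
  is_derive x 1 (g^`(n))%classic ((g^`(n.+1))%classic x).
Proof. by move=> sg; split; [exact: sg|rewrite derive1nS derive1E]. Qed.

Lemma compactly_supported_eq0 g : compactly_supported g ->
  exists2 tau, 0 < tau & forall t, tau <= `|t| -> g t = 0.
Proof.
move=> /compact_bounded[M [_ gM]].
(* Any number above [M] bounds the support, for instance [Num.max M 0 + 1]; the second unit makes
   the contradiction strict. *)
exists (Num.max M 0 + 2); first by rewrite ltr_wpDl// le_max lexx orbT.
move=> t tM; apply/eqP/negPn/negP => gt0.
have : M < Num.max M 0 + 1 by rewrite ltr_pwDr// le_max lexx.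
move=> /gM/(_ t (@subset_closure _ _ t gt0)) tM'.
by have := le_trans tM tM'; rewrite lerD2l; lra.
Qed.

Lemma derive1_support g tau (t : R) : (forall u, tau <= `|u| -> g u = 0) ->
  tau < `|t| -> (g^`())%classic t = 0.
Proof.
move=> g0 tt; rewrite derive1E.
rewrite (@near_eq_derive _ _ _ g (cst 0)) ?derive_cst//.
have : \forall u \near t, tau < `|u|.
  have := @norm_continuous _ _ t.
  by move=> /(_ _ (lt_nbhsr tt)).
by apply: filterS => u /ltW; exact: g0.
Qed.

Lemma support_bounded g tau : 0 < tau -> continuous g ->
  (forall t, tau < `|t| -> g t = 0) -> exists M, forall t, `|g t| <= M.
Proof.
move=> tau0 cg g0.
have tau1 : - tau <= tau by lra.
have [|c _ cM] := @EVT_max R (fun t => `|g t|) (- tau) tau tau1.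
  apply: continuous_subspaceT => t; apply: continuous_comp; first exact: cg.
  exact: norm_continuous.
exists `|g c| => t; have [tt|tt] := leP `|t| tau.
  by apply: cM; rewrite in_itv/= -ler_norml.
by rewrite g0// normr0.
Qed.

End compact_support.

Section gibbs_density.
Context (R : realType) (m M : R) (V : R -> R).
Hypothesis m_gt0 : 0 < m.
Hypothesis VM : forall x, `|V x| <= M.
Hypothesis mV : measurable_fun setT V.
Local Notation mu := (@lebesgue_measure R).
Let g (x : R) := expR (- m ^+ 2 * x ^+ 2 - 2 * V x).
Let s := Num.sqrt (2 * m ^+ 2)^-1.
Let p := normal_pdf 0 s.

Let s_gt0 : 0 < s.
Proof. by rewrite sqrtr_gt0 invr_gt0 mulr_gt0// exprn_gt0. Qed.

(** The Gibbs density is a Gaussian density times a factor bounded above and away from 0: the upper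
    bound gives integrability, the lower one a positive total mass. *)
Let gE x : g x = expR (- 2 * V x) / normal_peak s * p x.
Proof.
have s2 : s ^+ 2 = (2 * m ^+ 2)^-1.
  by rewrite sqr_sqrtr// invr_ge0 mulr_ge0// sqr_ge0.
rewrite /p normal_pdf_expR ?gt_eqF// mulrA divfK ?gt_eqF ?normal_peak_gt0 ?gt_eqF//.
rewrite -expRD /g s2; congr expR; field; rewrite gt_eqF//.
Qed.

Let pk : 0 < normal_peak s. Proof. by rewrite normal_peak_gt0// gt_eqF. Qed.

Let pkV : 0 < (normal_peak s)^-1. Proof. by rewrite (invr_gt0 (normal_peak s)). Qed.

Let p0 x : 0 <= p x. Proof. exact: normal_pdf_ge0. Qed.

Let V_bounds x : expR (- 2 * M) <= expR (- 2 * V x) <= expR (2 * M).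
Proof.
by have := VM x; rewrite ler_norml !ler_expR => /andP[? ?]; apply/andP; split; lra.
Qed.

Lemma measurable_gibbs : measurable_fun setT g.
Proof.
by apply: measurableT_comp => //; apply: measurable_funB; apply: measurable_funM.
Qed.

Let integrable_p : mu.-integrable setT (EFin \o p).
Proof. by apply: integrable_normal_pdf; rewrite gt_eqF. Qed.

Lemma integrable_bounded_gibbs (F : R -> R) (K : R) : measurable_fun setT F ->
  (forall x, `|F x| <= K) -> mu.-integrable setT (EFin \o (fun x => F x * g x)).
Proof.
move=> mF FK.
apply: (@le_integrable _ _ R mu setT measurableT _
  (EFin \o (fun x => K * (expR (2 * M) / normal_peak s) * p x))).
- by apply/measurable_EFinP; apply: measurable_funM => //; exact: measurable_gibbs.
- move=> x _; rewrite /= lee_fin.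
  have K0 : 0 <= K by exact: le_trans (FK x).
  have h : 0 <= expR (2 * M) / normal_peak s by rewrite divr_ge0 ?expR_ge0 ?ltW.
  rewrite (ger0_norm (mulr_ge0 (mulr_ge0 K0 h) (p0 x))) -[leRHS]mulrA normrM.
  apply: ler_pM => //.
  rewrite ger0_norm ?expR_ge0// gE ler_wpM2r// ler_pM2r//.
  by have /andP[] := V_bounds x.
- by have := integrableZl measurableT (K * (expR (2 * M) / normal_peak s)) integrable_p.
Qed.

Lemma Rintegral_gibbs_gt0 : 0 < \int[mu]_x g x.
Proof.
have ig : mu.-integrable setT (EFin \o g).
  have := @integrable_bounded_gibbs (cst 1) 1 (@measurable_cst _ _ _ _ _ _).
  by rewrite /comp; under eq_fun do rewrite mul1r; apply => x; rewrite normr1.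
apply: (@lt_le_trans _ _ (\int[mu]_x (expR (- 2 * M) / normal_peak s * p x))).
  rewrite RintegralZl// [X in _ * X](_ : _ = 1) ?mulr1; first exact: mulr_gt0 (expR_gt0 _) pkV.
  by rewrite /Rintegral integral_normal_pdf// gt_eqF.
apply: le_Rintegral => //.
  by have := integrableZl measurableT (expR (- 2 * M) / normal_peak s) integrable_p.
move=> x _; rewrite gE ler_wpM2r// ler_pM2r//.
by have /andP[] := V_bounds x.
Qed.

End gibbs_density.

Section continuum_limit.
Context d (T : measurableType d) (R : realType) (P : probability T R).
Variables (m tau M : R) (f f' V v v' v'' : R -> R).
Variables (xi : (R -> R) -> {RV P >-> R}) (ou phi : R -> {RV P >-> R}) (N0 : set T).
Hypothesis m_gt0 : 0 < m.
Hypothesis tau_gt0 : 0 < tau.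
Hypothesis df : forall x : R, is_derive x 1 f (f' x).
Hypothesis cf' : continuous f'.
Hypothesis f0 : forall t, tau <= `|t| -> f t = 0.
Hypothesis f'0 : forall t, tau < `|t| -> f' t = 0.
Hypothesis f1 : f 0 = 1.
Hypothesis fM : forall t, `|f t| <= M.
Hypothesis f'M : forall t, `|f' t| <= M.
Hypothesis dV : forall x : R, is_derive x 1 V (v x).
Hypothesis dv : forall x : R, is_derive x 1 v (v' x).
Hypothesis dv' : forall x : R, is_derive x 1 v' (v'' x).
Hypothesis VM : forall x, `|V x| <= M.
Hypothesis vM : forall x, `|v x| <= M.
Hypothesis v'M : forall x, `|v' x| <= M.
Hypothesis v''M : forall x, `|v'' x| <= M.
Hypothesis xi_white_noise : white_noise xi.
Hypothesis ouE : forall t, {ae P, forall w, ou t w = xi (fun s => OU_kernel m (t - s)) w}.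
Hypothesis mN0 : measurable N0.
Hypothesis PN0 : P N0 = 0%E.
Hypothesis cphi : forall w, ~ N0 w -> continuous (fun t : R => phi t w).
Hypothesis sol : forall w, ~ N0 w -> forall t : R,
  phi t w + convolution (OU_kernel m) (fun s => f s * v (phi s w)) t = ou t w.

Local Notation mu := (@lebesgue_measure R).
Let c0 := normal_peak (Num.sqrt (2 * m ^+ 2)^-1).
Let gibbs (x : R) := expR (- m ^+ 2 * x ^+ 2 - 2 * V x).

(* The weight of the theorem need not be a measurable function of [w]; off a
   measurable null set it is a limit of measurable weights. *)
Definition good_weight (w : T) : R :=
  expR (- 2 * \int[mu]_(s in `]-oo, 0%R]) (f' s * V (phi s w))) * \1_(~` N0) w.

Let h (n : nat) := tau / n.+1%:R.
Let t (n k : nat) := - tau + k%:R * h n.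
Let p (n k : nat) := f (t n k).
Let y n (w : T) := innovation (fun k => ou (t n k) w) (expR (- m ^+ 2 * h n)).
Let D n := euler_drift m (h n) (p n) v.
Let w_ n := euler_weight (p n) V.
Let X n (w : T) := chain (D n) (y n w) n.+2.
Let H n (w : T) := chain_weight (D n) (w_ n) (y n w) n.+2.
(** There are [n.+2] weights, each at most [expR (2 * M ^+ 2 * h n)], and [h n <= tau]; the
    resulting bound is uniform in [n] and serves for domination. *)
Let B := expR (4 * M ^+ 2 * tau).

Let M0 : 0 <= M. Proof. exact: le_trans (VM 0). Qed.

Let cV : continuous V. Proof. exact: is_derive_continuous dV. Qed.
Let cv : continuous v. Proof. exact: is_derive_continuous dv. Qed.
Let mV : measurable_fun setT V. Proof. exact: continuous_measurable_fun. Qed.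
Let mv : measurable_fun setT v. Proof. exact: continuous_measurable_fun. Qed.

Let h_gt0 n : 0 < h n. Proof. by rewrite divr_gt0. Qed.

Let nh n : n.+1%:R * h n = tau. Proof. by rewrite /h mulrC divfK. Qed.

Let tn n : t n n.+1 = 0. Proof. by rewrite /t nh addNr. Qed.

Let dp n k : `|p n k.+1 - p n k| <= M * h n.
Proof.
have [c [_ _ ->]] := mean_value df (t n k) (t n k.+1).
rewrite (_ : t n k.+1 - t n k = h n); last by rewrite /t -natr1; ring.
by rewrite normrM (gtr0_norm (h_gt0 n)) ler_wpM2r// ltW.
Qed.

Let my n k : measurable_fun setT (fun w => y n w k).
Proof.
apply: (@measurable_innovation _ _ _ (fun k w => ou (t n k) w)) => j.
exact: measurable_funPT.
Qed.

Let mX n : measurable_fun setT (X n).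
Proof.
apply: (@measurable_chain _ _ _ (fun k w => y n w k) (D n)) => //.
by move=> k; exact: measurable_euler_drift.
Qed.

Let mH n : measurable_fun setT (H n).
Proof.
apply: (@measurable_chain_weight _ _ _ (fun k w => y n w k) (D n) (w_ n)) => //.
- by move=> k; exact: measurable_euler_drift.
- by move=> k; exact: measurable_euler_weight.
Qed.

Let H_bound n w : 0 <= H n w <= B.
Proof.
have wb k x : 0 <= w_ n k x <= expR (2 * M ^+ 2 * h n).
  by apply: euler_weight_bound => //; rewrite ltW.
have /andP[h0 h1] := chain_weight_bound (fun k w => y n w k) (D n) wb n.+2 w.
rewrite /H h0/= (le_trans h1)// -expRM_natl /B ler_expR.
have := nh n; rewrite -[n.+2%:R]natr1.
have hn : h n <= tau.
  by rewrite -[leRHS](nh n); apply: ler_peMl; [exact: ltW|rewrite ler1n].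
move=> E; have -> : (n.+1%:R + 1) * (2 * M ^+ 2 * h n) = 2 * M ^+ 2 * (tau + h n).
  by rewrite -E; ring.
rewrite (_ : 4 * M ^+ 2 * tau = 2 * M ^+ 2 * (tau + tau)); last by ring.
by rewrite ler_wpM2l ?lerD2l// mulr_ge0 ?sqr_ge0.
Qed.

Let f0' u : u <= - tau -> f u = 0.
Proof.
move=> ut; apply: f0; rewrite ler0_norm; first by rewrite lerNr.
by rewrite (le_trans ut)// oppr_le0 ltW.
Qed.

Let f'0' u : u < - tau -> f' u = 0.
Proof.
move=> ut; apply: f'0; rewrite ltr0_norm; first by rewrite ltrNr.
by rewrite (lt_trans ut)// oppr_lt0.
Qed.

Let X_cvg w : ~ N0 w -> X n w @[n --> \oo] --> phi 0 w.
Proof.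
move=> Nw; exact (@chain_cvg R m tau M f f' V v v' (fun t => ou t w) (fun t => phi t w)
  m_gt0 tau_gt0 df f0' (fun u _ => fM u) dv VM vM v'M (cphi Nw) (sol Nw)).
Qed.

Let H_cvg w : ~ N0 w -> H n w @[n --> \oo] -->
  expR (- 2 * \int[mu]_(s in `]-oo, 0%R]) (f' s * V (phi s w))).
Proof.
move=> Nw; exact (@chain_weight_cvg R m tau M f f' V v v' (fun t => ou t w)
  (fun t => phi t w) m_gt0 tau_gt0 df cf' f0' f'0' (fun u _ => fM u) (fun u _ => f'M u)
  dV dv VM vM v'M (cphi Nw) (sol Nw)).
Qed.

Let good_weight_cvg w : H n w * \1_(~` N0) w @[n --> \oo] --> good_weight w.
Proof.
rewrite /good_weight indicE; have [Nw|Nw] := pselect (N0 w).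
  rewrite memNset; last by apply.
  by under eq_fun do rewrite mulr0; rewrite mulr0; exact: cvg_cst.
by apply: cvgM; [exact: H_cvg|exact: cvg_cst].
Qed.

Lemma measurable_good_weight : measurable_fun setT good_weight.
Proof.
apply: (measurable_fun_cvg (h := fun n w => H n w * \1_(~` N0) w)).
- move=> n; apply: measurable_funM => //; apply: measurable_indic.
  exact: measurableC.
- by move=> w _; exact: good_weight_cvg.
Qed.

Lemma good_weight_ge0 w : 0 <= good_weight w.
Proof. by rewrite mulr_ge0 ?expR_ge0// indicE. Qed.

Lemma good_weight_le w : good_weight w <= B.
Proof.
have h1 n : H n w * \1_(~` N0) w <= B.
  have /andP[H0 HB] := H_bound n w.
  by rewrite (le_trans _ HB)// ler_piMr// indicE lern1 leq_b1.
have := good_weight_cvg (w := w) => ch.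
rewrite -(cvg_lim (@Rhausdorff R) ch).
apply: limr_le; first by apply/cvg_ex; exists (good_weight w).
exact: nearW.
Qed.

Section test_function.
Variable psi : R -> R.
Hypothesis cpsi : continuous psi.
Hypothesis psi01 : forall x, 0 <= psi x <= 1.

Let psi_norm x : `|psi x| <= 1.
Proof. by have /andP[? ?] := psi01 x; rewrite ger0_norm. Qed.

Let mpsi : measurable_fun setT psi. Proof. exact: continuous_measurable_fun. Qed.

Let E n := \int[P]_w (psi (X n w) * H n w).

Let mE n : measurable_fun setT (fun w => psi (X n w) * H n w).
Proof. by apply: measurable_funM => //; exact: measurableT_comp. Qed.

Let E_norm n w : `|psi (X n w) * H n w| <= B.
Proof.
have /andP[H0 HB] := H_bound n w.
by rewrite normrM -[leRHS]mul1r ler_pM// ger0_norm.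
Qed.

Let E_cvg : E n @[n --> \oo] --> \int[P]_w (psi (phi 0 w) * good_weight w).
Proof.
apply: (@Rintegral_dominated_cvg _ T R P (fun n w => psi (X n w) * H n w)
  (fun w => psi (phi 0 w) * good_weight w) (cst B)).
- exact: mE.
- apply: measurable_funM; last exact: measurable_good_weight.
  by apply: measurableT_comp => //; exact: measurable_funPT.
- exists N0; split => // w /=; apply: contra_notP => Nw.
  apply: cvgM.
    by apply: continuous_cvg; [exact: cpsi|exact: X_cvg].
  by rewrite /good_weight indicE mem_set// mulr1; exact: H_cvg.
- exact: finite_measure_integrable_cst.
- by apply: aeW => w n; exact: E_norm.
Qed.

Let I := \int[mu]_x (psi x * gibbs x).

Let E_estimate : exists K, \forall n \near \oo, `|c0 * I - E n| <= K * Num.sqrt (h n).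
Proof.
have [G GE] := gaussian_expR_norm m_gt0.
(* [n.+1] errors of size [Num.sqrt (h n) ^+ 3], amplified by [expR (2 * M ^+ 2 * h n)] per step:
   since [n.+1%:R * h n = tau], a single factor [Num.sqrt (h n)] is left. *)
exists (tau * (c0 * one_step_constant m M G) * expR (2 * M ^+ 2 * tau)).
have h_cvg0 : h n @[n --> \oo] --> (0 : R).
  by rewrite -(mulr0 tau); apply: cvgM; [exact: cvg_cst|exact: cvg_harmonic].
move/cvgr0_norm_le : h_cvg0 => /(_ _ ltr01); apply: filterS => n hn1.
have h01 : 0 < h n <= 1 by rewrite h_gt0 (le_trans (ler_norm _)).
have p0 : p n 0 = 0 by rewrite /p /t mul0r addr0 f0'.
have vL a b : `|v b - v a| <= M * `|b - a|.
  by have [c [_ _ ->]] := mean_value dv a b; rewrite normrM ler_wpM2r.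
have tr := trapezoid_rule dV dv dv' v''M.
have cosY := white_noise_innovation_cos (- tau) m_gt0 (ltW (h_gt0 n)) xi_white_noise ouE.
have [e1 e2] := @euler_chain_estimate d T R P m (h n) M G (p n) V v (fun k w => y n w k)
  m_gt0 h01 p0 (fun k => fM _) (dp n) VM vM vL tr mV mv GE (my n) cosY n.+1 psi mpsi psi01.
have EE : (\int[P]_w (psi (X n w) * H n w)%:E = (E n)%:E)%E.
  exact: EFin_bounded_Rintegral (mE n) (E_norm n).
have IE : (\int[mu]_x (psi x * expR (- m ^+ 2 * x ^+ 2 - 2 * p n n.+1 * V x))%:E = I%:E)%E.
  rewrite /p tn f1 mulr1 /I /Rintegral fineK//.
  apply: integrable_fin_num => //.
  exact: (integrable_bounded_gibbs m_gt0 VM mV mpsi psi_norm).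
rewrite /X /H in EE; rewrite EE IE -EFinM -EFinD lee_fin in e1.
rewrite EE IE -EFinM -EFinD lee_fin in e2.
set K := (K in _ <= K); set e := (e in _ <= _ + e) in e1.
have -> : K = e.
  rewrite /K /e -expRM_natl (_ : 2 * M ^+ 2 * tau = n.+1%:R * (2 * M ^+ 2 * h n)).
    have tauE : tau = n.+1%:R * Num.sqrt (h n) ^+ 2 by rewrite sqr_sqrtr ?nh// ltW.
    have key (c k x : R) : tau * (c * k) * x * Num.sqrt (h n) =
        n.+1%:R * (c * (k * Num.sqrt (h n) ^+ 3)) * x.
      by move: (Num.sqrt (h n)) tauE => r ->; ring.
    exact: key.
  by rewrite -(nh n); ring.
have : E n <= c0 * I + e /\ c0 * I <= E n + e by split; [exact: e1|exact: e2].
clear e1 e2; move: (E n) (c0 * I) (e) => x z e' [? ?].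
by rewrite ler_norml; apply/andP; split; lra.
Qed.

Lemma continuous_test_limit :
  \int[P]_w (psi (phi 0 w) * good_weight w) = c0 * \int[mu]_x (psi x * gibbs x).
Proof.
have [K KE] := E_estimate.
have e0 : K * Num.sqrt (h n) @[n --> \oo] --> (0 : R).
  have h_cvg0 : h n @[n --> \oo] --> (0 : R).
    by rewrite -(mulr0 tau); apply: cvgM; [exact: cvg_cst|exact: cvg_harmonic].
  rewrite -(mulr0 K); apply: cvgM; first exact: cvg_cst.
  rewrite -(@sqrtr0 R); apply: continuous_cvg => //; exact: sqrt_continuous.
have E2 : E n @[n --> \oo] --> c0 * I.
  apply/cvgrPdist_le => eps eps0.
  move/cvgr0_norm_le : e0 => /(_ _ eps0) e1.
  near=> n.
  apply: (@le_trans _ _ (K * Num.sqrt (h n))); first by near: n.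
  by rewrite (le_trans (ler_norm _))//; near: n.
exact: (cvg_unique (@Rhausdorff R) E_cvg E2).
Unshelve. all: by end_near. Qed.

End test_function.

End continuum_limit.

Theorem theorem1 (R : realType) (d : measure_display) (T : measurableType d)
    (P : probability T R) (m : R) (f V : R -> R)
    (xi : (R -> R) -> {RV P >-> R}) (ou phi : R -> {RV P >-> R})
    (m_gt0 : 0 < m)
    (f_smooth : smooth f)
    (f_supp : compactly_supported f)
    (f_ge0 : forall t : R, 0 <= f t)
    (f_even : forall t : R, f (- t) = f t)
    (f0 : f 0 = 1)
    (V_smooth : smooth V)
    (V_bounded : forall n : nat, bounded_fct (V^`(n))%classic)
    (xi_white_noise : white_noise xi)
    (ou_OU : stationary_OU m xi ou)
    (phi_sol : mild_solution m f V ou phi) :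
  let weight (w : T) : R :=
    expR (- 2 * \int[@lebesgue_measure R]_(t in `]-oo, 0%R])
                  ((f^`())%classic t * V (phi t w))) in
  let gibbs (x : R) : R := expR (- m ^+ 2 * x ^+ 2 - 2 * V x) in
  let Z : R := fine ('E_P[weight])%E / \int[@lebesgue_measure R]_x gibbs x in
  forall F : R -> R, measurable_fun setT F -> bounded_fct F ->
    ('E_P[fun w => (F (phi 0 w) * weight w)%R])%E =
      (Z * \int[@lebesgue_measure R]_x (F x * gibbs x))%:E.
Proof.
move=> weight gibbs Z F mF [K FK].
have [tau tau_gt0 f_out] := compactly_supported_eq0 f_supp.
have df (x : R) : is_derive x 1 f ((f^`())%classic x).
  exact: (smooth_is_derive 0 x f_smooth).
have df' (x : R) : is_derive x 1 (f^`())%classic ((f^`(2))%classic x).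
  exact: (smooth_is_derive 1 x f_smooth).
have dV (x : R) : is_derive x 1 V ((V^`())%classic x).
  exact: (smooth_is_derive 0 x V_smooth).
have dv (x : R) : is_derive x 1 (V^`())%classic ((V^`(2))%classic x).
  exact: (smooth_is_derive 1 x V_smooth).
have dv' (x : R) : is_derive x 1 (V^`(2))%classic ((V^`(3))%classic x).
  exact: (smooth_is_derive 2 x V_smooth).
have cf := is_derive_continuous df.
have cf' := is_derive_continuous df'.
have f'_out t : tau < `|t| -> (f^`())%classic t = 0 by exact: derive1_support.
have [Mf fM] := support_bounded tau_gt0 cf (fun t tt => f_out t (ltW tt)).
have [Mf' f'M] := support_bounded tau_gt0 cf' f'_out.
have [M0 VM] := V_bounded 0%N.
have [M1 vM] := V_bounded 1%N.
have [M2 v'M] := V_bounded 2%N.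
have [M3 v''M] := V_bounded 3%N.
pose M := Mf + Mf' + M0 + M1 + M2 + M3.
have Mf_ge0 : 0 <= Mf by exact: le_trans (fM 0).
have Mf'_ge0 : 0 <= Mf' by exact: le_trans (f'M 0).
have M0_ge0 : 0 <= M0 by exact: le_trans (VM 0).
have M1_ge0 : 0 <= M1 by exact: le_trans (vM 0).
have M2_ge0 : 0 <= M2 by exact: le_trans (v'M 0).
have M3_ge0 : 0 <= M3 by exact: le_trans (v''M 0).
have {}fM t : `|f t| <= M by rewrite (le_trans (fM t))// /M; lra.
have {}f'M t : `|(f^`())%classic t| <= M by rewrite (le_trans (f'M t))// /M; lra.
have {}VM x : `|V x| <= M by rewrite (le_trans (VM x))// /M; lra.
have {}vM x : `|(V^`())%classic x| <= M by rewrite (le_trans (vM x))// /M; lra.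
have {}v'M x : `|(V^`(2))%classic x| <= M by rewrite (le_trans (v'M x))// /M; lra.
have {}v''M x : `|(V^`(3))%classic x| <= M by rewrite (le_trans (v''M x))// /M; lra.
have mV : measurable_fun setT V.
  by apply: continuous_measurable_fun; exact: is_derive_continuous dV.
(* A single measurable null set, off which the path is continuous and solves the equation at all
   times. *)
have [N0 [mN0 PN0 N0P]] := filterI phi_sol.1 phi_sol.2.
have cphi w : ~ N0 w -> continuous (fun t : R => phi t w).
  by move=> Nw; apply: contrapT => h; apply: Nw; apply: N0P => -[/= ? _]; exact: h.
have sol w : ~ N0 w -> forall t : R, phi t w +
    convolution (OU_kernel m) (fun s => f s * (V^`())%classic (phi s w)) t = ou t w.
  by move=> Nw; apply: contrapT => h; apply: Nw; apply: N0P => -[/= _ ?]; exact: h.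
have mphi : measurable_fun setT (phi 0) by exact: measurable_funPT.
(* The normalisation of the stationary Gaussian density, that is [m] divided by the square root of
   [pi]. *)
pose c0 := normal_peak (Num.sqrt (2 * m ^+ 2)^-1).
have c0_ge0 : 0 <= c0 by exact: normal_peak_ge0.
pose good := good_weight (f^`())%classic V phi N0.
have mgood : measurable_fun setT good.
  exact: (@measurable_good_weight _ _ _ P m tau M f (f^`())%classic V _ _ ou phi N0
    m_gt0 tau_gt0 df cf' f_out f'_out fM f'M dV dv VM vM v'M mN0 cphi sol).
have good_ge0 w : 0 <= good w by exact: good_weight_ge0.
have good_le w : good w <= expR (4 * M ^+ 2 * tau).
  exact: (@good_weight_le _ _ _ P m tau M f (f^`())%classic V _ _ ou phi N0
    m_gt0 tau_gt0 df cf' f_out f'_out fM f'M dV dv VM vM v'M cphi sol).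
have test := @continuous_test_limit _ _ _ P m tau M f (f^`())%classic V _ _ _ xi ou phi N0
  m_gt0 tau_gt0 df cf' f_out f'_out f0 fM f'M dV dv dv' VM vM v'M v''M xi_white_noise
  ou_OU.2 mN0 PN0 cphi sol.
have mgibbs : measurable_fun setT gibbs by exact: measurable_gibbs.
have igibbs (G : R -> R) (L : R) : measurable_fun setT G -> (forall x, `|G x| <= L) ->
    lebesgue_measure.-integrable setT (EFin \o (fun x => G x * gibbs x)).
  exact: integrable_bounded_gibbs.
have gibbsZ (G : R -> R) (L : R) : measurable_fun setT G -> (forall x, `|G x| <= L) ->
    (\int[@lebesgue_measure R]_x ((G x)%:E * (c0 * gibbs x)%:E) =
     (c0 * \int[@lebesgue_measure R]_x (G x * gibbs x))%:E)%E.
  move=> mG GL; rewrite -RintegralZl//; last exact: (igibbs _ L).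
  rewrite /Rintegral fineK; last first.
    apply: integrable_fin_num => //.
    by have := integrableZl measurableT c0 (igibbs _ _ mG GL).
  by apply: eq_integral => x _; rewrite -EFinM; congr EFin; rewrite mulrCA.
(* [nu1] is the weighted law of [phi 0] and [nu2] is [c0] times the Gibbs measure. As finite
   measures, they coincide as soon as they agree on continuous functions with values in [[0, 1]]. *)
have [nu1 nu1E] : exists nu : {finite_measure set (measurableTypeR R) -> \bar R},
    forall f : measurableTypeR R -> \bar R, measurable_fun setT f ->
    (\int[nu]_y f y = \int[P]_w (f (phi 0%R w) * (good w)%:E))%E.
  apply: (@weighted_image _ _ _ (measurableTypeR R) R P good (phi 0)) => //.
  rewrite (@EFin_bounded_Rintegral _ _ _ P good (expR (4 * M ^+ 2 * tau)))// ?ltry//.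
  by move=> w; rewrite ger0_norm.
have [nu2 nu2E] : exists nu : {finite_measure set (measurableTypeR R) -> \bar R},
    forall f : measurableTypeR R -> \bar R, measurable_fun setT f ->
    (\int[nu]_y f y = \int[@lebesgue_measure R]_x (f x * (c0 * gibbs x)%:E))%E.
  apply: (@weighted_image _ _ _ (measurableTypeR R) R lebesgue_measure
    (fun x => c0 * gibbs x) id) => //.
  - exact: measurable_funM.
  - by move=> x; rewrite mulr_ge0// expR_ge0.
  - rewrite (_ : (\int[_]_x _)%E = \int[@lebesgue_measure R]_x
        ((cst 1 x)%:E * (c0 * gibbs x)%:E))%E; last first.
      by apply: eq_integral => x _; rewrite mul1e.
    by rewrite (gibbsZ (cst 1) 1) ?ltry// => x; rewrite normr1.
have nuE (A : set (measurableTypeR R)) : measurable A -> nu1 A = nu2 A.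
  apply: continuous_test_unique => psi cpsi psi01.
  have mpsi : measurable_fun setT psi by exact: continuous_measurable_fun.
  rewrite /Rintegral nu1E; last exact/measurable_EFinP.
  rewrite nu2E; last exact/measurable_EFinP.
  rewrite (gibbsZ psi 1)//; last first.
    by move=> x; have /andP[? ?] := psi01 x; rewrite ger0_norm.
  rewrite [RHS]/= -test//.
have main (G : R -> R) (L : R) : measurable_fun setT G -> (forall x, `|G x| <= L) ->
    ('E_P[fun w => (G (phi 0 w) * weight w)%R] =
     (c0 * \int[@lebesgue_measure R]_x (G x * gibbs x))%:E)%E.
  move=> mG GL; rewrite unlock -(gibbsZ G L)// -(nu2E (EFin \o G)); last exact/measurable_EFinP.
  transitivity (\int[P]_w ((G (phi 0%R w))%:E * (good w)%:E))%E.
    apply: (eq_integral_negligible mN0 PN0) => w Nw.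
    by rewrite -EFinM /good /good_weight indicE mem_set// mulr1.
  rewrite -(nu1E (EFin \o G)); last exact/measurable_EFinP.
  by apply: eq_measure_integral => A mA _; exact: nuE.
have ZE : Z = c0.
  rewrite /Z (_ : weight = fun w => cst 1 (phi 0 w) * weight w); last first.
    by apply/funext => w; rewrite mul1r.
  rewrite (main (cst 1) 1)//; last by move=> x; rewrite normr1.
  rewrite /=; under eq_Rintegral do rewrite mul1r.
  by rewrite mulfK// gt_eqF// (Rintegral_gibbs_gt0 m_gt0 VM).
by rewrite ZE; exact: (main F K).
Qed.
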